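(* Let $L$ be an algebraically closed field with $\mathrm{char}(L)\neq 2$. Let $F\in L[X,Y]$ be an irreducible polynomial defining an irreducible plane algebraic curve $C$ with an ordinary double point at $(0,0)$, and suppose that the $Y$-axis (the line $X=0$) is distinct from the two tangent directions of this ordinary double point. Let $\eta_1(X),\eta_2(X)\in L[[X]]$ be the power series, with $\eta_1(0)=\eta_2(0)=0$ and $\eta_1'(0)\neq\eta_2'(0)$, such that $F(X,Y)=U(X,Y)(Y-\eta_1(X))(Y-\eta_2(X))$ in $L[[X,Y]]$ for some $U\in L[[X,Y]]$ with $U(0,0)\neq 0$. Then the two branches $\gamma_1,\gamma_2$ of $C$ centred at $(0,0)$ can be numbered so that, for every plane (possibly not irreducible) algebraic curve $H(X,Y)=0$ with $H(0,0)=0$, the following hold: (i) $H(T,\eta_j(T))\equiv 0$ for $j=1$ or $j=2$ if and only if $H$ contains $C$ as a component; (ii) if $H$ does not contain $C$ as a component, then $\mathrm{ord}_T\, H(T,\eta_j(T))=I_{\gamma_j}(C,H)$ for $j\in\{1,2\}$.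
   Context: Ordinary double point: for a nonzero $F\in L[X,Y]$ of degree $n$ with $F(0,0)=0$, the point $(0,0)$ is an ordinary double point of $F$ if $F=F_2+\dots+F_n$ with each $F_j$ homogeneous of degree $j$, $F_2\neq 0$, and the two linear factors of $F_2$ are distinct (non-proportional). The tangent directions are the two lines through $(0,0)$ given by the linear factors of $F_2$. The power series $\eta_1,\eta_2$ of the claim exist under the stated hypotheses. A plane algebraic curve $H$ is given by a nonconstant polynomial $H(X,Y)\in L[X,Y]$; it contains $C$ as a component if $F$ divides $H$. Infinitesimal neighbourhoods: fix an algebraically closed extension $K\supset L$ of infinite transcendence degree with a valuation ring $\mathcal{O}\supset L$ of $K$ with fraction field $K$ and maximal ideal $\mathfrak{m}\neq 0$ such that $L\to\mathcal{O}/\mathfrak{m}$ is an isomorphism. Reduction modulo $\mathfrak{m}$ gives specialisation maps $P^n(K)\to P^n(L)$. For a point $p$ over $L$, $\mathcal{V}_p$ denotes the set of $K$-points specialising to $p$. Generic means generic over $L$. Branches: let $\Phi:C^{ns}\to \overline{C}$ be the normalisation (nonsingular model) of the projective closure $\overline{C}\subset P^2$ of $C$. The branches of $C$ centred at a point $p$ are in bijection with the points of $\Phi^{-1}(p)$; the branch corresponding to $p_j\in \Phi^{-1}(p)$ is (the image under $\Phi$ of) $C^{ns}\cap\mathcal{V}_{p_j}$. For an ordinary double point of an irreducible curve there are exactly two branches. Branched intersection multiplicity: let $H$ be a plane curve of degree $e$ not containing $C$ as a component, and let $\gamma$ be the branch of $C$ corresponding to $p_\gamma\in C^{ns}$. Let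 $\Sigma$ be a linear system of plane curves $\{H_{\bar v}:\bar v\in Par_\Sigma\}$ of degree $e$ (with $Par_\Sigma$ a projective space), maximal among linear systems all of whose members have finite intersection with $C$, and containing $H=H_{\bar v_0}$. Let $\overline{H_{\bar v}}=\Phi^{-1}(H_{\bar v})$. Then $I_\gamma(C,H)=\mathrm{Card}\left(C^{ns}(K)\cap\overline{H_{\bar v'}}\cap\mathcal{V}_{p_\gamma}\right)$ for $\bar v'\in\mathcal{V}_{\bar v_0}$ generic in $Par_\Sigma$. *)

(* Defs.v *)
From HB Require Import structures.
From mathcomp Require Import all_boot all_order all_algebra.
From mathcomp Require Import boolp.
From mathcomp Require Export mpoly.

Set Implicit Arguments.
Unset Strict Implicit.
Unset Printing Implicit Defensive.

Import GRing.Theory.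
Local Open Scope ring_scope.

(** * Formal power series *)

Record fps (R : Type) := Fps { fps_coef :> nat -> R }.

Notation "{ 'fps' R }" := (fps R) (format "{ 'fps'  R }") : type_scope.

HB.instance Definition _ (R : Type) := gen_eqMixin {fps R}.
HB.instance Definition _ (R : Type) := gen_choiceMixin {fps R}.

Lemma fpsP (R : Type) (f g : {fps R}) : f =1 g <-> f = g.
Proof. by split=> [|-> //]; case: f g => [f] [g] /= /funext ->. Qed.

Section FpsRing.
Variable R : comNzRingType.
Implicit Types f g h : {fps R}.

Definition fps_zero : {fps R} := Fps (fun=> 0).
Definition fps_opp f : {fps R} := Fps (fun n => - f n).
Definition fps_add f g : {fps R} := Fps (fun n => f n + g n).

Fact fps_addA : associative fps_add.
Proof. by move=> f g h; apply/fpsP => n /=; rewrite addrA. Qed.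
Fact fps_addC : commutative fps_add.
Proof. by move=> f g; apply/fpsP => n /=; rewrite addrC. Qed.
Fact fps_add0 : left_id fps_zero fps_add.
Proof. by move=> f; apply/fpsP => n /=; rewrite add0r. Qed.
Fact fps_addN : left_inverse fps_zero fps_opp fps_add.
Proof. by move=> f; apply/fpsP => n /=; rewrite addNr. Qed.

HB.instance Definition _ :=
  GRing.isZmodule.Build {fps R} fps_addA fps_addC fps_add0 fps_addN.

Definition fpsC (c : R) : {fps R} := Fps (fun n => if n == 0%N then c else 0).
Definition fpsX : {fps R} := Fps (fun n => (n == 1%N)%:R).
Definition fps_mul f g : {fps R} :=
  Fps (fun n => \sum_(i < n.+1) f i * g (n - i)%N).

Let trunc N f : {poly R} := \poly_(i < N) f i.

Fact fps_mul_trunc N n f g :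
  (n < N)%N -> fps_mul f g n = (trunc N f * trunc N g)`_n.
Proof.
move=> nN; rewrite coefM; apply: eq_bigr => i _; rewrite !coef_poly.
by rewrite (leq_ltn_trans _ nN) ?leq_ord // (leq_ltn_trans (leq_subr i n) nN).
Qed.

Fact fps_mulC : commutative fps_mul.
Proof.
by move=> f g; apply/fpsP => n; rewrite !(@fps_mul_trunc n.+1) // mulrC.
Qed.

Fact fps_mulA : associative fps_mul.
Proof.
move=> f g h; apply/fpsP => n.
have tM u v i : (i < n.+1)%N ->
    (trunc n.+1 (fps_mul u v))`_i = (trunc n.+1 u * trunc n.+1 v)`_i.
  by move=> iN; rewrite coef_poly iN (fps_mul_trunc _ _ iN).
rewrite !(@fps_mul_trunc n.+1) //.
transitivity (trunc n.+1 f * (trunc n.+1 g * trunc n.+1 h))`_n.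
  by rewrite !coefM; apply: eq_bigr => i _; rewrite tM ?ltnS ?leq_subr.
by rewrite mulrA [LHS]coefM [RHS]coefM; apply: eq_bigr => i _; rewrite tM.
Qed.

Fact fps_mul1 : left_id (fpsC 1) fps_mul.
Proof.
move=> f; apply/fpsP => n /=; rewrite big_ord_recl /= mul1r subn0.
by rewrite big1 ?addr0 // => i _; rewrite mul0r.
Qed.

Fact fps_mulD : left_distributive fps_mul fps_add.
Proof.
move=> f g h; apply/fpsP => n /=; rewrite -big_split /=.
by apply: eq_bigr => i _; rewrite mulrDl.
Qed.

Fact fps_1neq0 : fpsC 1 != fps_zero.
Proof. by apply/eqP => /fpsP/(_ 0%N)/eqP; rewrite /= oner_eq0. Qed.

HB.instance Definition _ := GRing.Zmodule_isComNzRing.Build {fps R}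
  fps_mulA fps_mulC fps_mul1 fps_mulD fps_1neq0.

Definition fps_ord f (m : nat) : Prop :=
  f m != 0 /\ forall i, (i < m)%N -> f i = 0.

End FpsRing.

Arguments fpsX {R}.

(** The variables [X], [Y] of [L[X,Y]] are ['X_ord0] and ['X_ord_max]. *)

(** [H(T, eta(T))] in [L[[T]]] *)
Definition subst_series (L : fieldType) (eta : {fps L}) (H : {mpoly L[2]}) :
    {fps L} :=
  mmap (@fpsC L) (fun i => if i == ord0 then fpsX else eta) H.

(** [L[[X,Y]]] is represented as [L[[X]][[Y]]]: the coefficient of
    [X^i Y^j] in [U] is [U j i]. *)
Definition mpoly_series (L : fieldType) (F : {mpoly L[2]}) : {fps {fps L}} :=
  mmap (fun c : L => fpsC (fpsC c))
       (fun i => if i == ord0 then fpsC fpsX else fpsX) F.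

(** * Polynomials *)

Definition irreducible_elt (R : unitRingType) (a : R) : Prop :=
  [/\ a != 0, a \isn't a GRing.unit &
      forall b c, a = b * c -> b \is a GRing.unit \/ c \is a GRing.unit].

Definition divides (R : comNzRingType) (a b : R) : Prop :=
  exists c, b = c * a.

(** The projective closure: the last variable is the homogenising one. *)
Definition homogenise (R : nzRingType) n (p : {mpoly R[n]}) :
    {mpoly R[n.+1]} :=
  \sum_(m <- msupp p) p@_m *:
    'X_[[multinom if unlift ord_max i is Some j then m j
                  else ((msize p).-1 - mdeg m)%N | i < n.+1]].

Definition ordinary_double_point (L : fieldType) (F : {mpoly L[2]}) : Prop :=
  [/\ F != 0, F.@[fun=> 0] = 0, pihomog mdeg 1 F = 0, pihomog mdeg 2 F != 0 &
      exists l1 l2 : {mpoly L[2]},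
        [/\ l1 \is 1.-homog, l2 \is 1.-homog, pihomog mdeg 2 F = l1 * l2 &
            forall c, l1 != c *: l2 /\ l2 != c *: l1]].

(** The line [l = 0] is one of the tangents at an ordinary double point. *)
Definition tangent_line (L : fieldType) (F l : {mpoly L[2]}) : Prop :=
  [/\ l != 0, l \is 1.-homog & divides l (pihomog mdeg 2 F)].

(** * Projective spaces *)

(** The points of [P^n(K)] are the lines of [K^(n+1)]. *)
Definition pspace (K : fieldType) n :=
  {U : {vspace 'rV[K]_n.+1} | \dim U == 1%N}.

Section ProjectiveSpace.
Variable K : fieldType.

Definition has_coords n (x : pspace K n) (u : 'rV[K]_n.+1) : Prop :=
  val x = <[u]>%VS.

Definition coords n (x : pspace K n) : 'rV[K]_n.+1 := vpick (val x).

(** Only applied to homogeneous [f], for which the choice of the homogeneous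
    coordinates of [x] is irrelevant. *)
Definition vanishes n (f : {mpoly K[n.+1]}) (x : pspace K n) : Prop :=
  f.@[coords x 0] = 0.

Definition zeros n (G : seq {mpoly K[n.+1]}) (x : pspace K n) : Prop :=
  forall g, g \in G -> vanishes g x.

Lemma origin_subproof n : \dim <[delta_mx 0 ord_max : 'rV[K]_n.+1]> == 1%N.
Proof.
rewrite dim_vline; suff -> : delta_mx 0 ord_max != 0 :> 'rV[K]_n.+1 by [].
by apply/eqP => /matrixP/(_ 0 ord_max)/eqP; rewrite !mxE !eqxx oner_eq0.
Qed.

(** The origin [0 : ... : 0 : 1] of the affine space [A^n] in [P^n] *)
Definition origin n : pspace K n :=
  exist (fun U => \dim U == 1%N) _ (origin_subproof n).

Definition same_degree n k (phi : k.-tuple {mpoly K[n]}) : Prop :=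
  exists d, forall i, tnth phi i \is d.-homog.

(** The value of the rational map [phi_0 : ... : phi_k] at [x] is [y]. The line
    [y] has dimension 1, so this entails that the [phi_i] have no common zero
    at [x]. *)
Definition sends n k (phi : k.+1.-tuple {mpoly K[n.+1]})
    (x : pspace K n) (y : pspace K k) : Prop :=
  has_coords y (\row_i (tnth phi i).@[coords x 0]).

(** The same for a map given by several local representatives *)
Definition mor_sends n k (Phi : seq (k.+1.-tuple {mpoly K[n.+1]}))
    (x : pspace K n) (y : pspace K k) : Prop :=
  exists2 phi, phi \in Phi & sends phi x y.

End ProjectiveSpace.

Definition has_card (T : eqType) (S : T -> Prop) (m : nat) : Prop :=
  exists s : seq T, [/\ uniq s, size s = m & forall x, x \in s <-> S x].

(** * The nonsingular model of the projective closure of the curve [F = 0] *)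

Section NonsingularModel.
Variable L : closedFieldType.

Definition generates_vanishing_ideal n (G : seq {mpoly L[n.+1]}) : Prop :=
  forall d (f : {mpoly L[n.+1]}), f \is d.-homog ->
    (forall x, zeros G x -> vanishes f x) ->
    exists c : 'I_(size G) -> {mpoly L[n.+1]}, f = \sum_i c i * G`_i.

Definition irreducible_zeros n (G : seq {mpoly L[n.+1]}) : Prop :=
  (exists x, zeros G x) /\
  forall d1 d2 (f g : {mpoly L[n.+1]}), f \is d1.-homog -> g \is d2.-homog ->
    (forall x, zeros G x -> vanishes (f * g) x) ->
    (forall x, zeros G x -> vanishes f x) \/
    (forall x, zeros G x -> vanishes g x).

(** Jacobian criterion for a curve in [P^n]: the rank is [n - 1]. *)
Definition nonsingular_curve_at n (G : seq {mpoly L[n.+1]}) (x : pspace L n) :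
    Prop :=
  (\rank (\matrix_(i < size G, j < n.+1) (G`_i)^`M(j).@[coords x 0])).+1 = n.

Record nonsingular_model (F : {mpoly L[2]}) := NonsingularModel {
  ns_dim : nat;
  ns_eqs : seq {mpoly L[ns_dim.+1]};
  ns_map : seq (3.-tuple {mpoly L[ns_dim.+1]});
  ns_homog : forall g, g \in ns_eqs -> exists d, g \is d.-homog;
  ns_ideal : generates_vanishing_ideal ns_eqs;
  ns_irreducible : irreducible_zeros ns_eqs;
  ns_nonsingular : forall x, zeros ns_eqs x -> nonsingular_curve_at ns_eqs x;
  (* [ns_map] is a morphism to the projective closure of [F = 0] ... *)
  ns_map_homog : forall phi, phi \in ns_map -> same_degree phi;
  ns_map_total : forall x, zeros ns_eqs x -> exists y, mor_sends ns_map x y;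
  ns_map_agree : forall x y y', zeros ns_eqs x ->
    mor_sends ns_map x y -> mor_sends ns_map x y' -> y = y';
  ns_map_curve : forall x y, zeros ns_eqs x -> mor_sends ns_map x y ->
    vanishes (homogenise F) y;
  (* ... with a rational inverse *)
  ns_birational : exists psi : ns_dim.+1.-tuple {mpoly L[3]},
    [/\ same_degree psi,
        exists y x, vanishes (homogenise F) y /\ sends psi y x,
        forall y x, vanishes (homogenise F) y -> sends psi y x ->
          zeros ns_eqs x /\ mor_sends ns_map x y &
        forall x y x', zeros ns_eqs x -> mor_sends ns_map x y ->
          sends psi y x' -> x' = x]
}.

End NonsingularModel.

(** * Infinitesimal neighbourhoods *)

Definition maxideal (K : fieldType) (O : {pred K}) : {pred K} :=
  [pred x | (x \in O) && ((x == 0) || (x^-1 \notin O))].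

Section Infinitesimals.
Variables (L K : closedFieldType) (iota : {rmorphism L -> K}) (O : {pred K}).

Definition infinite_trdeg : Prop :=
  forall n, exists t : 'I_n -> K,
    forall P : {mpoly L[n]}, P != 0 -> (map_mpoly iota P).@[t] != 0.

Definition valuation_ring : Prop :=
  subring_closed O /\ forall x, x \in O \/ x^-1 \in O.

(** [L -> O/m] is automatically injective: it is a morphism from a field to a
    nonzero ring. *)
Definition infinitesimal_extension : Prop :=
  [/\ infinite_trdeg, valuation_ring, forall a, iota a \in O,
      exists2 x, x \in maxideal O & x != 0 &
      forall x, x \in O -> exists a, x - iota a \in maxideal O].

(** [x] belongs to the infinitesimal neighbourhood of [p]: the residues of
    suitable homogeneous coordinates of [x] in [O] are homogeneous coordinates
    of [p]. *)
Definition specialises n (x : pspace K n) (p : pspace L n) : Prop :=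
  exists (u : 'rV[K]_n.+1) (w : 'rV[L]_n.+1),
    [/\ has_coords x u, has_coords p w &
        forall i, u 0 i \in O /\ u 0 i - iota (w 0 i) \in maxideal O].

Definition generic n (x : pspace K n) : Prop :=
  forall d (G : {mpoly L[n.+1]}), G \is d.-homog -> G != 0 ->
    ~ vanishes (map_mpoly iota G) x.

(** * Branches and branched intersection multiplicity *)

Variable F : {mpoly L[2]}.

Definition finite_intersection (h : {mpoly L[3]}) : Prop :=
  exists s : seq (pspace L 2),
    forall y, vanishes (homogenise F) y -> vanishes h y -> y \in s.

(** A linear system of curves of degree [e] is the projectivisation of a
    subspace of the forms of degree [e]. *)
Definition finite_system e (W : {vspace dhomog 3 L e}) : Prop :=
  forall h, h \in W -> h != 0 -> finite_intersection (val h).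

Definition maximal_finite_system e (W : {vspace dhomog 3 L e}) : Prop :=
  finite_system W /\
  forall W' : {vspace dhomog 3 L e},
    (W <= W')%VS -> finite_system W' -> W' = W.

(** The basis [b] identifies the parameter space of the linear system [<<b>>]
    with [P^r]. *)
Definition sys_member e r (b : r.+1.-tuple (dhomog 3 L e)) (v : pspace K r) :
    {mpoly K[3]} :=
  \sum_i coords v 0 i *: map_mpoly iota (val (tnth b i)).

Definition generic_deformation (H : {mpoly L[2]}) r
    (b : r.+1.-tuple (dhomog 3 L (msize H).-1)) (v : pspace K r) : Prop :=
  [/\ free b, maximal_finite_system <<b>>%VS, generic v &
      exists (v0 : pspace L r) (u : 'rV[L]_r.+1),
        [/\ specialises v v0, has_coords v0 u &
            \sum_i u 0 i *: val (tnth b i) = homogenise H]].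

Variable M : nonsingular_model F.

Definition ns_point (x : pspace K (ns_dim M)) : Prop :=
  zeros (map (map_mpoly iota) (ns_eqs M)) x.

Definition ns_sends (x : pspace K (ns_dim M)) (y : pspace K 2) : Prop :=
  mor_sends [seq map_tuple (map_mpoly iota) phi | phi <- ns_map M] x y.

Definition branch_centred_at (a : pspace L 2) (p : pspace L (ns_dim M)) :
    Prop :=
  zeros (ns_eqs M) p /\ mor_sends (ns_map M) p a.

Definition branch (p : pspace L (ns_dim M)) (x : pspace K (ns_dim M)) : Prop :=
  ns_point x /\ specialises x p.

Definition branch_intersection (p : pspace L (ns_dim M)) (h : {mpoly K[3]})
    (x : pspace K (ns_dim M)) : Prop :=
  branch p x /\ exists2 y, ns_sends x y & vanishes h y.

(** [I_gamma(C, H) = m] for the branch [gamma] given by [p]. The existential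
    clause keeps this from holding vacuously. *)
Definition branch_multiplicity (p : pspace L (ns_dim M)) (H : {mpoly L[2]})
    (m : nat) : Prop :=
  (exists r b v, @generic_deformation H r b v) /\
  forall r b v, @generic_deformation H r b v ->
    has_card (branch_intersection p (sys_member b v)) m.

End Infinitesimals.

(* Main.v *)
(** Blowing up [(x, y) = (x, x z)] turns [F] into [x^2 G(x, z)], where [G] meets
    the line [x = 0] transversally in the two slopes [a_j = eta_j'(0)]; near
    [(0, a_j)] the curve [G = 0] is the graph of [zeta_j = eta_j / x].

    If [f] has infinitesimal deviation from a polynomial [fb] over [L] and
    [ord fb(T, zeta_j(T)) = m], then [f] has [m] zeros, counted suitably, on the
    [K]-points of [G = 0] infinitesimally near [(0, a_j)]: a zero exists by
    lifting a root of a resultant, and dividing [f] by [x - x1] modulo [G] lowers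
    the order by one.  If the zeros so obtained are not distinct, [f] is tangent
    to the curve at one of them.

    The rational inverse [psi] of the model, expanded along [eta_j], has a
    leading coefficient, the point [p_j]; it identifies the infinitesimal points
    of [G = 0] near [(0, a_j)] with those of the model near [p_j], except over the
    origin itself.  Nonsingularity of the model gives [p_1 <> p_2].  There is no
    third point [p] above the origin: [y / x] is integral over the local ring of
    [p], so its reductions are among [a_1], [a_2], and a function that vanishes
    at [p] but not at [p_1] and [p_2] would be a unit.

    Finally a generic member [v] of a maximal finite system is nowhere tangent
    to the curve: maximality puts [1] and [x] in the system modulo [F], so a
    tangency point [P] determines two coordinates of [v] from the others, while
    [P] itself varies on a curve; this makes the coordinates of [v]
    algebraically dependent over [L]. *)

From HB Require Import structures.
Require Import Defs.
From mathcomp Require Import all_boot all_order all_algebra.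
From mathcomp Require Import boolp ring.
Set Implicit Arguments.
Unset Strict Implicit.
Unset Printing Implicit Defensive.
Import GRing.Theory.
Local Open Scope ring_scope.

(** * Polynomial evaluation *)

(** The ring [O] is assumed neither complete nor of rank one, so a series over [L] has no value at
    an infinitesimal of [K]. Statements about [eta_j] are therefore turned into polynomial
    identities [D f = X^m g + B G] over [L] with [D] nonzero at [(0, a_j)], and only these are
    evaluated in [O]; points are produced from the algebraic closedness of [K], in place of
    completeness. The data of the model concern [L]-points. They reach points over [O] and [K] in
    two ways: a form vanishing on the model lies in the ideal of its equations, and an identity
    between pullbacks to the plane holds modulo [F]. The local ring of a point of the model is
    handled through a bare residue relation inside [K], and the integrality argument becomes an
    explicit instance of Nakayama's lemma. A generic point of projective space need not have
    algebraically independent coordinates; multiplying them by a new variable makes them so, and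
    tangency is then refuted by comparing algebraic and transcendental elements. Characteristic
    different from 2 enters through [F_YY(0,0) = 2 u0(0,0)], which makes [F] separable in [Y]. *)

Lemma mpoly_ring_ind n (R : comNzRingType) (P : {mpoly R[n]} -> Prop) :
    (forall c, P c%:MP) -> (forall i, P 'X_i) ->
    (forall p q, P p -> P q -> P (p + q)) ->
    (forall p q, P p -> P q -> P (p * q)) ->
  forall p, P p.
Proof.
move=> PC PX PD PM p; rewrite (mpolyE p); apply: (big_ind P) => [||m _].
- by rewrite -mpolyC0; apply: PC.
- exact: PD.
rewrite -mul_mpolyC mpolyXE_id; apply: (PM) => //.
apply: (big_ind P) => [||i _]; [by rewrite -mpolyC1; apply: PC | exact: PM |].
elim: (m i) => [|k IHk]; first by rewrite expr0 -mpolyC1; apply: PC.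
by rewrite exprS; apply: PM.
Qed.

Lemma mmapXU n (R S : comNzRingType) (f : {rmorphism R -> S}) (h : 'I_n -> S) i :
  mmap f h 'X_i = h i.
Proof. by rewrite mmapX mmap1U. Qed.

Lemma eq_mmap n (R S : comNzRingType) (f f' : R -> S) (h h' : 'I_n -> S) p :
  f =1 f' -> h =1 h' -> mmap f h p = mmap f' h' p.
Proof.
move=> ef eh; apply: eq_bigr => m _; rewrite ef; congr (_ * _).
exact: mmap1_eq.
Qed.

Lemma mderivXU n (R : nzRingType) (i k : 'I_n) :
  ('X_i : {mpoly R[n]})^`M(k) = (i == k)%:R.
Proof.
rewrite mderivX mnm1E; case: eqP => [->|_]; last by rewrite scale0r.
have -> : (U_(k) - U_(k))%MM = 0%MM :> 'X_{1..n}.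
  by apply/mnmP => l; rewrite mnmBE mnm0E subnn.
by rewrite mpolyX0 scale1r.
Qed.

Section Mmap.
Variables (n : nat) (R S : comNzRingType).
Implicit Types (f : {rmorphism R -> S}) (h : 'I_n -> S) (p : {mpoly R[n]}).

Lemma rmorph_mmap (T : comNzRingType) (g : {rmorphism S -> T}) f h p :
  g (mmap f h p) = mmap (g \o f) (g \o h) p.
Proof.
elim/mpoly_ring_ind: p => [c|i|p q IHp IHq|p q IHp IHq].
- by rewrite mmapC [RHS]mmapC.
- by rewrite mmapXU [RHS]mmapXU.
- by rewrite !mmapD rmorphD IHp IHq.
- by rewrite !rmorphM /= IHp IHq.
Qed.

Lemma mmap_map_mpoly (T : comNzRingType) (g : {rmorphism S -> T})
    (h : 'I_n -> T) f p :
  mmap g h (map_mpoly f p) = mmap (g \o f) h p.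
Proof.
elim/mpoly_ring_ind: p => [c|i|p q IHp IHq|p q IHp IHq].
- by rewrite map_mpolyC mmapC [RHS]mmapC.
- by rewrite map_mpolyX mmapXU [RHS]mmapXU.
- by rewrite raddfD !mmapD IHp IHq.
- by rewrite !rmorphM /= IHp IHq.
Qed.

Lemma meval_map_mpoly f h p : (map_mpoly f p).@[h] = mmap f h p.
Proof. by rewrite /meval mmap_map_mpoly; apply: eq_mmap. Qed.

(** The target ring is arbitrary on purpose: with a polynomial ring as target this divides by the
    ideal of a point, and with a ring of series it compares [F(X, Y)] with [F(X, eta)]. *)
Lemma mmap_sub f u v p :
  exists D : 'I_n -> S, mmap f u p - mmap f v p = \sum_i (u i - v i) * D i.
Proof.
elim/mpoly_ring_ind: p => [c|i|p q [D Dp] [E Eq]|p q [D Dp] [E Eq]].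
- exists (fun=> 0); rewrite !mmapC subrr big1 // => i _; exact: mulr0.
- exists (fun j => (j == i)%:R); rewrite !mmapXU (bigD1 i) //= eqxx mulr1.
  by rewrite big1 ?addr0 // => j /negPf ->; rewrite mulr0.
- exists (fun i => D i + E i); rewrite !mmapD opprD addrACA Dp Eq -big_split.
  by apply: eq_bigr => i _; rewrite mulrDr.
- exists (fun i => D i * mmap f u q + mmap f v p * E i); rewrite !rmorphM /=.
  have -> : forall a b c d : S, a * b - c * d = (a - c) * b + c * (b - d).
    by move=> a b c d; ring.
  rewrite Dp Eq mulr_suml mulr_sumr -big_split.
  by apply: eq_bigr => i _ /=; ring.
Qed.

(** The remainder is built by induction on [p], without factorials, so the expansion holds in every
    characteristic. It is used with [s] an infinitesimal of [O] and with [s] a polynomial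
    variable. *)
Lemma mmap_Taylor1 f u (s : S) w p :
  exists q, mmap f (fun i => u i + s * w i) p =
    mmap f u p + s * (\sum_i w i * mmap f u p^`M(i)) + s ^+ 2 * q.
Proof.
elim/mpoly_ring_ind: p => [c|i|p q [a Ea] [b Eb]|p q [a Ea] [b Eb]].
- exists 0; rewrite !mmapC big1 ?mulr0 ?addr0 // => i _.
  by rewrite mderivC mmap0 mulr0.
- exists 0; rewrite !mmapXU (bigD1 i) //= big1 => [|j /negPf ji]; last first.
    by rewrite mderivXU eq_sym ji mmap0 mulr0.
  by rewrite mderivXU eqxx rmorph1 mulr1 !addr0 mulr0 addr0.
- exists (a + b); rewrite !mmapD Ea Eb.
  under [in RHS]eq_bigr => i _ do rewrite mderivD mmapD mulrDr.
  by rewrite big_split /=; ring.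
- set A := \sum_i _ in Ea; set B := \sum_i _ in Eb.
  exists (mmap f u p * b + a * mmap f u q + A * B
          + s * (A * b + a * B) + s ^+ 2 * (a * b)).
  have -> : \sum_i w i * mmap f u (p * q)^`M(i) = A * mmap f u q + mmap f u p * B.
    rewrite mulr_suml mulr_sumr -big_split; apply: eq_bigr => i _ /=.
    by rewrite mderivM mmapD !rmorphM /=; ring.
  by rewrite !rmorphM /= Ea Eb; ring.
Qed.

Lemma mmap_dhomog f (s : S) u d p :
  p \is d.-homog -> mmap f (fun i => s * u i) p = s ^+ d * mmap f u p.
Proof.
move=> /dhomogP hp; rewrite /mmap mulr_sumr; apply: eq_big_seq => m mp.
have -> : d = (\sum_i m i)%N by rewrite -mdegE; apply/esym/hp.
rewrite mulrCA; congr (_ * _); rewrite /mmap1 expr_sum -big_split /=.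
by apply: eq_bigr => i _; rewrite exprMn.
Qed.

End Mmap.

Lemma dhomog_mmap n k (R : comNzRingType) d e (p : {mpoly R[n]})
    (h : 'I_n -> {mpoly R[k]}) :
  p \is d.-homog -> (forall i, h i \is e.-homog) ->
  mmap (@mpolyC k R) h p \is (d * e)%N.-homog.
Proof.
move=> /dhomogP hp hh; rewrite /mmap big_seq; apply: rpred_sum => m mp.
rewrite mul_mpolyC; apply: rpredZ.
have -> : d = (\sum_i m i)%N by rewrite -mdegE; apply/esym/hp.
rewrite big_distrl /=.
apply: (big_ind2 (fun (a : {mpoly R[k]}) b => a \is b.-homog)).
- exact: dhomog1.
- by move=> a i b j ai bj; apply: dhomogM.
- by move=> i _; rewrite mulnC; apply: dhomogMn.
Qed.

Definition xy (S : Type) (a b : S) (i : 'I_2) := if i == ord0 then a else b.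

Lemma comp_xy (S T : Type) (g : S -> T) a b : g \o xy a b =1 xy (g a) (g b).
Proof. by move=> i; rewrite /xy /=; case: (i == ord0). Qed.

Section Mmap2.
Variables (R S : comNzRingType) (f : {rmorphism R -> S}).
Implicit Types (p : {mpoly R[2]}) (a b : S).

Lemma mmap_xy_sub a b a' b' p :
  exists A B, mmap f (xy a b) p - mmap f (xy a' b') p =
    (a - a') * A + (b - b') * B.
Proof.
have [D ->] := mmap_sub f (xy a b) (xy a' b') p.
by exists (D ord0), (D (lift ord0 ord0)); rewrite big_ord_recl big_ord1.
Qed.

Lemma rmorph_mmap_xy (T : comNzRingType) (g : {rmorphism S -> T}) a b p :
  g (mmap f (xy a b) p) = mmap (g \o f) (xy (g a) (g b)) p.
Proof. by rewrite rmorph_mmap; apply: eq_mmap => //; apply: comp_xy. Qed.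

End Mmap2.

(** * Power series *)

Section PowerSeries.
Variable R : comNzRingType.
Implicit Types (f g : {fps R}) (c : R).

Fact fpsC_zmod_morphism : zmod_morphism (@fpsC R).
Proof. by move=> a b; apply/fpsP => n /=; case: eqP; rewrite ?subrr. Qed.

Fact fpsC_monoid_morphism : monoid_morphism (@fpsC R).
Proof.
split=> [|a b]; first by [].
apply/fpsP => n /=; rewrite big_ord_recl /= subn0 big1 ?addr0.
  by case: eqP => _; rewrite ?mulr0.
by move=> i _; rewrite mul0r.
Qed.

HB.instance Definition _ :=
  GRing.isZmodMorphism.Build R {fps R} (@fpsC R) fpsC_zmod_morphism.
HB.instance Definition _ :=
  GRing.isMonoidMorphism.Build R {fps R} (@fpsC R) fpsC_monoid_morphism.

Definition fps_at0 f : R := f 0%N.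

Fact fps_at0_zmod_morphism : zmod_morphism fps_at0.
Proof. by []. Qed.

Fact fps_at0_monoid_morphism : monoid_morphism fps_at0.
Proof. by split=> [|f g] //; rewrite [LHS]big_ord1. Qed.

HB.instance Definition _ :=
  GRing.isZmodMorphism.Build {fps R} R fps_at0 fps_at0_zmod_morphism.
HB.instance Definition _ :=
  GRing.isMonoidMorphism.Build {fps R} R fps_at0 fps_at0_monoid_morphism.

Lemma fps_coefD f g n : (f + g) n = f n + g n. Proof. by []. Qed.
Lemma fps_coefN f n : (- f) n = - f n. Proof. by []. Qed.
Lemma fps_coefCM c f n : (fpsC c * f) n = c * f n.
Proof.
rewrite [LHS]big_ord_recl /= subn0 big1 ?addr0 // => i _; exact: mul0r.
Qed.

Lemma fps_coefXM f n : (fpsX * f) n = if n is k.+1 then f k else 0.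
Proof.
case: n => [|n]; first by rewrite [LHS]big_ord1 /= mul0r.
rewrite [LHS]big_ord_recl /= mul0r add0r big_ord_recl /= mul1r subSS subn0.
by rewrite big1 ?addr0 // => i _; rewrite mul0r.
Qed.

Lemma fps_coefXnM f m n : (fpsX ^+ m * f) n = if (n < m)%N then 0 else f (n - m)%N.
Proof.
elim: m n => [|m IHm] n; first by rewrite expr0 mul1r subn0.
by rewrite exprS -mulrA fps_coefXM; case: n => // n; rewrite IHm.
Qed.

Lemma fps_lowP m f :
  (forall i, (i < m)%N -> f i = 0) <-> exists g, f = fpsX ^+ m * g.
Proof.
split=> [f0|[g ->] i im]; last by rewrite fps_coefXnM im.
exists (Fps (fun i => f (i + m)%N)); apply/fpsP => n.
by rewrite fps_coefXnM; case: ltnP => [/f0 //|mn] /=; rewrite subnK.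
Qed.

Lemma fps_low_mul m f g i :
  (forall j, (j < m)%N -> f j = 0) -> (i < m)%N -> (f * g) i = 0.
Proof.
move=> /fps_lowP[h ->] im; rewrite -mulrA fps_coefXnM im //.
Qed.

Lemma fpsXnI m f g : fpsX ^+ m * f = fpsX ^+ m * g -> f = g.
Proof.
move=> /fpsP E; apply/fpsP => n; have := E (n + m)%N.
by rewrite !fps_coefXnM ltnNge leq_addl /= addnK.
Qed.

End PowerSeries.

Section SeriesField.
Variable L : fieldType.
Implicit Types (f g u eta : {fps L}) (p q : {mpoly L[2]}).

Lemma fps_ord_neq0 f m : fps_ord f m -> f <> 0.
Proof. by case=> /eqP fm _ f0; apply: fm; rewrite f0. Qed.

Lemma fps_neq0_ord f : f <> 0 -> exists m, fps_ord f m.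
Proof.
move=> f0; have [m fm] : exists m, f m != 0.
  apply: contrapT => H; apply: f0; apply/fpsP => n; apply/eqP.
  by apply: contrapT => /negP fn; apply: H; exists n.
case: (ex_minnP (ex_intro _ m fm : exists m, [pred i | f i != 0] m)) => k fk kmin.
exists k; split=> // i ik; apply/eqP/negPn/negP => fi.
by have := kmin i fi; rewrite leqNgt ik.
Qed.

Lemma fps_ord_mul f g k m :
  fps_ord f k -> fps_ord g m -> fps_ord (f * g) (k + m).
Proof.
move=> [fk /fps_lowP[f' Ef]] [gm /fps_lowP[g' Eg]].
have E : f * g = fpsX ^+ (k + m) * (f' * g').
  by rewrite Ef Eg exprD; ring.
have E0 : (f' * g') 0%N = f' 0%N * g' 0%N := rmorphM (@fps_at0 L) f' g'.
split=> [|i im]; rewrite E fps_coefXnM ?im // ltnn subnn E0 mulf_neq0 //.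
  by move: fk; rewrite Ef fps_coefXnM ltnn subnn.
by move: gm; rewrite Eg fps_coefXnM ltnn subnn.
Qed.

Lemma fps_mulf_eq0 f g : f * g = 0 -> f <> 0 -> g = 0.
Proof.
move=> fg0 /fps_neq0_ord[k fk]; apply: contrapT => /fps_neq0_ord[m gm].
exact: fps_ord_neq0 (fps_ord_mul fk gm) fg0.
Qed.

Lemma fps_ord_uniq f k m : fps_ord f k -> fps_ord f m -> k = m.
Proof.
move=> [fk lk] [fm lm]; case: (ltngtP k m) => // h.
  by rewrite lm ?eqxx in fk.
by rewrite lk ?eqxx in fm.
Qed.

Lemma subst_seriesE eta p : subst_series eta p = mmap (@fpsC L) (xy fpsX eta) p.
Proof. by []. Qed.

(** The value [c = F(X, eta)] is constant in [Y] and equals [(Y - eta) W] for some series [W].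
    Comparing coefficients of powers of [Y] gives [c = - eta W_0] and [W_n = eta W_(n+1)], so [c] is
    divisible by every power of [eta], hence by every power of [X]. *)
Lemma subst_series_factor eta (F : {mpoly L[2]}) (V : {fps {fps L}}) :
  eta 0%N = 0 -> mpoly_series F = V * (fpsX - fpsC eta) ->
  subst_series eta F = 0.
Proof.
move=> e0 EF; pose cc : {rmorphism L -> {fps {fps L}}} := @fpsC {fps L} \o @fpsC L.
have [A [B]] := mmap_xy_sub cc (fpsC fpsX) fpsX (fpsC fpsX) (fpsC eta) F.
have -> : mmap cc (xy (fpsC fpsX) fpsX) F = mpoly_series F by [].
have -> : mmap cc (xy (fpsC fpsX) (fpsC eta)) F = fpsC (subst_series eta F).
  by rewrite subst_seriesE rmorph_mmap_xy.
rewrite subrr mul0r add0r EF => E; set c := subst_series _ _ in E *.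
have {E} Ec : fpsC c = (fpsX - fpsC eta) * (V - B).
  by rewrite mulrBr -E; ring.
set W := V - B in Ec.
have coefW n : ((fpsX - fpsC eta) * W) n = (if n is k.+1 then W k else 0) - eta * W n.
  by rewrite mulrBl fps_coefD fps_coefN fps_coefXM fps_coefCM.
have W0 : c = - (eta * W 0%N).
  by move/fpsP/(_ 0%N): Ec; rewrite coefW /= sub0r.
have WS n : W n = eta * W n.+1.
  move/fpsP/(_ n.+1): Ec; rewrite coefW /= => /esym/eqP.
  by rewrite subr_eq0 => /eqP.
have Wn n : W 0%N = eta ^+ n * W n.
  by elim: n => [|n ->]; rewrite ?mul1r // exprSr -mulrA -WS.
have [h Eh] : exists h, eta = fpsX ^+ 1 * h by apply/fps_lowP; case.
apply/fpsP => n; rewrite W0 (Wn n) mulrA -exprS fps_coefN.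
by rewrite Eh expr1 exprMn -mulrA fps_coefXnM ltnSn oppr0.
Qed.

End SeriesField.

Lemma pihomog_lt n (R : nzRingType) k d (p q : {mpoly R[n]}) :
  (d < k)%N -> p \is k.-homog -> pihomog mdeg d (p * q) = 0.
Proof.
move=> dk /dhomogP pk; rewrite pihomogE big_seq_cond big1 // => m /andP[+ /eqP md].
move=> /msuppM_le/allpairsP[[m1 m2] /= [m1p _ Em]].
have e1 : mdeg m1 = k := pk _ m1p; have e2 : mdeg m = d := md.
by move: dk; rewrite -e2 -e1 Em mdegD ltnNge leq_addr.
Qed.

(** * Second-order expansion at the double point *)

Section Node.
Variable L : fieldType.
Implicit Types (F : {mpoly L[2]}) (a x z : L).

Notation X := ('X_ord0 : {mpoly L[2]}).
Notation Y := ('X_ord_max : {mpoly L[2]}).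

Lemma mpoly2_expand F : exists a b u0 u1 u2,
  F = (F.@[fun=> 0])%:MP + a *: X + b *: Y + (Y ^+ 2 * u0 + X * Y * u1 + X ^+ 2 * u2).
Proof.
suff [c [a [b [u0 [u1 [u2 E]]]]]] : exists c a b u0 u1 u2,
    F = c%:MP + a *: X + b *: Y + (Y ^+ 2 * u0 + X * Y * u1 + X ^+ 2 * u2).
  exists a, b, u0, u1, u2; rewrite {1}E; congr (_ + _ + _ + _); congr (_%:MP).
  by rewrite E !(mevalD, mevalM, mevalZ, mevalC, mevalXU, rmorphXn) /=; ring.
elim/mpoly_ring_ind: F => [c|i|p q [c [a [b [u0 [u1 [u2 E]]]]]] [c' [a' [b' [v0 [v1 [v2 E']]]]]]
   |p q [c [a [b [u0 [u1 [u2 E]]]]]] [c' [a' [b' [v0 [v1 [v2 E']]]]]]].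
- by exists c, 0, 0, 0, 0, 0; rewrite !scale0r !mulr0 !addr0.
- case: (unliftP ord0 i) => [j|] ->.
    exists 0, 0, 1, 0, 0, 0; have -> : lift ord0 j = ord_max by apply: val_inj; rewrite ord1.
    by rewrite scale0r scale1r !mulr0 !addr0 mpolyC0 !add0r.
  exists 0, 1, 0, 0, 0, 0.
  by rewrite scale0r scale1r !mulr0 !addr0 mpolyC0 !add0r.
- exists (c + c'), (a + a'), (b + b'), (u0 + v0), (u1 + v1), (u2 + v2).
  by rewrite E E' mpolyCD !scalerDl; ring.
- exists (c * c'), (c * a' + a * c'), (c * b' + b * c').
  exists (c%:MP * v0 + c'%:MP * u0 + (b * b')%:MP
    + (b *: Y + a *: X) * v0 + (b' *: Y + a' *: X) * u0
    + (Y ^+ 2 * u0 + X * Y * u1 + X ^+ 2 * u2) * v0).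
  exists (c%:MP * v1 + c'%:MP * u1 + (a * b' + b * a')%:MP
    + (b *: Y + a *: X) * v1 + (b' *: Y + a' *: X) * u1
    + (Y ^+ 2 * u0 + X * Y * u1 + X ^+ 2 * u2) * v1).
  exists (c%:MP * v2 + c'%:MP * u2 + (a * a')%:MP
    + (b *: Y + a *: X) * v2 + (b' *: Y + a' *: X) * u2
    + (Y ^+ 2 * u0 + X * Y * u1 + X ^+ 2 * u2) * v2).
  by rewrite E E' -!mul_mpolyC !(mpolyCD, mpolyCM); ring.
Qed.

Lemma dhomogXU n (R : nzRingType) (i : 'I_n) : ('X_i : {mpoly R[n]}) \is 1.-homog.
Proof. by rewrite dhomogX /= mdeg1. Qed.

(** This presentation makes the blow-up explicit: under [Y := X Y] each of the three terms acquires
    the factor [X^2], and the values of the [u_i] at the origin are the coefficients of the tangent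
    cone. *)
Lemma node_expand F : F.@[fun=> 0] = 0 -> pihomog mdeg 1 F = 0 ->
  exists u0 u1 u2, F = Y ^+ 2 * u0 + X * Y * u1 + X ^+ 2 * u2 /\
    pihomog mdeg 2 F = u0.@[fun=> 0] *: Y ^+ 2 + u1.@[fun=> 0] *: (X * Y)
                       + u2.@[fun=> 0] *: X ^+ 2.
Proof.
move=> F0 F1; have [a [b [u0 [u1 [u2]]]]] := mpoly2_expand F.
rewrite F0 mpolyC0 add0r => E.
have hY2 : Y ^+ 2 \is 2.-homog by apply: (dhomogMn 2 (dhomogXU _ _)).
have hX2 : X ^+ 2 \is 2.-homog by apply: (dhomogMn 2 (dhomogXU _ _)).
have hXY : X * Y \is 2.-homog by apply: (dhomogM (dhomogXU _ _) (dhomogXU _ _)).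
have E1 : a *: X + b *: Y = 0.
  rewrite -F1 E 4!pihomogD !(pihomog_lt _ (k := 2)) // !addr0.
  by rewrite !linearZ /= !pihomog_dE ?dhomogXU.
have a0 : a = 0.
  move: (congr1 (meval (xy 1 0)) E1).
  by rewrite mevalD !mevalZ !mevalXU meval0 /xy /= mulr1 mulr0 addr0.
have b0 : b = 0.
  move: (congr1 (meval (xy 0 1)) E1).
  by rewrite mevalD !mevalZ !mevalXU meval0 /xy /= mulr1 mulr0 add0r.
move: E; rewrite a0 b0 !scale0r !add0r => E.
exists u0, u1, u2; split=> //; rewrite E 2!pihomogD.
have pi2 (q u : {mpoly L[2]}) : q \is 2.-homog -> pihomog mdeg 2 (q * u) = u.@[fun=> 0] *: q.
  move=> q2; have low i s : pihomog mdeg 2 (q * ('X_i * s)) = 0.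
    rewrite mulrA (@pihomog_lt _ _ (2 + 1)) //.
    exact: dhomogM q2 (dhomogXU _ _).
  have [a' [b' [v0 [v1 [v2 Eu]]]]] := mpoly2_expand u.
  have -> : q * u = u.@[fun=> 0] *: q + q * (X * (a'%:MP + Y * v1 + X * v2))
                    + q * (Y * (b'%:MP + Y * v0)).
    by rewrite {1}Eu -!mul_mpolyC; ring.
  by rewrite !pihomogD !low !addr0 linearZ /= pihomog_dE.
by rewrite !pi2.
Qed.
End Node.

(** * Common zeros of plane curves *)

Section ClosedField.
Variable L : closedFieldType.

Lemma closed_field_infinite (s : seq L) : exists x, x \notin s.
Proof.
case: s => [|a s]; first by exists 0.
pose p := \prod_(z <- a :: s) ('X - z%:P) + 1.
have sp : size p != 1%N.
  rewrite size_polyDl size_prod_XsubC //=.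
  by rewrite size_poly1.
have /closed_rootP[x] := sp; rewrite rootE hornerD hornerC horner_prod => /eqP rx.
exists x; apply/negP => xs; move: rx; rewrite (big_rem x) //= !hornerE subrr mul0r.
by rewrite add0r => /eqP; rewrite oner_eq0.
Qed.

Lemma poly_finite_roots (p : {poly L}) :
  p != 0 -> exists s : seq L, forall x, root p x -> x \in s.
Proof.
move=> p0; have [s Es] := closed_field_poly_normal p; exists s => x.
by rewrite Es rootZ ?lead_coef_eq0 // root_prod_XsubC.
Qed.

Lemma poly_nonroot (p : {poly L}) (s : seq L) :
  p != 0 -> exists2 x, p.[x] != 0 & x \notin s.
Proof.
move=> /poly_finite_roots[r rP]; have [x] := closed_field_infinite (r ++ s).
rewrite mem_cat => /norP[xr xs]; exists x => //.
by apply: contra xr => px; apply: rP.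
Qed.

Lemma poly_infinite_zeros (p : {poly L}) (s : seq L) :
  (forall x, x \notin s -> p.[x] = 0) -> p = 0.
Proof.
move=> ps; apply/eqP/negP => /negP/(poly_nonroot s)[x px /ps p0].
by rewrite p0 eqxx in px.
Qed.

End ClosedField.

Section BivariatePoly.
Variable L : closedFieldType.
Implicit Types (c r : {poly L}) (P Q D G : {poly {poly L}}) (F g : {mpoly L[2]}).

Definition bipoly F : {poly {poly L}} :=
  mmap (polyC \o polyC) (xy 'X%:P 'X) F.

Fact bipoly_zmod_morphism : zmod_morphism bipoly.
Proof. by move=> p q; rewrite /bipoly mmapB. Qed.

Fact bipoly_monoid_morphism : monoid_morphism bipoly.
Proof. by split=> [|p q]; rewrite /bipoly ?rmorph1 ?rmorphM. Qed.

HB.instance Definition _ :=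
  GRing.isZmodMorphism.Build {mpoly L[2]} {poly {poly L}} bipoly bipoly_zmod_morphism.
HB.instance Definition _ :=
  GRing.isMonoidMorphism.Build {mpoly L[2]} {poly {poly L}} bipoly bipoly_monoid_morphism.

Definition ofbipoly P : {mpoly L[2]} :=
  (map_poly (horner_morph (fun a => mulrC 'X_ord0 (mpolyC 2 a))) P).['X_ord_max].

Fact ofbipoly_zmod_morphism : zmod_morphism ofbipoly.
Proof. by move=> P Q; rewrite /ofbipoly rmorphB hornerD hornerN. Qed.

Fact ofbipoly_monoid_morphism : monoid_morphism ofbipoly.
Proof.
by split=> [|P Q]; rewrite /ofbipoly ?rmorph1 ?hornerC // rmorphM hornerM.
Qed.

HB.instance Definition _ :=
  GRing.isZmodMorphism.Build {poly {poly L}} {mpoly L[2]} ofbipoly ofbipoly_zmod_morphism.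
HB.instance Definition _ :=
  GRing.isMonoidMorphism.Build {poly {poly L}} {mpoly L[2]} ofbipoly ofbipoly_monoid_morphism.

Lemma ofbipolyX : ofbipoly 'X = 'X_ord_max.
Proof. by rewrite /ofbipoly map_polyX hornerX. Qed.

Lemma ofbipolyCX : ofbipoly 'X%:P = 'X_ord0.
Proof. by rewrite /ofbipoly map_polyC hornerC /= horner_morphX. Qed.

Lemma ofbipolyCC a : ofbipoly a%:P%:P = a%:MP.
Proof. by rewrite /ofbipoly map_polyC hornerC /= horner_morphC. Qed.

Lemma bipolyK : cancel bipoly ofbipoly.
Proof.
move=> F; elim/mpoly_ring_ind: F => [c|i|p q IHp IHq|p q IHp IHq].
- by rewrite /bipoly mmapC /= ofbipolyCC.
- rewrite /bipoly mmapXU /xy; case: (unliftP ord0 i) => [j|] -> /=.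
    by rewrite ofbipolyX; congr 'X_(_); apply: val_inj; rewrite /= ord1.
  by rewrite ofbipolyCX.
- by rewrite !rmorphD /= IHp IHq.
- by rewrite !rmorphM /= IHp IHq.
Qed.

Lemma bipolyX0 : bipoly 'X_ord0 = 'X%:P. Proof. by rewrite /bipoly mmapXU. Qed.
Lemma bipolyX1 : bipoly 'X_ord_max = 'X. Proof. by rewrite /bipoly mmapXU. Qed.
Lemma bipolyC a : bipoly a%:MP = a%:P%:P. Proof. by rewrite /bipoly mmapC. Qed.

Lemma ofbipolyK : cancel ofbipoly bipoly.
Proof.
have KC r : bipoly (ofbipoly r%:P) = r%:P.
  elim/poly_ind: r => [|r a IH]; first by rewrite !rmorph0.
  rewrite polyCD polyCM !(rmorphD, rmorphM) /= IH.
  by rewrite ofbipolyCX bipolyX0 ofbipolyCC bipolyC.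
elim/poly_ind => [|P r IH]; first by rewrite !rmorph0.
by rewrite !(rmorphD, rmorphM) /= IH ofbipolyX bipolyX1 KC.
Qed.

Lemma mmap_bipoly (S : comNzRingType) (f : {rmorphism L -> S}) a b F :
  mmap f (xy a b) F =
  (map_poly (horner_morph (fun x => mulrC a (f x))) (bipoly F)).[b].
Proof.
elim/mpoly_ring_ind: F => [c|i|p q IHp IHq|p q IHp IHq].
- by rewrite mmapC bipolyC map_polyC hornerC /= horner_morphC.
- rewrite mmapXU /bipoly /xy /= mmapXU /xy; case: (i == ord0).
    by rewrite map_polyC hornerC /= horner_morphX.
  by rewrite map_polyX hornerX.
- by rewrite mmapD IHp IHq !rmorphD hornerD.
- by rewrite rmorphM /= IHp IHq !rmorphM hornerM.
Qed.

Definition at_x (x : L) P : {poly L} := map_poly (horner_eval x) P.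

Lemma meval_bipoly x y F : F.@[xy x y] = (at_x x (bipoly F)).[y].
Proof.
rewrite /meval mmap_bipoly; congr (_.[y]); apply: eq_map_poly => r.
by rewrite /ofbipoly /horner_morph map_poly_id.
Qed.

Lemma at_x_eq0 x P : at_x x P = 0 -> exists P1, P = ('X - x%:P) *: P1.
Proof.
move=> P0; exists (map_poly (fun r => r %/ ('X - x%:P)) P).
apply/polyP => i; rewrite coefZ coef_map_id0 ?div0p // mulrC divpK //.
rewrite dvdp_XsubCl; apply/rootP.
by have /polyP/(_ i) := P0; rewrite coef_map /= coef0.
Qed.

Lemma scale_bipolyI c : c != 0 -> injective ( *:%R c : {poly {poly L}} -> _).
Proof.
by move=> c0 P Q /=; rewrite -!mul_polyC; apply: mulfI; rewrite polyC_eq0.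
Qed.

(** Gauss's lemma, by removing the roots of [c] one at a time: at a root [x] the product of
    [Q(x, Y)] and [D(x, Y)] is zero in the domain [L[Y]], so [X - x] divides [Q] or [D]. The factors
    removed are collected in [a] and [b]. *)
Lemma bipoly_Gauss c P Q D : c != 0 -> c *: P = Q * D ->
  exists Q' D' a b, [/\ a != 0, b != 0, Q = a *: Q', D = b *: D' & P = Q' * D'].
Proof.
elim: {c}(size c) {1 3 4}c (leqnn (size c)) Q D => [|n IHn] c sc Q D c0.
  by move: sc; rewrite leqn0 size_poly_eq0 (negPf c0).
move=> E; have [s1|/closed_rootP[x xc]] := eqVneq (size c) 1%N.
  have /size_poly1P[k k0 Ek] : size c == 1%N by apply/eqP.
  exists (k^-1%:P *: Q), D, k%:P, 1; rewrite polyC_eq0 k0 oner_eq0 scale1r.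
  split=> //; first by rewrite scalerA -polyCM mulfV // scale1r.
  by rewrite -scalerAl -E Ek scalerA -polyCM mulVf // scale1r.
have /factor_theorem[c' Ec] := xc.
have c'0 : c' != 0 by apply: contraNneq c0 => c'0; rewrite Ec c'0 mul0r.
have sc' : (size c' <= n)%N.
  by move: sc; rewrite Ec size_Mmonic ?monicXsubC // size_XsubC addn2.
have X0 : ('X - x%:P : {poly L}) != 0 by rewrite polyXsubC_eq0.
have /eqP : at_x x Q * at_x x D = 0.
  rewrite -rmorphM -E; apply/polyP => i.
  by rewrite coef_map coefZ coef0 /= /horner_eval hornerM (rootP xc) mul0r.
rewrite mulf_eq0 => /orP[] /eqP/at_x_eq0[R ER].
  have {}E : c' *: P = R * D.
    by apply: (scale_bipolyI X0); rewrite scalerA mulrC -Ec E ER scalerAl.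
  have [Q' [D' [a [b [a0 b0 EQ ED EP]]]]] := IHn c' sc' _ _ c'0 E.
  exists Q', D', (('X - x%:P) * a), b; split=> //; first by rewrite mulf_neq0.
  by rewrite ER EQ scalerA.
have {}E : c' *: P = Q * R.
  by apply: (scale_bipolyI X0); rewrite scalerA mulrC -Ec E ER scalerAr.
have [Q' [D' [a [b [a0 b0 EQ ED EP]]]]] := IHn c' sc' _ _ c'0 E.
exists Q', D', a, (('X - x%:P) * b); split=> //; first by rewrite mulf_neq0.
by rewrite ER ED scalerA.
Qed.

Lemma mpoly_unit_const F : F \is a GRing.unit -> exists2 k, k != 0 & F = k%:MP.
Proof.
by move=> /andP[/eqP E u]; exists F@_0; rewrite // -unitfE.
Qed.

Section Irreducible.
Variable F : {mpoly L[2]}.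
Hypothesis irrF : irreducible_elt F.
Hypothesis degF : (1 < size (bipoly F))%N.

Lemma bipoly_irr Q D : bipoly F = Q * D ->
  (exists2 k, k != 0 & Q = k%:P%:P) \/ (exists2 k, k != 0 & D = k%:P%:P).
Proof.
move=> E; have [_ _ irr] := irrF.
have /irr[] : F = ofbipoly Q * ofbipoly D by rewrite -rmorphM /= -E bipolyK.
  move=> /mpoly_unit_const[k k0 Ek]; left; exists k => //.
  by rewrite -[LHS]ofbipolyK Ek bipolyC.
move=> /mpoly_unit_const[k k0 Ek]; right; exists k => //.
by rewrite -[LHS]ofbipolyK Ek bipolyC.
Qed.

Lemma scale_bipoly_irr c D : bipoly F = c *: D -> exists2 k, k != 0 & c = k%:P.
Proof.
rewrite -mul_polyC => E; case: (bipoly_irr E) => [[k k0 /polyC_inj Ek]|[k _ Ek]].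
  by exists k.
move: degF; rewrite E Ek -polyCM => /leq_trans/(_ (size_polyC_leq1 _)).
by rewrite ltnn.
Qed.

(** The gcd over the fractions of [L[X]] has positive degree in [Y]. Gauss's lemma turns the
    pseudo-divisibility of [F] by it into a factorisation in [L[X][Y]], and irreducibility leaves
    only [F] up to factors in [L[X]]; a second use of Gauss's lemma clears the denominator in front
    of [g]. *)
Lemma resultant0_divides g : resultant (bipoly F) (bipoly g) = 0 -> divides F g.
Proof.
move/eqP; rewrite resultant_eq0; set D := gcdp _ _ => sD.
have /Pdiv.Idomain.dvdpP[[c Q] /= c0 E] := dvdp_gcdl (bipoly F) (bipoly g).
have [Q' [D' [a [b [a0 b0 _ ED EF]]]]] := bipoly_Gauss c0 E.
have sD' : (1 < size D')%N by rewrite -(size_scale D' b0) -ED.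
have [k k0 EQ'] : exists2 k, k != 0 & Q' = k%:P%:P.
  case: (bipoly_irr EF) => // -[k k0 Ek].
  by move: sD'; rewrite Ek ltnNge size_polyC_leq1.
have /Pdiv.Idomain.dvdpP[[c2 Q2] /= c20 E2] := dvdp_gcdr (bipoly F) (bipoly g).
have E3 : c2 *: bipoly g = (((b * k^-1%:P)%:P) * Q2) * bipoly F.
  rewrite E2 ED EF EQ' -mul_polyC polyCM.
  have : (k^-1%:P%:P * k%:P%:P : {poly {poly L}}) = 1.
    by rewrite -!polyCM mulVf.
  move=> Ek; rewrite -[LHS]mulr1 -Ek; ring.
have [Q3 [F' [_ [b' [_ b'0 _ EF' Eg]]]]] := bipoly_Gauss c20 E3.
have [k' k'0 Eb'] := scale_bipoly_irr EF'.
exists (ofbipoly (k'^-1%:P *: Q3)); rewrite -[g]bipolyK -[F in RHS]bipolyK -rmorphM.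
congr ofbipoly; rewrite EF' Eb' Eg -scalerAl -scalerAr scalerA -polyCM mulVf //.
by rewrite scale1r.
Qed.

Lemma at_x_irr x : at_x x (bipoly F) != 0.
Proof.
apply/eqP => /at_x_eq0[P1 /scale_bipoly_irr[k _ /(congr1 (size : {poly L} -> nat))]].
by rewrite size_XsubC => E; have := size_polyC_leq1 k; rewrite -E.
Qed.

Lemma coprime_combination g : ~ divides F g ->
  exists r A B, r != 0 /\ ofbipoly r%:P = A * F + B * g.
Proof.
(* The expression of the resultant as a combination requires positive degree in [Y] on both sides; a
   [g] free of [Y] is itself the combination. *)
move=> nFg; have [sg|sg] := leqP (size (bipoly g)) 1.
  have Eg := size1_polyC sg; exists (bipoly g)`_0, 0, 1; split.
    apply: contra_not_neq nFg => g0; exists 0; rewrite mul0r -[g]bipolyK.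
    by rewrite Eg g0 !rmorph0.
  by rewrite -Eg bipolyK mul0r add0r mul1r.
have [[u v] _ /= E] := resultant_in_ideal degF sg.
exists (resultant (bipoly F) (bipoly g)), (ofbipoly u), (ofbipoly v); split.
  by apply: contra_not_neq nFg; apply: resultant0_divides.
by rewrite E rmorphD !rmorphM /= !bipolyK.
Qed.

Lemma finite_common_zeros g : ~ divides F g ->
  exists s : seq (L * L),
    forall x y, F.@[xy x y] = 0 -> g.@[xy x y] = 0 -> (x, y) \in s.
Proof.
move=> /coprime_combination[r [A [B [r0 E]]]].
have [s sP] := poly_finite_roots r0.
have /choice[t tP] x := poly_finite_roots (at_x_irr x).
exists [seq (x, y) | x <- s, y <- t x] => x y Fxy gxy.
apply/allpairsPdep; exists x, y; split=> //.
  apply: sP; apply/rootP.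
  have /(congr1 (meval (xy x y))) := E; rewrite mevalD !mevalM Fxy gxy !mulr0 addr0.
  rewrite meval_bipoly ofbipolyK /at_x map_polyC hornerC //.
by apply: tP; apply/rootP; rewrite -meval_bipoly.
Qed.

Lemma curve_infinite (s : seq (L * L)) :
  exists x y, F.@[xy x y] = 0 /\ (x, y) \notin s.
Proof.
have lc0 : lead_coef (bipoly F) != 0.
  by rewrite lead_coef_eq0 -size_poly_gt0 ltnW.
have [x lx xs] := poly_nonroot (map fst s) lc0.
have /closed_rootP[y /rootP Fy] : size (at_x x (bipoly F)) != 1%N.
  by rewrite size_map_poly_id0 // gtn_eqF.
exists x, y; rewrite meval_bipoly; split=> //.
by apply: contra xs => /(map_f fst).
Qed.

Lemma vanishing_divides g :
  (forall x y, F.@[xy x y] = 0 -> g.@[xy x y] = 0) -> divides F g.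
Proof.
move=> gF; apply: contrapT => /finite_common_zeros[s sP].
have [x [y [Fxy /negP]]] := curve_infinite s; apply; apply: sP => //; exact: gF.
Qed.

End Irreducible.
End BivariatePoly.

Section Branch.
Variables (L : closedFieldType) (F : {mpoly L[2]}) (eta : {fps L}).
Hypothesis irrF : irreducible_elt F.
Hypothesis etaF : subst_series eta F = 0.

Lemma subst_series_polyX (r : {poly L}) i : subst_series eta (ofbipoly r%:P) i = r`_i.
Proof.
elim/poly_ind: r i => [|r a IH] i.
  by rewrite !rmorph0 subst_seriesE mmap0 coef0.
rewrite polyCD polyCM !(rmorphD, rmorphM) /= ofbipolyCX ofbipolyCC.
have -> : subst_series eta (ofbipoly r%:P * 'X_ord0 + a%:MP)
    = fpsX * subst_series eta (ofbipoly r%:P) + fpsC a.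
  by rewrite !subst_seriesE mmapD rmorphM /= mmapC mmapXU mulrC.
rewrite fps_coefD fps_coefXM coefD coefMX coefC.
by case: i => [|i]; rewrite ?IH.
Qed.

Lemma branch_degY : (1 < size (bipoly F))%N.
Proof.
rewrite ltnNge; apply/negP => /size1_polyC EF; have [/eqP] := irrF; case.
rewrite -[F]bipolyK EF; have -> : (bipoly F)`_0 = 0; last by rewrite !rmorph0.
apply/polyP => i; rewrite -subst_series_polyX -EF bipolyK etaF coef0 //.
Qed.

(** If [F] did not divide [g], a nonzero [r] in [L[X]] would be a combination of [F] and [g], and so
    vanish at [(X, eta)]; but substitution leaves [r] unchanged. This is part (i) of the theorem,
    and it also makes [F] a prime element. *)
Lemma subst_series_divides g : subst_series eta g = 0 <-> divides F g.
Proof.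
split=> [g0|[q ->]]; last by rewrite subst_seriesE rmorphM /= -!subst_seriesE etaF mulr0.
apply: contrapT => /(coprime_combination irrF branch_degY)[r [A [B [/eqP r0 E]]]].
have E0 : subst_series eta (A * F + B * g) = 0.
  by rewrite subst_seriesE mmapD !rmorphM /= -!subst_seriesE etaF g0 !mulr0 addr0.
by apply: r0; apply/polyP => i; rewrite -subst_series_polyX E E0 coef0.
Qed.

End Branch.

(** * The valuation ring *)

Section Valuation.
Variables (L K : closedFieldType) (iota : {rmorphism L -> K}).

(** The valuation ring is bundled with its properties so that the subring structure and the residue
    morphism can be attached to it as canonical instances. *)
Record residue_ring := ResidueRing {
  rr_pred :> {pred K};
  rr_valuation : valuation_ring rr_pred;
  rr_const : forall a, iota a \in rr_pred;
  rr_nontrivial : exists2 x, x \in maxideal rr_pred & x != 0;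
  rr_residue : forall x, x \in rr_pred -> exists a, x - iota a \in maxideal rr_pred
}.

Lemma rr_subring (V : residue_ring) : subring_closed V.
Proof. by have [] := rr_valuation V. Qed.

HB.instance Definition _ (V : residue_ring) :=
  GRing.isSubringClosed.Build K (rr_pred V) (rr_subring V).

Definition vring (V : residue_ring) := {x : K | x \in rr_pred V}.

HB.instance Definition _ (V : residue_ring) := SubChoice.on (vring V).
HB.instance Definition _ (V : residue_ring) :=
  [SubChoice_isSubComNzRing of vring V by <:].

Variable V : residue_ring.
Implicit Types (x y : K) (a b c : vring V).

Definition vval a : K := \val a.

HB.instance Definition _ := GRing.RMorphism.copy vval (\val : vring V -> K).

Lemma vval_inj : injective vval. Proof. exact: val_inj. Qed.

Lemma vvalP x : x \in rr_pred V -> exists a, vval a = x.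
Proof. by move=> xV; exists (exist _ x xV). Qed.

Lemma mem_vval a : vval a \in rr_pred V. Proof. exact: valP. Qed.

Local Notation m := (maxideal (rr_pred V)).

Lemma maxideal_mem x : x \in m -> x \in rr_pred V.
Proof. by rewrite inE => /andP[]. Qed.

Lemma maxidealM x y : x \in m -> y \in rr_pred V -> x * y \in m.
Proof.
rewrite !inE => /andP[xV xm] yV; rewrite rpredM //=.
have [->|x0] := eqVneq x 0; first by rewrite mul0r eqxx.
have [->|y0] := eqVneq y 0; first by rewrite mulr0 eqxx.
rewrite (negPf x0) /= in xm; apply/orP; right; apply: contra xm => xy.
have -> : x^-1 = y * (x * y)^-1 by rewrite invfM mulrCA mulfV // mulr1.
exact: rpredM.
Qed.

Lemma maxidealD x y : x \in m -> y \in m -> x + y \in m.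
Proof.
move=> xm ym; have [->|x0] := eqVneq x 0; first by rewrite add0r.
have [->|y0] := eqVneq y 0; first by rewrite addr0.
have [_ /(_ (x / y))[xy|]] := rr_valuation V.
  have -> : x + y = y * (1 + x / y) by rewrite mulrDr mulr1 mulrC divfK // addrC.
  by apply: maxidealM => //; rewrite rpredD ?rpred1.
rewrite invfM invrK mulrC => yx.
have -> : x + y = x * (1 + y / x) by rewrite mulrDr mulr1 (mulrC x) divfK.
by apply: maxidealM => //; rewrite rpredD ?rpred1.
Qed.

Lemma maxidealN x : x \in m -> - x \in m.
Proof. by move=> xm; rewrite -mulrN1; apply: maxidealM => //; rewrite rpredN rpred1. Qed.

Lemma maxideal_iota (k : L) : iota k \in m -> k = 0.
Proof.
rewrite inE fmorph_eq0 => /andP[_ /orP[/eqP //|]].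
by rewrite -fmorphV rr_const.
Qed.

Definition vres a : L := projT1 (cid (rr_residue (mem_vval a))).

Lemma vresP a : vval a - iota (vres a) \in m.
Proof. by rewrite /vres; case: cid. Qed.

Lemma vres_uniq a (k : L) : vval a - iota k \in m -> vres a = k.
Proof.
move=> am; apply/eqP; rewrite -subr_eq0; apply/eqP/maxideal_iota.
rewrite rmorphB; have -> : iota (vres a) - iota k
  = (vval a - iota k) - (vval a - iota (vres a)) by ring.
by apply: maxidealD => //; apply/maxidealN/vresP.
Qed.

Fact vres_zmod_morphism : zmod_morphism vres.
Proof.
move=> a b; apply: vres_uniq; rewrite !rmorphB /=.
have -> : vval a - vval b - (iota (vres a) - iota (vres b)) =
  (vval a - iota (vres a)) - (vval b - iota (vres b)) by ring.
by apply: maxidealD; [|apply: maxidealN]; apply: vresP.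
Qed.

Fact vres_monoid_morphism : monoid_morphism vres.
Proof.
have m0 : 0 \in m by rewrite inE eqxx rpred0.
split=> [|a b]; apply: vres_uniq; first by rewrite !rmorph1 subrr.
rewrite !rmorphM /=; have -> : vval a * vval b - iota (vres a) * iota (vres b) =
  (vval a - iota (vres a)) * vval b + (vval b - iota (vres b)) * iota (vres a) by ring.
by apply: maxidealD; apply: maxidealM; rewrite ?vresP ?mem_vval ?rr_const.
Qed.

HB.instance Definition _ :=
  GRing.isZmodMorphism.Build (vring V) L vres vres_zmod_morphism.
HB.instance Definition _ :=
  GRing.isMonoidMorphism.Build (vring V) L vres vres_monoid_morphism.

Definition vconst (k : L) : vring V := exist _ (iota k) (rr_const V k).

Fact vconst_zmod_morphism : zmod_morphism vconst.
Proof. by move=> a b; apply: vval_inj; rewrite rmorphB /= /vval /= rmorphB. Qed.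

Fact vconst_monoid_morphism : monoid_morphism vconst.
Proof.
split=> [|a b]; apply: vval_inj; first by rewrite rmorph1 /vval /= rmorph1.
by rewrite rmorphM /= /vval /= rmorphM.
Qed.

HB.instance Definition _ :=
  GRing.isZmodMorphism.Build L (vring V) vconst vconst_zmod_morphism.
HB.instance Definition _ :=
  GRing.isMonoidMorphism.Build L (vring V) vconst vconst_monoid_morphism.

Lemma vres_const k : vres (vconst k) = k.
Proof. by apply: vres_uniq; rewrite subrr inE eqxx rpred0. Qed.

Lemma vres_eq0 a : (vres a == 0) = (vval a \in m).
Proof.
apply/eqP/idP => [a0|am]; first by have := vresP a; rewrite a0 rmorph0 subr0.
by apply: vres_uniq; rewrite rmorph0 subr0.
Qed.

Lemma vval_eq0 a : (vval a == 0) = (a == 0).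
Proof. by rewrite -(inj_eq vval_inj) rmorph0. Qed.

Lemma vunit a : vres a != 0 -> exists b, vval b = (vval a)^-1 /\ a * b = 1.
Proof.
move=> a0; have va0 : vval a != 0.
  by apply: contraNneq a0 => va0; rewrite vres_eq0 va0 inE eqxx rpred0.
have [_ /(_ (vval a))[_|]] := rr_valuation V.
  move: a0; rewrite vres_eq0 inE mem_vval (negPf va0) /= negbK => /vvalP[b Eb].
  by exists b; split=> //; apply: vval_inj; rewrite rmorphM /= Eb mulfV // rmorph1.
move=> /vvalP[b Eb]; exists b; split=> //.
by apply: vval_inj; rewrite rmorphM /= Eb mulfV // rmorph1.
Qed.

Lemma vring_or_inv x :
  (exists a, vval a = x) \/ (exists2 b, vval b = x^-1 & vres b = 0).
Proof.
have [xV|xV] := boolP (x \in rr_pred V); first by left; apply: vvalP.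
right; have [_ /(_ x)[|xV']] := rr_valuation V; first by rewrite (negPf xV).
have [b Eb] := vvalP xV'; exists b => //; apply/eqP.
by rewrite vres_eq0 Eb inE xV' /= invrK xV orbT.
Qed.

Lemma vring_infinitesimal : exists2 t, vval t != 0 & vres t = 0.
Proof.
have [x xm x0] := rr_nontrivial V; have [t Et] := vvalP (maxideal_mem xm).
by exists t; rewrite ?Et //; apply/eqP; rewrite vres_eq0 Et.
Qed.

Lemma specialisesE x (k : L) :
  (x \in rr_pred V /\ x - iota k \in m) <-> exists2 a, vval a = x & vres a = k.
Proof.
split=> [[/vvalP[a <-] /vres_uniq <-]|[a <- <-]]; first by exists a.
by rewrite mem_vval vresP.
Qed.

(** An entry of least valuation. No value group is constructed: the indices are run through, keeping
    an entry that divides all those already met. *)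
Lemma dominant_entry n (u : 'I_n -> K) : (exists i, u i != 0) ->
  exists2 i, u i != 0 & exists w : 'I_n -> vring V, forall j, u j = u i * vval (w j).
Proof.
move=> [i0 ui0]; pose dom i j := u j / u i \in rr_pred V.
suff [i [ui0' di]] : exists i, u i != 0 /\ forall j, j \in enum 'I_n -> dom i j.
  exists i => //; have /choice[w Ew] j : exists w, vval w = u j / u i.
    by apply/vvalP/di; rewrite mem_enum.
  by exists w => j; rewrite Ew mulrC divfK.
elim: (enum 'I_n) => [|k s [i [ui di]]]; first by exists i0.
have [_ /(_ (u k / u i))[ki|]] := rr_valuation V.
  by exists i; split=> // j; rewrite inE => /orP[/eqP ->|/di].
have [uk0|uk] := eqVneq (u k) 0.
  by exists i; split=> // j; rewrite inE /dom => /orP[/eqP ->|/di //]; rewrite uk0 mul0r rpred0.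
rewrite invfM invrK mulrC => ik; exists k; split=> // j.
rewrite inE /dom => /orP[/eqP ->|/di dj]; first by rewrite mulfV // rpred1.
have -> : u j / u k = (u j / u i) * (u i / u k) by rewrite mulrA divfK.
exact: rpredM.
Qed.

(** A root of the residue polynomial lifts: otherwise every root [x] satisfies
    [x^-1 \in O], and [P = P(0) * \prod (1 - X / x)] has residue [0]. *)
Lemma root_lift0 (P : {poly vring V}) :
  map_poly vres P != 0 -> root (map_poly vres P) 0 ->
  exists2 a, root P a & vres a = 0.
Proof.
move=> P0 rP; apply: contrapT => noroot.
have [s Es] := closed_field_poly_normal (map_poly vval P).
have lc0 : lead_coef (map_poly vval P) != 0.
  rewrite lead_coef_eq0 map_poly_eq0_id0; first by apply: contraNneq P0 => ->; rewrite rmorph0.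
  by rewrite vval_eq0 lead_coef_eq0; apply: contraNneq P0 => ->; rewrite rmorph0.
have rs x : x \in s -> exists2 b, vval b = x^-1 & x != 0.
  move=> xs; have rx : root (map_poly vval P) x by rewrite Es rootZ // root_prod_XsubC.
  have liftP a : vval a = x -> vres a != 0.
    move=> Ea; apply/eqP => a0; apply: noroot; exists a => //.
    by move: rx; rewrite -Ea !rootE horner_map vval_eq0.
  have [[a Ea]|[b Eb _]] := vring_or_inv x.
    have [b [Eb ab]] := vunit (liftP a Ea); exists b; rewrite ?Eb ?Ea //.
    have := liftP a Ea; apply: contraNneq => x0; rewrite (_ : a = 0) ?rmorph0 //.
    by apply/eqP; rewrite -vval_eq0 Ea x0.
  exists b => //; apply/eqP => x0; have := liftP 0.
  by rewrite rmorph0 x0 => /(_ erefl); rewrite rmorph0 eqxx.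
have [Q EQ] : exists Q : {poly vring V},
    \prod_(x <- s) ('X - x%:P) = (\prod_(x <- s) (- x))%:P * map_poly vval Q.
  elim: s rs {Es} => [|x s IHs] rs.
    by exists 1; rewrite !big_nil !rmorph1 mulr1.
  have [|Q EQ] := IHs; first by move=> y ys; apply: rs; rewrite inE ys orbT.
  have [b Eb x0] := rs x (mem_head _ _).
  exists ((1 - b%:P * 'X) * Q); rewrite !big_cons EQ polyCM rmorphM /=.
  have -> : map_poly vval (1 - b%:P * 'X) = 1 - (x^-1)%:P * 'X.
    by rewrite rmorphB rmorphM /= rmorph1 map_polyC map_polyX /= Eb.
  have -> : 'X - x%:P = (- x)%:P * (1 - (x^-1)%:P * 'X).
    by rewrite mulrBr mulr1 mulrA -polyCM mulNr mulfV // !polyCN mulN1r opprK addrC.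
  by rewrite mulrACA.
have P0E : map_poly vval P = (vval P`_0)%:P * map_poly vval Q.
  have [k E] : exists k, map_poly vval P = k%:P * map_poly vval Q.
    exists (lead_coef (map_poly vval P) * \prod_(x <- s) (- x)).
    by rewrite {1}Es EQ -mul_polyC polyCM mulrA.
  rewrite E; congr (_%:P * _).
  have Q0 : (map_poly vval Q)`_0 = 1.
    have /(congr1 (horner^~ 0)) := EQ; rewrite hornerM hornerC !horner_coef0 -horner_coef0.
    rewrite horner_prod; under eq_bigr => x _ do rewrite !hornerE.
    move=> /eqP; rewrite -subr_eq0 -{1}[\prod_(_ <- _) _]mulr1 -mulrBr mulf_eq0.
    case/orP=> [|/eqP/subr0_eq <- //].
    rewrite prodf_seq_eq0 => /hasP[x xs]; rewrite /= oppr_eq0.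
    by have [b _ /negPf ->] := rs x xs.
  by rewrite -coef_map E coefCM Q0 mulr1.
have EP : P = (P`_0)%:P * Q.
  apply: (map_inj_poly vval_inj (rmorph0 _)).
  by rewrite P0E rmorphM /= map_polyC.
move: P0; rewrite EP rmorphM /= map_polyC /=.
by move: rP; rewrite rootE horner_coef0 coef_map => /eqP ->; rewrite mul0r eqxx.
Qed.

Lemma root_lift (P : {poly vring V}) k :
  map_poly vres P != 0 -> root (map_poly vres P) k ->
  exists2 a, root P a & vres a = k.
Proof.
move=> P0 rP; pose P' := P \Po ('X + (vconst k)%:P).
have EP' : map_poly vres P' = map_poly vres P \Po ('X + k%:P).
  by rewrite map_comp_poly rmorphD /= map_polyX map_polyC /= vres_const.
have [||a ra a0] := @root_lift0 P'.
- rewrite EP'; apply: contra P0 => /eqP E.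
  have : (map_poly vres P \Po ('X + k%:P)) \Po ('X - k%:P) = 0 by rewrite E comp_poly0.
  by rewrite -comp_polyA comp_polyD comp_polyX comp_polyC subrK comp_polyXr => ->.
- by rewrite EP' rootE horner_comp !hornerE.
exists (a + vconst k); last by rewrite rmorphD /= a0 vres_const add0r.
by move: ra; rewrite !rootE horner_comp !hornerE.
Qed.

(** Otherwise [b = x^-1] lies in the maximal ideal. Dividing the equation by the top power of [x]
    writes it in powers of [b], and its residue says that the leading coefficient has residue 0. *)
Lemma root_integral (P : {poly vring V}) x :
  vres (lead_coef P) != 0 -> root (map_poly vval P) x -> exists a, vval a = x.
Proof.
move=> lc rx; have [//|[b Eb b0]] := vring_or_inv x.
have [x0|x0] := eqVneq x 0; first by exists 0; rewrite rmorph0 x0.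
have P0 : P != 0 by apply: contraNneq lc => ->; rewrite lead_coef0 rmorph0.
have : \sum_(i < size P) P`_i * b ^+ ((size P).-1 - i) = 0.
  apply: vval_inj; rewrite rmorph0 rmorph_sum /=.
  have := rx; rewrite rootE horner_coef size_map_poly_id0 ?vval_eq0 ?lead_coef_eq0 // => /eqP E.
  have x0n : x ^- (size P).-1 != 0 by rewrite invr_neq0 // expf_neq0.
  transitivity ((\sum_(i < size P) (map_poly vval P)`_i * x ^+ i) * x ^- (size P).-1).
    rewrite mulr_suml; apply: eq_bigr => i _.
    rewrite coef_map rmorphM rmorphXn /= Eb -mulrA; congr (_ * _).
    have iP : (i <= (size P).-1)%N by rewrite -ltnS prednK ?size_poly_gt0.
    by rewrite -{2}(subnK iP) exprD invfM mulrCA mulfV ?expf_neq0 // mulr1 exprVn.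
  by rewrite E mul0r.
rewrite -(prednK (_ : 0 < size P)%N) ?size_poly_gt0 // big_ord_recr /= subnn mulr1.
move=> /(congr1 vres); rewrite rmorphD rmorph0 rmorph_sum /= big1 ?add0r.
  by move=> E; move: lc; rewrite lead_coefE E eqxx.
move=> i _; rewrite rmorphM rmorphXn /= b0 expr0n subn_eq0 leqNgt ltn_ord /=.
by rewrite mulr0.
Qed.

End Valuation.

(** * Lifting and counting common zeros *)

Section Shear.
Variable R : comNzRingType.
Implicit Types (P Q : {poly {poly R}}) (F : {mpoly R[2]}).

Lemma top_coefM (S : nzRingType) (P Q : {poly S}) n m :
  (size P <= n.+1)%N -> (size Q <= m.+1)%N -> (P * Q)`_(n + m) = P`_n * Q`_m.
Proof.
move=> sP sQ; rewrite coefM.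
have nlt : (n < (n + m).+1)%N by rewrite ltnS leq_addr.
rewrite (bigD1 (Ordinal nlt)) //= addKn big1 ?addr0 // => i /eqP ni.
have [ltin|ltni|] := ltngtP i n; last by move=> Ei; case: ni; apply: val_inj.
  rewrite [X in _ * X]nth_default ?mulr0 //; apply: leq_trans sQ _.
  by rewrite ltn_subRL ltn_add2r.
by rewrite [X in X * _]nth_default ?mul0r //; apply: leq_trans sP _.
Qed.

(** [F(X + c Z, Z)], as a polynomial in [Z] over [R[X]] *)
Definition shear (c : R) F : {poly {poly R}} :=
  mmap (polyC \o polyC) (xy ('X%:P + c%:P%:P * 'X) 'X) F.

Lemma horner_shear (S : comNzRingType) (h : {rmorphism {poly R} -> S}) c F z :
  (map_poly h (shear c F)).[z] = mmap (h \o polyC) (xy (h 'X + h c%:P * z) z) F.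
Proof.
rewrite -[LHS]/((horner_eval z \o map_poly h) (shear c F)) rmorph_mmap_xy.
apply: eq_mmap => [a|i] /=; first by rewrite map_polyC /= /horner_eval hornerC.
rewrite /xy; case: ifP => _; last by rewrite map_polyX /horner_eval hornerX.
by rewrite rmorphD rmorphM /= !map_polyC map_polyX /= /horner_eval !hornerE.
Qed.

(** If [F_d] is the form of highest degree of [F], this is [F_d(T, 1)]. Its value at [c] is the
    coefficient of [Z^d] in [F(X + c Z, Z)], and its roots [a] give the points at infinity
    [(a : 1 : 0)]. *)
Definition top_form F : {poly R} :=
  \sum_(m <- msupp F | mdeg m == (msize F).-1) F@_m *: 'X^(m ord0).

Lemma top_form_neq0 F : F != 0 -> top_form F != 0.
Proof.
move=> F0; pose m := mlead F; apply/eqP => /polyP/(_ (m ord0)).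
rewrite coef0 /top_form coef_sum big_mkcond (bigD1_seq m) ?msupp_uniq ?mlead_supp //=.
rewrite -mlead_deg // eqxx coefZ coefXn eqxx mulr1 big1 => [|m' mm'].
  by rewrite addr0 => /eqP; rewrite mleadc_eq0 (negPf F0).
case: eqP => // dm'; move/eqP: mm' => mm'.
rewrite coefZ coefXn; case: eqP => [E|]; rewrite ?mulr0 // ; case: mm'.
have dm : mdeg m' = mdeg m by rewrite dm'.
move: dm; rewrite !mdegE !big_ord_recl !big_ord0 !addn0 E => /addnI E1.
apply/mnmP => i; case: (unliftP ord0 i) => [j|] -> //.
by have -> : j = ord0 by apply: val_inj; rewrite /= ord1.
Qed.

Lemma shear_top c F : F != 0 -> (size (shear c F) <= (msize F).-1.+1)%N
  /\ (shear c F)`_(msize F).-1 = (top_form F).[c]%:P.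
Proof.
move=> F0; set A := 'X%:P + c%:P%:P * 'X : {poly {poly R}}.
have sA : (size A <= 2)%N.
  apply: leq_trans (size_polyD _ _) _; rewrite geq_max (leq_trans (size_polyC_leq1 _)) //.
  by rewrite (leq_trans (size_polyMleq _ _)) // size_polyX addn2 /= ltnS size_polyC_leq1.
have sAk k : (size (A ^+ k) <= k.+1)%N.
  apply: leq_trans (size_poly_exp_leq _ _) _; rewrite ltnS.
  by rewrite -{2}[k]mul1n leq_mul2r; apply/orP; right; rewrite -ltnS (leq_trans (leqSpred _)) ?ltnS //; case: (size A) sA.
have cAk k : (A ^+ k)`_k = (c ^+ k)%:P.
  elim: k => [|k IH]; first by rewrite !expr0 coefC eqxx.
  rewrite exprS -add1n top_coefM // IH exprD expr1 polyCM; congr (_ * _).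
  by rewrite /A coefD coefC coefMX coefC /= add0r.
pose t (m : 'X_{1..2}) := mmap1 (xy A 'X) m.
have Et m : t m = A ^+ m ord0 * 'X^(m ord_max).
  rewrite /t /mmap1 big_ord_recl big_ord1; congr (_ * _).
  by have -> : lift ord0 ord0 = ord_max :> 'I_2 by apply: val_inj.
have Ed (m : 'X_{1..2}) : mdeg m = (m ord0 + m ord_max)%N.
  rewrite mdegE big_ord_recl big_ord1.
  by have -> : lift ord0 ord0 = ord_max :> 'I_2 by apply: val_inj.
have st m : (size (t m) <= (mdeg m).+1)%N.
  rewrite Et Ed (leq_trans (size_polyMleq _ _)) // size_polyXn addnS /=.
  by rewrite -addSn leq_add2r.
have ct m : (t m)`_(mdeg m) = (c ^+ m ord0)%:P.
  by rewrite Et Ed top_coefM ?size_polyXn // cAk coefXn eqxx mulr1.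
have szm m : m \in msupp F -> (mdeg m <= (msize F).-1)%N.
  by move=> /msize_mdeg_lt; case: (msize F).
split.
  rewrite /shear /mmap big_seq; apply: (big_ind (fun P : {poly {poly R}} => size P <= (msize F).-1.+1)%N).
  - by rewrite size_poly0.
  - by move=> P Q sP sQ; rewrite (leq_trans (size_polyD _ _)) // geq_max sP.
  - move=> m /szm dm; rewrite -/A -/(t m) /= mul_polyC (leq_trans (size_scale_leq _ _)) //.
    by rewrite (leq_trans (st m)).
rewrite /shear /mmap coef_sum /top_form horner_sum rmorph_sum /= [RHS]big_mkcond /=.
apply: eq_big_seq => m /szm dm; rewrite -/A -/(t m) coefCM; case: eqP => [<-|/eqP nd].
  by rewrite ct hornerZ hornerXn polyCM.
rewrite nth_default ?mulr0 // (leq_trans (st m)) // ltn_neqAle nd dm //.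
Qed.

End Shear.

Lemma field_resultant0 (E : closedFieldType) (p q : {poly E}) : p != 0 ->
  resultant p q = 0 <-> exists2 z, root p z & root q z.
Proof.
move=> p0; have g0 : gcdp p q != 0 by rewrite gcdp_eq0 (negPf p0).
split=> [/eqP|[z pz qz]].
  rewrite resultant_eq0 => sg; have /closed_rootP[z] : size (gcdp p q) != 1%N.
    by rewrite gtn_eqF.
  by rewrite root_gcd => /andP[]; exists z.
apply/eqP; rewrite resultant_eq0; apply: (@root_size_gt1 _ z) => //.
by rewrite root_gcd pz.
Qed.

Section Existence.
Variables (L K : closedFieldType) (iota : {rmorphism L -> K}) (V : residue_ring iota).
Notation R := (vring V).
Notation res := (@vres L K iota V).
Notation vv := (@vval L K iota V).
Notation cst := (@vconst L K iota V).

Variables (G : {mpoly L[2]}) (f : {mpoly R[2]}) (s : seq (L * L)) (x0 z0 : L).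
Let fb := map_mpoly res f.
Hypotheses (G0 : G != 0) (Gp : G.@[xy x0 z0] = 0) (fp : fb.@[xy x0 z0] = 0).
Hypothesis sP : forall x z, G.@[xy x z] = 0 -> fb.@[xy x z] = 0 -> (x, z) \in s.

(** In the coordinate [x - c z], for general [c], the point [(x0, z0)] is the
    only common zero on its fibre and [G] has constant leading coefficient in
    [z], so a root of the resultant near [x0 - c z0] yields the point sought. *)
Lemma lift_common_zero : exists x z : R,
  [/\ res x = x0, res z = z0, mmap cst (xy x z) G = 0 & f.@[xy x z] = 0].
Proof.
(* [c] avoids the roots of the top form, and the slopes of the lines joining [(x0, z0)] to the other
   common zeros. For points with [z = z0] the quotient is 0 by convention, which merely excludes one
   more value. *)
have [c kc cs] := poly_nonroot [seq (p.1 - x0) / (p.2 - z0) | p <- s] (top_form_neq0 G0).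
set k := (top_form G).[c] in kc; set d := (msize G).-1.
have [sG cG] := shear_top c G0; rewrite -/d -/k in sG cG.
have sep x z : (x, z) \in s -> x - c * z = x0 - c * z0 -> x = x0 /\ z = z0.
  move=> xzs E; have [Ez|nz] := eqVneq z z0.
    by move: E; rewrite Ez => /addIr.
  have nz' : z - z0 != 0 by rewrite subr_eq0.
  case/negP: cs; apply/mapP; exists (x, z) => //=; apply: (mulIf nz').
  rewrite divfK //; have -> : x = x0 - c * z0 + c * z by rewrite -E subrK.
  by ring.
pose P := shear (cst c) (map_mpoly cst G).
pose q0 := shear (cst c) f; have [N EN] : exists N, size q0 = N by exists (size q0).
have ccK : res \o cst =1 idfun by move=> a; apply: vres_const.
have EPres : map_poly (map_poly res) P = shear c G.
  rewrite /P /shear (rmorph_mmap_xy _ (map_poly (map_poly res))) mmap_map_mpoly.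
  apply: eq_mmap => [a|i] /=; first by rewrite !map_polyC /= map_polyC /= vres_const.
  by rewrite /xy rmorphD rmorphM /= !map_polyC /= map_polyC !map_polyX /= vres_const.
have EPc : P = map_poly (map_poly cst) (shear c G).
  rewrite /P /shear mmap_map_mpoly (rmorph_mmap_xy _ (map_poly (map_poly cst))).
  apply: eq_mmap => [a|i] /=; first by rewrite !map_polyC /= map_polyC.
  by rewrite /xy rmorphD rmorphM /= !map_polyC /= map_polyC !map_polyX.
have ck0 : cst k != 0 by apply: contraNneq kc => E; rewrite -(vres_const V k) E rmorph0.
have cP : P`_d = (cst k)%:P by rewrite EPc coef_map cG /= map_polyC.
have sP' : size P = d.+1.
  apply/eqP; rewrite eqn_leq; apply/andP; split.
    by rewrite EPc; apply: leq_trans (size_poly _ _) sG.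
  by rewrite ltnNge; apply: contra ck0 => /(nth_default 0); rewrite cP => /polyC_inj ->.
have lP : lead_coef P = (cst k)%:P by rewrite lead_coefE sP' cP.
(* Adding a multiple of [P] of large degree does not change the common zeros with [P]. It makes the
   leading coefficient the constant [k], so that the resultant commutes both with reduction and with
   evaluation in [K]. *)
pose q := 'X^N * P + q0.
have lq : lead_coef q = (cst k)%:P.
  rewrite /q mulrC lead_coefDl; first by rewrite lead_coef_Mmonic ?monicXn.
  have P0 : P != 0 by rewrite -size_poly_gt0 sP'.
  have -> : size (P * 'X^N) = (d + N).+1.
    rewrite (size_Mmonic P0 (monicXn _ _)).
    rewrite size_polyXn.
    rewrite sP' addSn addnS.
    done.
  rewrite EN.
  by rewrite ltnS leq_addl.
pose r := resultant P q.
have evr (E : closedFieldType) (h : {rmorphism {poly R} -> E}) : h (cst k)%:P != 0 ->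
    h r = 0 <-> exists z, mmap (h \o polyC \o cst) (xy (h 'X + h (cst c)%:P * z) z) G = 0
                       /\ mmap (h \o polyC) (xy (h 'X + h (cst c)%:P * z) z) f = 0.
  move=> hk; rewrite /r map_resultant ?lP ?lq //.
  have hP0 : map_poly h P != 0.
    by rewrite -lead_coef_eq0 lead_coef_map_eq lP.
  rewrite (field_resultant0 _ hP0).
  have EhP z : (map_poly h P).[z] = mmap (h \o polyC \o cst) (xy (h 'X + h (cst c)%:P * z) z) G.
    by rewrite /P horner_shear mmap_map_mpoly.
  have Ehq z : (map_poly h q).[z] = z ^+ N * (map_poly h P).[z] + mmap (h \o polyC) (xy (h 'X + h (cst c)%:P * z) z) f.
    by rewrite /q rmorphD rmorphM /= map_polyXn hornerD hornerM hornerXn -horner_shear.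
  split=> [[z /rootP Pz /rootP qz]|[z [Gz fz]]]; exists z.
  - by rewrite -EhP; split=> //; move: qz; rewrite Ehq Pz mulr0 add0r.
  - by apply/rootP; rewrite EhP.
  - by apply/rootP; rewrite Ehq EhP Gz mulr0 add0r.
pose rb := map_poly res r.
have rbP t : rb.[t] = 0 <-> exists z, G.@[xy (t + c * z) z] = 0 /\ fb.@[xy (t + c * z) z] = 0.
  have [h [hr hX hC]] : exists h : {rmorphism {poly R} -> L},
      [/\ rb.[t] = h r, h 'X = t & forall a, h a%:P = res a].
    exists (horner_eval t \o map_poly res); split=> //= [|a]; rewrite /horner_eval.
      by rewrite map_polyX hornerX.
    by rewrite map_polyC hornerC.
  have hcst a : (h \o polyC \o cst) a = a := etrans (hC _) (vres_const V a).
  have EG z : mmap (h \o polyC \o cst) (xy (t + c * z) z) G = G.@[xy (t + c * z) z].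
    exact: eq_mmap.
  have Ef z : mmap (h \o polyC) (xy (t + c * z) z) f = fb.@[xy (t + c * z) z].
    by rewrite meval_map_mpoly; apply: eq_mmap.
  rewrite hr evr; last by rewrite hC vres_const.
  by split=> -[z zP]; exists z; move: zP; rewrite hX hC vres_const EG Ef.
(* Only finitely many fibres [x - c z = t] meet the finite set [s]. *)
have rb0 : rb != 0.
  have [t ts] := closed_field_infinite [seq p.1 - c * p.2 | p <- s].
  apply: contraNneq ts => rb0; have /rbP[z [Gz fz]] : rb.[t] = 0 by rewrite rb0 horner0.
  by apply/mapP; exists (t + c * z, z); [exact: sP | rewrite /= addrK].
have [a0 ra0 Ea0] : exists2 a, root r a & res a = x0 - c * z0.
  apply: root_lift rb0 _; apply/rootP/rbP; exists z0; rewrite subrK; split=> //.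
have [h [hr hX hC hh]] : exists h : {rmorphism {poly R} -> K},
    [/\ h r = 0, h 'X = vv a0, forall a, h a%:P = vv a & forall u, h u = vv u.[a0]].
  exists (horner_eval (vv a0) \o map_poly vv); split=> /= [||a|u]; rewrite /horner_eval.
  - by rewrite horner_map (rootP ra0) rmorph0.
  - by rewrite map_polyX hornerX.
  - by rewrite map_polyC hornerC.
  - by rewrite horner_map.
have hk : h (cst k)%:P != 0 by rewrite hC vval_eq0.
have /(evr _ _ hk)[z [Gz fz]] := hr; rewrite hX hC in Gz fz.
(* The root found in [K] lies in [O], because the leading coefficient of [P] is a unit there. *)
have [b Eb] : exists b, vv b = z.
  apply: (@root_integral _ _ _ _ (map_poly (horner_eval a0) P)).
    rewrite lead_coef_map_eq lP /= /horner_eval hornerC ?vres_const //.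
  apply/rootP; rewrite -map_poly_comp -[RHS]Gz.
  have -> : map_poly (vv \o horner_eval a0) P = map_poly h P.
    by apply: eq_map_poly => u; rewrite hh.
  by rewrite /P horner_shear mmap_map_mpoly hX hC.
have hG : mmap cst (xy (a0 + cst c * b) b) G = 0.
  apply: (@vval_inj _ _ _ V); rewrite rmorph0 -[RHS]Gz (rmorph_mmap_xy _ vv).
  by apply: eq_mmap => [u|i]; rewrite /= ?hC // /xy rmorphD rmorphM /= Eb.
have hf : f.@[xy (a0 + cst c * b) b] = 0.
  apply: (@vval_inj _ _ _ V); rewrite rmorph0 -[RHS]fz /meval (rmorph_mmap_xy _ vv).
  by apply: eq_mmap => [u|i]; rewrite /= ?hC // /xy rmorphD rmorphM /= Eb.
have Gr : G.@[xy (res (a0 + cst c * b)) (res b)] = 0.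
  have := congr1 res hG; rewrite rmorph0 (rmorph_mmap_xy _ res) => <-.
  by apply: eq_mmap => // u; rewrite /= vres_const.
have fr : fb.@[xy (res (a0 + cst c * b)) (res b)] = 0.
  have := congr1 res hf; rewrite rmorph0 /meval (rmorph_mmap_xy _ res) => <-.
  by rewrite mmap_map_mpoly.
(* The reduction of the new point is a common zero on the fibre of [(x0, z0)], hence equal to it by
   the choice of [c]. *)
have [|Ex Ez] := sep _ _ (sP Gr fr).
  by rewrite rmorphD rmorphM /= vres_const addrK.
by exists (a0 + cst c * b), b.
Qed.

End Existence.

Lemma subst_series_coef0_xy (L : fieldType) (eta : {fps L}) p :
  subst_series eta p 0%N = p.@[xy 0 (eta 0%N)].
Proof.
rewrite -[LHS]/(@fps_at0 L _) subst_seriesE rmorph_mmap.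
by apply: eq_mmap => // i; rewrite comp_xy /xy; case: (i == ord0).
Qed.

Lemma mmap_xy_Taylor (R S : comNzRingType) (f : {rmorphism R -> S}) a b s p :
  exists q, mmap f (xy a (b + s)) p =
    mmap f (xy a b) p + s * (mmap f (xy a b) p^`M(ord_max) + s * q).
Proof.
have [q Eq] := mmap_Taylor1 f (xy a b) s (xy 0 1) p; exists q.
rewrite -[LHS](_ : mmap f (fun i => xy a b i + s * xy 0 1 i) p = _); last first.
  by apply: eq_mmap => // i; rewrite /xy; case: ifP; rewrite ?mulr0 ?addr0 ?mulr1.
rewrite Eq big_ord_recl big_ord1 /xy /= mul0r add0r mul1r.
have -> : lift ord0 ord0 = ord_max :> 'I_2 by apply: val_inj.
by rewrite -/(xy a b); ring.
Qed.

Lemma mmap_mpolyC_xy (R : comNzRingType) (g : {mpoly R[2]}) :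
  mmap (@mpolyC 2 R) (xy 'X_ord0 'X_ord_max) g = g.
Proof.
rewrite -[RHS](comp_mpoly_id g) /comp_mpoly; apply: eq_mmap => // i.
rewrite tnth_mktuple /xy; case: (unliftP ord0 i) => [j|] -> //=.
by congr 'X_(_); apply: val_inj; rewrite /= ord1.
Qed.

Lemma mpoly_divide_point (R : comNzRingType) (g : {mpoly R[2]}) x z :
  g.@[xy x z] = 0 ->
  exists A B, g = ('X_ord0 - x%:MP) * A + ('X_ord_max - z%:MP) * B.
Proof.
move=> g0; have [A [B]] :=
  mmap_xy_sub (@mpolyC 2 R) 'X_ord0 'X_ord_max x%:MP z%:MP g.
have -> : mmap (@mpolyC 2 R) (xy x%:MP z%:MP) g = 0.
  by rewrite -(mpolyC0 2) -g0 /meval (rmorph_mmap_xy _ (@mpolyC 2 R)).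
by rewrite subr0 mmap_mpolyC_xy; exists A, B.
Qed.

(** With [f = (X - x) A + (Z - z) B] and [G = (X - x) C + (Z - z) D], one has
    [D f = (X - x) (A D - B C) + B G]. *)
Lemma branch_division (R : comNzRingType) (G f : {mpoly R[2]}) x z :
    G.@[xy x z] = 0 -> f.@[xy x z] = 0 ->
  exists D g B, D * f = ('X_ord0 - x%:MP) * g + B * G /\
    D.@[xy x z] = G^`M(ord_max).@[xy x z].
Proof.
move=> /mpoly_divide_point[C [D EG]] /mpoly_divide_point[A [B Ef]].
exists D, (A * D - B * C), B; split; first by rewrite Ef EG; ring.
have dX : ('X_ord0 - x%:MP : {mpoly R[2]})^`M(ord_max) = 0.
  by rewrite mderivB mderivC mderivX mnm1E /= scale0r subrr.
have dZ : ('X_ord_max - z%:MP : {mpoly R[2]})^`M(ord_max) = 1.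
  rewrite mderivB mderivC mderivX mnm1E /= scale1r subr0 (_ : (_ - _)%MM = 0%MM) ?mpolyX0 //.
  by apply/mnmP => i; rewrite mnmBE mnm0E subnn.
have eX : ('X_ord0 - x%:MP : {mpoly R[2]}).@[xy x z] = 0.
  by rewrite mevalB mevalXU mevalC subrr.
have eZ : ('X_ord_max - z%:MP : {mpoly R[2]}).@[xy x z] = 0.
  by rewrite mevalB mevalXU mevalC subrr.
rewrite EG mderivD !mderivM dX dZ mul0r add0r mul1r.
by rewrite !mevalD 2!mevalM eX eZ !mul0r add0r addr0.
Qed.

Section Count.
Variables (L K : closedFieldType) (iota : {rmorphism L -> K}) (V : residue_ring iota).
Notation R := (vring V).
Notation res := (@vres L K iota V).
Notation vv := (@vval L K iota V).
Notation cst := (@vconst L K iota V).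

Variables (G : {mpoly L[2]}) (zeta : {fps L}).
Hypothesis Gzeta : subst_series zeta G = 0.
Hypothesis Gz0 : G^`M(ord_max).@[xy 0 (zeta 0%N)] != 0.
Hypothesis finG : forall g, subst_series zeta g <> 0 ->
  exists s : seq (L * L), forall x z, G.@[xy x z] = 0 -> g.@[xy x z] = 0 -> (x, z) \in s.

Definition near_branch (x z : R) : Prop :=
  [/\ res x = 0, res z = zeta 0%N & mmap cst (xy x z) G = 0].

Lemma res_eval x z (f : {mpoly R[2]}) : res x = 0 -> res z = zeta 0%N ->
  res f.@[xy x z] = subst_series zeta (map_mpoly res f) 0%N.
Proof.
move=> x0 z0; rewrite subst_series_coef0_xy /meval (rmorph_mmap_xy _ res).
by rewrite mmap_map_mpoly /= x0 z0.
Qed.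

Lemma res_eval_cst x z (g : {mpoly L[2]}) : res x = 0 -> res z = zeta 0%N ->
  res (mmap cst (xy x z) g) = g.@[xy 0 (zeta 0%N)].
Proof.
move=> x0 z0; rewrite (rmorph_mmap_xy _ res) /= x0 z0.
by apply: eq_mmap => // a; apply: vres_const.
Qed.

Lemma vring_mulf0 (a b : R) : a * b = 0 -> a = 0 \/ b = 0.
Proof.
move=> /(congr1 vv)/eqP; rewrite rmorphM rmorph0 mulf_eq0 !vval_eq0.
by case/orP=> /eqP; [left | right].
Qed.

Lemma res_neq0 (a : R) : res a != 0 -> a <> 0.
Proof. by move=> a0 E; rewrite E rmorph0 eqxx in a0. Qed.

(** The Taylor expansion in [z] gives [0 = (z - z')(G_Z + (z - z') q)]. The second factor has the
    residue of [G_Z], which is nonzero. *)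
Lemma near_branch_uniq x z z' : near_branch x z -> near_branch x z' -> z = z'.
Proof.
move=> [x0 z0 Gz] [_ z0' Gz'].
have [q Eq] := mmap_xy_Taylor cst x z' (z - z') G.
move: Eq; rewrite subrKC Gz Gz' add0r => /esym/vring_mulf0[/subr0_eq //|].
move=> /(congr1 res); rewrite rmorphD rmorph0 rmorphM rmorphB /= z0 z0' subrr mul0r addr0.
by rewrite res_eval_cst // => E; case/eqP: Gz0.
Qed.

Lemma near_branch_lift (f : {mpoly R[2]}) :
  subst_series zeta (map_mpoly res f) <> 0 ->
  subst_series zeta (map_mpoly res f) 0%N = 0 ->
  exists x z, near_branch x z /\ f.@[xy x z] = 0.
Proof.
move=> f0 fp; have [s sP] := finG f0.
have G0 : G != 0 by apply: contraNneq Gz0 => ->; rewrite mderiv0 meval0.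
have Gp : G.@[xy 0 (zeta 0%N)] = 0 by rewrite -subst_series_coef0_xy Gzeta.
rewrite subst_series_coef0_xy in fp.
by have [x [z [x0 z0 Gxz fxz]]] := lift_common_zero G0 Gp fp sP; exists x, z.
Qed.

(** The restriction of [f] to the line through [(x, z)] with direction [(1, t)]. Polynomials modulo
    ['X^2] play the role of dual numbers, so divisibility by ['X^2] means that [f] vanishes to first
    order in that direction. *)
Definition dual_eval (x z t : K) (f : {mpoly R[2]}) : {poly K} :=
  mmap (polyC \o vv) (xy (x%:P + 'X) (z%:P + t *: 'X)) f.

Fact dual_eval_zmod_morphism x z t : zmod_morphism (dual_eval x z t).
Proof. by move=> p q; rewrite /dual_eval mmapB. Qed.
Fact dual_eval_monoid_morphism x z t : monoid_morphism (dual_eval x z t).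
Proof. by split=> [|p q]; rewrite /dual_eval ?rmorph1 ?rmorphM. Qed.
HB.instance Definition _ x z t := GRing.isZmodMorphism.Build {mpoly R[2]} {poly K}
  (dual_eval x z t) (dual_eval_zmod_morphism x z t).
HB.instance Definition _ x z t := GRing.isMonoidMorphism.Build {mpoly R[2]} {poly K}
  (dual_eval x z t) (dual_eval_monoid_morphism x z t).

Definition tangent_at (f : {mpoly R[2]}) (x z : R) : Prop := exists t : K,
  'X^2 %| dual_eval (vv x) (vv z) t (map_mpoly cst G) /\
  'X^2 %| dual_eval (vv x) (vv z) t f.

Lemma dual_eval0 x z t f : (dual_eval (vv x) (vv z) t f).[0] = vv f.@[xy x z].
Proof.
rewrite /meval (rmorph_mmap_xy _ vv) -[LHS]/(horner_eval 0 _) rmorph_mmap_xy.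
apply: eq_mmap => [a|i]; rewrite /= /horner_eval ?hornerC //.
by rewrite /xy; case: ifP; rewrite !hornerE.
Qed.

Lemma dual_cancel x z t (f g : {mpoly R[2]}) : g.@[xy x z] <> 0 ->
  'X^2 %| dual_eval (vv x) (vv z) t (g * f) -> 'X^2 %| dual_eval (vv x) (vv z) t f.
Proof.
move=> g0; rewrite rmorphM /= Gauss_dvdpr // coprimep_pexpl // -['X]subr0 -polyC0.
rewrite coprimep_sym coprimep_XsubC; apply/rootP; rewrite dual_eval0 => /eqP.
by rewrite vval_eq0 => /eqP.
Qed.

Lemma near_branch_tangent x z : near_branch x z -> exists t,
  'X^2 %| dual_eval (vv x) (vv z) t (map_mpoly cst G).
Proof.
move=> [x0 z0 Gxz]; pose u := xy (vv x) (vv z).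
pose Gx := mmap (vv \o cst) u G^`M(ord0); pose Gz := mmap (vv \o cst) u G^`M(ord_max).
have Gzn0 : Gz != 0.
  have -> : Gz = vv (mmap cst (xy x z) G^`M(ord_max)) by rewrite (rmorph_mmap_xy _ vv).
  by rewrite vval_eq0; apply/eqP/res_neq0; rewrite res_eval_cst.
exists (- Gx / Gz).
have [q Eq] := mmap_Taylor1 (polyC \o (vv \o cst)) (polyC \o u) 'X (polyC \o xy 1 (- Gx / Gz)) G.
have -> : dual_eval (vv x) (vv z) (- Gx / Gz) (map_mpoly cst G)
   = mmap (polyC \o (vv \o cst)) (fun i => (polyC \o u) i + 'X * (polyC \o xy 1 (- Gx / Gz)) i) G.
  rewrite /dual_eval mmap_map_mpoly; apply: eq_mmap => // i.
  by rewrite /u /xy /=; case: ifP => _; rewrite ?mulr1 // -mul_polyC (mulrC _ 'X).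
rewrite Eq big_ord_recl big_ord1.
have EC g : mmap (polyC \o (vv \o cst)) (polyC \o u) g = (mmap (vv \o cst) u g)%:P.
  by rewrite [RHS](rmorph_mmap polyC).
have -> : lift ord0 ord0 = ord_max :> 'I_2 by apply: val_inj.
rewrite !EC -/Gx -/Gz /xy /= mul1r.
have -> : mmap (vv \o cst) u G = 0.
  by rewrite -[RHS](rmorph0 vv) -Gxz (rmorph_mmap_xy _ vv).
rewrite -polyCM divfK // -polyCD subrr polyC0 mulr0 !add0r.
exact: dvdp_mulr.
Qed.

Lemma branch_zeros m (f : {mpoly R[2]}) :
  fps_ord (subst_series zeta (map_mpoly res f)) m ->
  exists s : seq (R * R), [/\ size s = m,
    forall x z, (x, z) \in s <-> near_branch x z /\ f.@[xy x z] = 0 &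
    uniq s \/ exists x z, (x, z) \in s /\ tangent_at f x z].
Proof.
elim: m f => [|m IHm] f ordf.
  exists [::]; split=> //; last by left.
  move=> x z; split=> // -[[x0 z0 _] fxz]; have [/eqP] := ordf; case.
  by rewrite -(res_eval f x0 z0) fxz rmorph0.
have f0 : subst_series zeta (map_mpoly res f) 0%N = 0 by have [_ ->] := ordf.
have [x1 [z1 [nb1 f1]]] := near_branch_lift (fps_ord_neq0 ordf) f0.
pose GR := map_mpoly cst G.
pose X : {mpoly R[2]} := 'X_ord0.
have GR1 : GR.@[xy x1 z1] = 0 by rewrite meval_map_mpoly; case: nb1.
have [D [g [B [E ED]]]] := branch_division GR1 f1; rewrite -/X in E.
have [rx1 rz1 _] := nb1; have GrK : map_mpoly res GR = G.
  by apply/mpolyP => i; rewrite !mcoeff_map_mpoly /= vres_const.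
have D0 : subst_series zeta (map_mpoly res D) 0%N != 0.
  rewrite -(res_eval D rx1 rz1) ED; have -> : GR^`M(ord_max) = map_mpoly cst G^`M(ord_max).
    by apply/mpolyP => i; rewrite mcoeff_deriv !mcoeff_map_mpoly /= mcoeff_deriv rmorphMn.
  by rewrite meval_map_mpoly res_eval_cst.
have unitD x z : near_branch x z -> D.@[xy x z] <> 0.
  by move=> [x0 z0 _]; apply: res_neq0; rewrite res_eval.
have nbG x z : near_branch x z -> GR.@[xy x z] = 0.
  by rewrite meval_map_mpoly; case.
(* As [x1] has residue 0, the reduction of the division identity reads [D f = X g] along the branch,
   where [D] has order 0. *)
have ordg : fps_ord (subst_series zeta (map_mpoly res g)) m.
  have ordD : fps_ord (subst_series zeta (map_mpoly res D)) 0 by split.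
  have ES : subst_series zeta (map_mpoly res D) * subst_series zeta (map_mpoly res f)
      = fpsX * subst_series zeta (map_mpoly res g).
    rewrite !subst_seriesE -rmorphM -rmorphM /= E rmorphD !rmorphM rmorphB /=.
    rewrite GrK map_mpolyX map_mpolyC /= rx1 mpolyC0 subr0 rmorphD !rmorphM /= mmapXU.
    by rewrite -[mmap _ _ G]subst_seriesE Gzeta mulr0 addr0.
  have ordX : fps_ord (fpsX : {fps L}) 1 by split=> [|[]//]; rewrite /= oner_eq0.
  have := fps_ord_mul ordD ordf; rewrite ES => ordE.
  have /fps_neq0_ord[k ordk] : subst_series zeta (map_mpoly res g) <> 0.
    by move=> g0; apply: (fps_ord_neq0 ordE); rewrite g0 mulr0.
  by have /eqP := fps_ord_uniq ordE (fps_ord_mul ordX ordk); rewrite eqSS => /eqP ->.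
have [s [ss sP sU]] := IHm g ordg.
have Eev x z : near_branch x z -> D.@[xy x z] * f.@[xy x z] = (x - x1) * g.@[xy x z].
  move=> nb; rewrite -mevalM E mevalD !mevalM mevalB mevalXU mevalC nbG // mulr0 addr0 //.
exists ((x1, z1) :: s); split; first by rewrite /= ss.
  move=> x z; rewrite inE; split.
    case/orP => [/eqP[-> ->] //|/sP[nb gxz]]; split=> //.
    by have := Eev _ _ nb; rewrite gxz mulr0 => /vring_mulf0[/(unitD _ _ nb)|].
  move=> [nb fxz]; have := Eev _ _ nb; rewrite fxz mulr0 => /esym/vring_mulf0[/subr0_eq Ex|gxz].
    by rewrite Ex in nb *; rewrite (near_branch_uniq nb nb1) eqxx.
  by apply/orP; right; apply/sP.
have dvdX2 x z t : 'X^2 %| dual_eval (vv x) (vv z) t GR -> near_branch x z ->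
    'X^2 %| dual_eval (vv x) (vv z) t ((X - x1%:MP) * g) -> 'X^2 %| dual_eval (vv x) (vv z) t f.
  move=> dG nb dg; apply: (dual_cancel (unitD _ _ nb)).
  rewrite E [dual_eval _ _ _ _]mmapD; apply: dvdp_add; first exact: dg.
  rewrite -[mmap _ _ _]/(dual_eval (vv x) (vv z) t (B * GR)) rmorphM /=.
  exact: dvdp_mull.
(* If the new zero is also a zero of [g], both factors of [(X - x1) g] vanish there, so in the
   tangent direction of [G] the product, hence [D f], is divisible by ['X^2]; since [D] does not
   vanish at the point, [f] is tangent. *)
have [in1|nin1] := boolP ((x1, z1) \in s).
  right; exists x1, z1; rewrite mem_head; split=> //.
  have [t tG] := near_branch_tangent nb1; exists t; split=> //.
  apply: dvdX2 => //; rewrite rmorphM expr2 /=; apply: dvdp_mul.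
    rewrite rmorphB /= /dual_eval mmapXU mmapC /xy /= addrAC subrr add0r //.
  rewrite -['X]subr0 -polyC0 dvdp_XsubCl; apply/rootP; rewrite dual_eval0.
  by have /sP[_ ->] := in1; rewrite rmorph0.
case: sU => [us|[x [z [xzs [t [tG tg]]]]]]; first by left; rewrite /= nin1.
right; exists x, z; split; first by rewrite inE xzs orbT.
exists t; split=> //; have /sP[nb _] := xzs.
by apply: dvdX2 => //; rewrite rmorphM dvdp_mull.
Qed.

End Count.

(** * The double point *)

Section Blowup.
Variable L : closedFieldType.
Implicit Types (p q g : {mpoly L[2]}) (x z : L) (zeta : {fps L}).

Notation X := ('X_ord0 : {mpoly L[2]}).
Notation Y := ('X_ord_max : {mpoly L[2]}).

Definition blowup : {mpoly L[2]} -> {mpoly L[2]} := mmap (@mpolyC 2 L) (xy X (X * Y)).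

Lemma blowupM p q : blowup (p * q) = blowup p * blowup q.
Proof. exact: rmorphM. Qed.
Lemma blowupD p q : blowup (p + q) = blowup p + blowup q.
Proof. exact: rmorphD. Qed.
Lemma blowupX : blowup X = X. Proof. by rewrite /blowup mmapXU. Qed.
Lemma blowupY : blowup Y = X * Y. Proof. by rewrite /blowup mmapXU. Qed.
Lemma blowupC c : blowup c%:MP = c%:MP. Proof. by rewrite /blowup mmapC. Qed.

Lemma mmap_blowup (S : comNzRingType) (f : {rmorphism L -> S}) a b p :
  mmap f (xy a b) (blowup p) = mmap f (xy a (a * b)) p.
Proof.
rewrite /blowup rmorph_mmap; apply: eq_mmap => [c|i]; first by rewrite /= mmapC.
by rewrite comp_xy rmorphM /= !mmapXU.
Qed.

Lemma subst_series_blowup zeta p :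
  subst_series zeta (blowup p) = subst_series (fpsX * zeta) p.
Proof. by rewrite subst_seriesE mmap_blowup. Qed.

(** Since [Z = Y / X], a polynomial in [X] and [Z] becomes one in [X] and [Y] once a power of [X] is
    cleared. *)
Lemma blowup_inv g : exists N h, blowup h = X ^+ N * g.
Proof.
elim/mpoly_ring_ind: g => [c|i|p q [N [h Eh]] [M [k Ek]]|p q [N [h Eh]] [M [k Ek]]].
- by exists 0%N, c%:MP; rewrite blowupC mul1r.
- case: (unliftP ord0 i) => [j|] ->; last by exists 0%N, X; rewrite blowupX mul1r.
  have -> : lift ord0 j = ord_max by apply: val_inj; rewrite /= ord1.
  by exists 1%N, Y; rewrite blowupY.
- exists (N + M)%N, (X ^+ M * h + X ^+ N * k).
  have EX n : blowup (X ^+ n) = X ^+ n by rewrite /blowup rmorphXn /= -/blowup blowupX.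
  by rewrite blowupD !blowupM Eh Ek !EX exprD; ring.
- by exists (N + M)%N, (h * k); rewrite blowupM Eh Ek exprD; ring.
Qed.

End Blowup.

Section NodeBranch.
Variables (L : closedFieldType) (F u0 u1 u2 : {mpoly L[2]}) (eta : {fps L}) (a' : L).

Notation X := ('X_ord0 : {mpoly L[2]}).
Notation Y := ('X_ord_max : {mpoly L[2]}).
Notation c0 := u0.@[fun=> 0].
Notation c1 := u1.@[fun=> 0].
Notation c2 := u2.@[fun=> 0].

Hypothesis irrF : irreducible_elt F.
Hypothesis EF : F = Y ^+ 2 * u0 + X * Y * u1 + X ^+ 2 * u2.
Hypothesis eta0 : eta 0%N = 0.
Hypothesis etaF : subst_series eta F = 0.

Definition strict_transform := Y ^+ 2 * blowup u0 + Y * blowup u1 + blowup u2.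
Notation G := strict_transform.

Definition slope_series : {fps L} := Fps (fun n => eta n.+1).
Notation zeta := slope_series.

Lemma fpsX_slope : fpsX * zeta = eta.
Proof. by apply/fpsP => n; rewrite fps_coefXM; case: n. Qed.

Lemma blowup_F : blowup F = X ^+ 2 * G.
Proof. by rewrite EF 2!blowupD !expr2 !blowupM blowupX blowupY /G; ring. Qed.

Lemma subst_slope g : subst_series zeta (blowup g) = subst_series eta g.
Proof. by rewrite subst_series_blowup fpsX_slope. Qed.

Lemma slope_G : subst_series zeta G = 0.
Proof.
apply: (@fpsXnI _ 2); rewrite mulr0 -etaF -subst_slope blowup_F !subst_seriesE.
by rewrite rmorphM rmorphXn /= mmapXU.
Qed.

Lemma mmap_G (S : comNzRingType) (f : {rmorphism L -> S}) a b :
  mmap f (xy a b) G = b ^+ 2 * mmap f (xy a (a * b)) u0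
    + b * mmap f (xy a (a * b)) u1 + mmap f (xy a (a * b)) u2.
Proof. by rewrite /G expr2 !mmapD !rmorphM /= !mmap_blowup !mmapXU expr2. Qed.

Lemma meval_G0 z : G.@[xy 0 z] = c0 * z ^+ 2 + c1 * z + c2.
Proof.
rewrite /meval mmap_G mul0r.
have E (u : {mpoly L[2]}) : mmap idfun (xy 0 0) u = u.@[fun=> 0].
  by apply: (@meval_eq 2 L (xy 0 0)) => i; rewrite /xy; case: ifP.
by rewrite !E; ring.
Qed.

Lemma slope_root : c0 * eta 1%N ^+ 2 + c1 * eta 1%N + c2 = 0.
Proof.
by rewrite -meval_G0 -[eta 1%N]/(zeta 0%N) -subst_series_coef0_xy slope_G.
Qed.

Hypothesis c0_neq0 : c0 != 0.
Hypothesis a'_root : c0 * a' ^+ 2 + c1 * a' + c2 = 0.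
Hypothesis a'_neq : eta 1%N != a'.

Lemma slope_c1 : c1 = - (c0 * (eta 1%N + a')).
Proof.
have d0 : eta 1%N - a' != 0 by rewrite subr_eq0.
apply: (mulfI d0); apply: subr0_eq.
transitivity ((c0 * eta 1%N ^+ 2 + c1 * eta 1%N + c2) - (c0 * a' ^+ 2 + c1 * a' + c2)).
  by ring.
by rewrite slope_root a'_root subrr.
Qed.

Lemma slope_c2 : c2 = c0 * eta 1%N * a'.
Proof.
by apply: (addrI (c0 * a' ^+ 2 + c1 * a')); rewrite a'_root slope_c1; ring.
Qed.

Lemma slope_factor z : c0 * z ^+ 2 + c1 * z + c2 = c0 * (z - eta 1%N) * (z - a').
Proof. by rewrite slope_c1 slope_c2; ring. Qed.

(** On the exceptional line [G(0, Z) = c0 (Z - a)(Z - a')] with [a = eta'(0)] and [a'] distinct, so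
    the derivative at [a] is [c0 (a - a')]. *)
Lemma strict_transform_unramified : G^`M(ord_max).@[xy 0 (zeta 0%N)] != 0.
Proof.
set v := xy 0 _; have -> : G^`M(ord_max).@[v] = c0 * (eta 1%N - a').
  have [q] := mmap_xy_Taylor (polyC : {rmorphism L -> {poly L}}) 0 (zeta 0%N)%:P 'X G.
  have EC g : mmap polyC (xy 0 (zeta 0%N)%:P) g = (g.@[v])%:P.
    by rewrite [RHS](rmorph_mmap_xy _ polyC) /= polyC0.
  rewrite !EC meval_G0 slope_root polyC0 add0r => /(congr1 (fun p : {poly L} => p`_1)).
  rewrite [RHS]coefXM /= coefD coefC coefXM /= addr0 => <-.
  have -> : mmap polyC (xy 0 ((zeta 0%N)%:P + 'X)) G =
     c0%:P * ((zeta 0%N)%:P + 'X) ^+ 2 + c1%:P * ((zeta 0%N)%:P + 'X) + c2%:P.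
    rewrite mmap_G mul0r.
    have E u : mmap polyC (xy 0 0) u = (u.@[fun=> 0])%:P :> {poly L}.
      rewrite [RHS](rmorph_mmap polyC); apply: eq_mmap => // i.
      by rewrite /xy /= polyC0; case: ifP.
    by rewrite !E; ring.
  have -> : c0%:P * ((zeta 0%N)%:P + 'X) ^+ 2 + c1%:P * ((zeta 0%N)%:P + 'X) + c2%:P
    = (c0 * eta 1%N ^+ 2 + c1 * eta 1%N + c2)%:P
      + (c0 * eta 1%N + (c0 * eta 1%N + c1))%:P * 'X + c0%:P * 'X ^+ 2.
    by rewrite /= !(polyCD, polyCM) ?rmorphXn /=; ring.
  rewrite slope_root polyC0 add0r coefD !coefCM coefXn coefX /= slope_c1.
  by rewrite mulr0 mulr1 addr0; ring.
by rewrite mulf_neq0 // subr_eq0.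
Qed.

(** The question is moved down to [F], irreducible by hypothesis: away from [X = 0] the common zeros
    map injectively to those of [F] and [h], where [h(X, X Z) = X^N g], and on [X = 0] the curve [G]
    has only the two slopes. *)
Lemma strict_transform_finite g : subst_series zeta g <> 0 ->
  exists s : seq (L * L), forall x z, G.@[xy x z] = 0 -> g.@[xy x z] = 0 -> (x, z) \in s.
Proof.
move=> g0; have [N [h Eh]] := blowup_inv g.
have nFh : ~ divides F h.
  move/(subst_series_divides irrF etaF); rewrite -subst_slope Eh subst_seriesE.
  rewrite rmorphM rmorphXn /= mmapXU /xy /= => E; apply: g0.
  by apply: (@fpsXnI _ N); rewrite mulr0.
have [s sP] := finite_common_zeros irrF (branch_degY irrF etaF) nFh.
exists ([:: (0, eta 1%N); (0, a')] ++ [seq (p.1, p.2 / p.1) | p <- s]) => x z Gxz gxz.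
rewrite mem_cat; have [x0|x0] := eqVneq x 0.
  move: Gxz; rewrite x0 meval_G0 slope_factor => /eqP.
  by rewrite !mulf_eq0 (negPf c0_neq0) /= !subr_eq0 => /orP[] /eqP ->; rewrite !inE eqxx ?orbT.
have Ez : x * z / x = z by rewrite mulrC mulKf.
apply/orP; right; apply/mapP; exists (x, x * z); last by rewrite /= Ez.
have ev q : (blowup q).@[xy x z] = q.@[xy x (x * z)] by rewrite /meval mmap_blowup.
by apply: sP; rewrite -ev ?blowup_F ?Eh mevalM ?Gxz ?gxz mulr0.
Qed.

(** The polynomial form of the statement that [f] has order at least [m] along the branch: modulo
    [G], and up to a factor that is a unit at [(0, zeta(0))], it is divisible by [X^m]. It is
    obtained by dividing [m] times by the ideal of that point. *)
Lemma branch_divide m f : (forall i, (i < m)%N -> subst_series zeta f i = 0) ->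
  exists D g B, D * f = X ^+ m * g + B * G /\ D.@[xy 0 (zeta 0%N)] != 0.
Proof.
have Gp : G.@[xy 0 (zeta 0%N)] = 0 by rewrite -subst_series_coef0_xy slope_G.
elim: m => [|m IHm] low.
  by exists 1, f, 0; rewrite !mul1r mul0r addr0 meval1 oner_neq0.
have [|D [g [B [E D0]]]] := IHm; first by move=> i im; apply: low; rewrite ltnW.
have g0 : g.@[xy 0 (zeta 0%N)] = 0.
  have ES : subst_series zeta D * subst_series zeta f = fpsX ^+ m * subst_series zeta g.
    rewrite !subst_seriesE -rmorphM /= E mmapD !rmorphM rmorphXn /= mmapXU.
    by rewrite -[mmap _ _ G]subst_seriesE slope_G mulr0 addr0.
  have : (fpsX ^+ m * subst_series zeta g) m = 0.
    by rewrite -ES mulrC (@fps_low_mul _ m.+1).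
  by rewrite fps_coefXnM ltnn subnn subst_series_coef0_xy.
have [D' [g' [B' [E' D'0]]]] := branch_division Gp g0.
exists (D' * D), g', (X ^+ m * B' + D' * B); split; last first.
  by rewrite mevalM mulf_neq0 // D'0 strict_transform_unramified.
rewrite -mulrA E mulrDr mulrCA E' mpolyC0 subr0 exprSr; ring.
Qed.

Lemma branch_divide_coef m f D g B : (forall i, (i < m)%N -> subst_series zeta f i = 0) ->
  D * f = X ^+ m * g + B * G ->
  g.@[xy 0 (zeta 0%N)] = D.@[xy 0 (zeta 0%N)] * subst_series zeta f m.
Proof.
move=> low E.
have ES : subst_series zeta D * subst_series zeta f = fpsX ^+ m * subst_series zeta g.
  rewrite !subst_seriesE -rmorphM /= E mmapD !rmorphM rmorphXn /= mmapXU.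
  by rewrite -[mmap _ _ G]subst_seriesE slope_G mulr0 addr0.
have [f' Ef'] : exists f', subst_series zeta f = fpsX ^+ m * f' by apply/fps_lowP.
have EDf : subst_series zeta D * f' = subst_series zeta g.
  by apply: (@fpsXnI _ m); rewrite -ES Ef' mulrCA.
rewrite Ef' fps_coefXnM ltnn subnn -[g.@[_]](subst_series_coef0_xy zeta) -EDf.
by rewrite -(subst_series_coef0_xy zeta D) [LHS]big_ord1.
Qed.

Section Points.
Variables (K : closedFieldType) (iota : {rmorphism L -> K}) (V : residue_ring iota).
Notation R := (vring V).
Notation res := (@vres L K iota V).
Notation vv := (@vval L K iota V).
Notation cst := (@vconst L K iota V).

(** This replaces the expansion of [g(x, eta(x))] from its term of degree [m] on, which has no
    meaning at an infinitesimal [x]. *)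
Lemma branch_value m g x z : near_branch G zeta x z ->
    (forall i, (i < m)%N -> subst_series eta g i = 0) ->
  exists2 w, mmap cst (xy x (x * z)) g = x ^+ m * w & res w = subst_series eta g m.
Proof.
move=> nb; have [rx rz Gxz] := nb.
rewrite -subst_slope -mmap_blowup; set f := blowup g => low.
have [D [h [B [E D0]]]] := branch_divide low.
have [b [_ Db]] : exists b, vv b = (vv (mmap cst (xy x z) D))^-1 /\ mmap cst (xy x z) D * b = 1.
  by apply: vunit; rewrite (res_eval_cst _ rx rz).
have Eev : mmap cst (xy x z) D * mmap cst (xy x z) f = x ^+ m * mmap cst (xy x z) h.
  by rewrite -rmorphM /= E mmapD !rmorphM rmorphXn /= mmapXU Gxz mulr0 addr0.
exists (mmap cst (xy x z) h * b).
  by rewrite mulrA -Eev mulrAC Db mul1r.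
have := congr1 res Db; rewrite !rmorphM rmorph1 /= !(res_eval_cst _ rx rz) => Eb.
by rewrite (branch_divide_coef low E) mulrAC Eb mul1r.
Qed.

Lemma near_branch_exists x : res x = 0 -> exists z, near_branch G zeta x z.
Proof.
(* The reduction of [X - x] is [X], of order 1 along the branch, so [X - x] has a zero near it. *)
move=> rx; pose f : {mpoly R[2]} := 'X_ord0 - x%:MP.
have Ef : map_mpoly res f = X.
  by rewrite /f rmorphB /= map_mpolyX map_mpolyC /= rx mpolyC0 subr0.
have ES : subst_series zeta X = fpsX by rewrite subst_seriesE mmapXU.
have [||x' [z [nb]]] := near_branch_lift slope_G strict_transform_unramified strict_transform_finite (f := f).
- by rewrite Ef ES => /fpsP/(_ 1%N)/eqP; rewrite /= oner_eq0.
- by rewrite Ef ES.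
by rewrite mevalB mevalXU mevalC /xy /= => /subr0_eq <-; exists z.
Qed.

Lemma near_branch_onF x z : near_branch G zeta x z -> mmap cst (xy x (x * z)) F = 0.
Proof.
by move=> [_ _ Gxz]; rewrite -mmap_blowup blowup_F rmorphM /= Gxz mulr0.
Qed.

(** If [g] had finite order [m] along the branch, its value would be [x^m w] with [w] of nonzero
    residue. Thus a near point with [x <> 0] is a generic point of the curve over [L]. *)
Lemma near_branch_generic x z g : near_branch G zeta x z -> x <> 0 ->
  mmap cst (xy x (x * z)) g = 0 -> divides F g.
Proof.
move=> nb x0 g0; apply/(subst_series_divides irrF etaF); apply: contrapT => /fps_neq0_ord[m [gm low]].
have [w Ew rw] := branch_value nb low; move: Ew; rewrite g0 => /esym/vring_mulf0[xm|w0].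
  have : vv x ^+ m = 0 by rewrite -rmorphXn xm rmorph0.
  by move/eqP; rewrite expf_eq0 vval_eq0 => /andP[_ /eqP].
by move: gm; rewrite -rw w0 rmorph0 eqxx.
Qed.

End Points.
End NodeBranch.

(** * Projective points *)

Section ProjectivePoints.
Variables (K : fieldType) (n : nat).
Implicit Types (x y : pspace K n) (u v : 'I_n.+1 -> K).

Definition hcoords x u : Prop := has_coords x (\row_i u i).

Lemma hcoords_ext x u v : u =1 v -> hcoords x u -> hcoords x v.
Proof.
move=> uv; rewrite /hcoords /has_coords => ->; congr <[_]>%VS.
by apply/rowP => i; rewrite !mxE uv.
Qed.

Lemma has_coords_hcoords x (w : 'rV[K]_n.+1) : has_coords x w <-> hcoords x (w 0).
Proof.
rewrite /hcoords; have -> // : \row_i w 0 i = w.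
by apply/rowP => i; rewrite !mxE.
Qed.

Lemma hcoords_neq0 x u : hcoords x u -> exists i, u i != 0.
Proof.
move=> xu; apply: contrapT => nu; have /eqP := valP x.
rewrite xu (_ : \row_i u i = 0) ?dim_vline ?eqxx //.
apply/rowP => i; rewrite !mxE; apply/eqP/negPn/negP => ui.
by apply: nu; exists i.
Qed.

Lemma hcoords_coords x : hcoords x (coords x 0).
Proof.
apply/(has_coords_hcoords x (coords x))/eqP; rewrite /has_coords eq_sym eqEdim.
have x0 : val x != 0%VS by rewrite -dimv_eq0 (eqP (valP x)).
by rewrite -memvE /coords memv_pick (eqP (valP x)) dim_vline vpick0 x0.
Qed.

Lemma hcoords_eq x y u : hcoords x u -> hcoords y u -> x = y.
Proof. by move=> xu yu; apply: val_inj; rewrite xu yu. Qed.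

Lemma hcoords_exists u : (exists i, u i != 0) -> exists x, hcoords x u.
Proof.
move=> [i ui]; have u0 : \row_i u i != 0.
  by apply: contraNneq ui => /rowP/(_ i); rewrite !mxE => ->.
have d1 : \dim <[\row_i u i]> == 1%N by rewrite dim_vline u0.
by exists (exist (fun U : {vspace _} => \dim U == 1%N) _ d1).
Qed.

Lemma hcoords_scale x u k : k != 0 -> hcoords x u -> hcoords x (fun i => k * u i).
Proof.
move=> k0; rewrite /hcoords /has_coords => ->.
have -> : \row_i (k * u i) = k *: \row_i u i by apply/rowP => i; rewrite !mxE.
by apply/eqP; rewrite eqEsubv -!memvE memvZ ?memv_line // -{1}[\row_i u i](scalerK k0) memvZ ?memv_line.
Qed.

Lemma hcoords_uniq x u v : hcoords x u -> hcoords x v ->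
  exists2 k, k != 0 & forall i, v i = k * u i.
Proof.
move=> xu xv; have /vlineP[k Ek] : \row_i v i \in <[\row_i u i]>%VS.
  by rewrite -xu xv memv_line.
have Ev i : v i = k * u i by move/rowP/(_ i): Ek; rewrite !mxE.
exists k => //; have [i] := hcoords_neq0 xv; rewrite Ev.
by apply: contraNneq => ->; rewrite mul0r.
Qed.

(** Equality of projective points becomes a family of polynomial identities, which can be moved
    between [L], [O] and [K]. *)
Lemma hcoords_minors x u v : hcoords x u -> (exists i, v i != 0) ->
  (forall i j, u i * v j = u j * v i) -> hcoords x v.
Proof.
move=> xu [j vj] uv; have [i ui] := hcoords_neq0 xu.
have vi : v i != 0.
  apply: contraNneq vj => vi; have := uv i j; rewrite vi mulr0 => /eqP.
  by rewrite mulf_eq0 (negPf ui).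
apply: (hcoords_ext _ (hcoords_scale (_ : v i / u i != 0) xu)); last first.
  by rewrite mulf_neq0 ?invr_eq0.
by move=> k; apply: (mulfI ui); rewrite uv mulrA mulrCA divff // mulr1 mulrC.
Qed.

Lemma meval_hcoords0 d (f : {mpoly K[n.+1]}) x u v : f \is d.-homog ->
  hcoords x u -> hcoords x v -> f.@[u] = 0 -> f.@[v] = 0.
Proof.
move=> hf xu xv fu; have [k _ Ev] := hcoords_uniq xu xv.
by rewrite (meval_eq _ Ev) /meval (mmap_dhomog _ _ _ hf) -/(meval u f) fu mulr0.
Qed.

Lemma vanishes_hcoords d (f : {mpoly K[n.+1]}) x u : f \is d.-homog ->
  hcoords x u -> (vanishes f x <-> f.@[u] = 0).
Proof.
move=> hf xu; have xc := hcoords_coords x.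
split; [exact: (meval_hcoords0 hf xc xu) | exact: (meval_hcoords0 hf xu xc)].
Qed.

Lemma sends_hcoords k (phi : k.+1.-tuple {mpoly K[n.+1]}) x (y : pspace K k) u :
  same_degree phi -> hcoords x u ->
  (sends phi x y <-> has_coords y (\row_i (tnth phi i).@[u])).
Proof.
move=> [d hd] xu; have xc := hcoords_coords x.
have sc a b : hcoords x a -> hcoords x b ->
    exists2 c, c != 0 & forall i, (tnth phi i).@[b] = c * (tnth phi i).@[a].
  move=> xa xb; have [l l0 El] := hcoords_uniq xa xb; exists (l ^+ d).
    by rewrite expf_neq0.
  by move=> i; rewrite (meval_eq _ El) /meval (mmap_dhomog _ _ _ (hd i)).
have tr (a b : 'I_k.+1 -> K) : (exists2 c, c != 0 & forall i, b i = c * a i) ->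
    has_coords y (\row_i a i) -> has_coords y (\row_i b i).
  move=> [c c0 Eb] ya; rewrite /has_coords ya.
  have -> : \row_i b i = c *: \row_i a i by apply/rowP => i; rewrite !mxE.
  by apply/eqP; rewrite eqEsubv -!memvE memvZ ?memv_line // -{1}[\row_i a i](scalerK c0) memvZ ?memv_line.
split; [exact: tr (sc _ _ xc xu) | exact: tr (sc _ _ xu xc)].
Qed.

End ProjectivePoints.

(** Homogeneous coordinates of the affine point [a] scaled so that the last one is [c]; the
    homogenisation of a polynomial of degree [d] then takes the value [c^d p(a)], without
    denominators. *)
Definition hpoint (S : comNzRingType) n (a : 'I_n -> S) (c : S) (i : 'I_n.+1) : S :=
  if unlift ord_max i is Some j then c * a j else c.

Section Homogenise.
Variables (n : nat) (R : comNzRingType).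
Implicit Types (p : {mpoly R[n]}).

Definition homog_exp p (m : 'X_{1..n}) : 'X_{1..n.+1} :=
  [multinom if unlift ord_max i is Some j then m j
            else ((msize p).-1 - mdeg m)%N | i < n.+1].

Lemma homogeniseE p : homogenise p = \sum_(m <- msupp p) p@_m *: 'X_[homog_exp p m].
Proof. by []. Qed.

Lemma msupp_deg p m : m \in msupp p -> (mdeg m <= (msize p).-1)%N.
Proof. by move=> /msize_mdeg_lt; case: (msize p). Qed.

Lemma homogenise_homog p : homogenise p \is (msize p).-1.-homog.
Proof.
rewrite homogeniseE big_seq; apply: rpred_sum => m /msupp_deg mp.
apply: rpredZ; rewrite dhomogX; apply/eqP; rewrite -[LHS]/(mdeg _) mdegE big_ord_recr /=.
rewrite mnmE unlift_none /= (eq_bigr (fun i => m i)); last first.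
  move=> i _; rewrite mnmE (_ : widen_ord _ i = lift ord_max i) ?liftK //.
  by apply: val_inj; rewrite /= /bump leqNgt ltn_ord.
by rewrite -mdegE addnC subnK.
Qed.

Lemma mmap_homogenise (S : comNzRingType) (f : {rmorphism R -> S}) (a : 'I_n -> S) c p :
  mmap f (hpoint a c) (homogenise p) = c ^+ (msize p).-1 * mmap f a p.
Proof.
rewrite homogeniseE raddf_sum [in RHS]/mmap mulr_sumr; apply: eq_big_seq => m /msupp_deg mp.
rewrite /= mmapZ mmapX mulrCA; congr (_ * _).
rewrite /mmap1 big_ord_recr /= mnmE unlift_none /= {2}/hpoint unlift_none.
rewrite (eq_bigr (fun i => c ^+ m i * a i ^+ m i)); last first.
  move=> i _; have -> : widen_ord (leqnSn n) i = lift ord_max i.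
    by apply: val_inj; rewrite /= /bump leqNgt ltn_ord.
  by rewrite /hpoint mnmE liftK exprMn.
rewrite big_split /= -expr_sum -mdegE mulrAC -exprD subnKC //.
Qed.

End Homogenise.

Lemma hcoords_cross (K : fieldType) n (x : pspace K n) (u v : 'I_n.+1 -> K) i k :
  hcoords x u -> hcoords x v -> u i * v k = u k * v i.
Proof. by move=> xu xv; have [c _ Ev] := hcoords_uniq xu xv; rewrite !Ev; ring. Qed.

Lemma fun_eq0_or (K : fieldType) n (u : 'I_n -> K) :
  (exists i, u i != 0) \/ (forall i, u i = 0).
Proof.
have [|H] := EM (exists i, u i != 0); first by left.
by right=> i; apply/eqP/negPn/negP => ui; apply: H; exists i.
Qed.

Lemma dehomogenise_msize n (R : comNzRingType) D (p : {mpoly R[n.+1]}) :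
  p \is D.-homog ->
  (msize (mmap (@mpolyC n R) (hpoint (fun i => 'X_i) 1) p) <= D.+1)%N.
Proof.
move=> /dhomogP hp; rewrite /mmap big_seq.
apply: (big_ind (fun q : {mpoly R[n]} => msize q <= D.+1)%N).
- by rewrite msize0.
- by move=> a b ha hb; rewrite (leq_trans (msizeD_le _ _)) // geq_max ha.
- move=> m mp; have Em : mdeg m = D := hp m mp.
  rewrite mul_mpolyC (leq_trans (msizeZ_le _ _)) //.
  have -> : mmap1 (hpoint (fun i => 'X_i) 1) m
     = 'X_[[multinom m (lift ord_max i) | i < n]] :> {mpoly R[n]}.
    rewrite /mmap1 big_ord_recr /= /hpoint unlift_none expr1n mulr1 mpolyXE_id.
    apply: eq_bigr => i _; have -> : widen_ord (leqnSn n) i = lift ord_max i.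
      by apply: val_inj; rewrite /= /bump leqNgt ltn_ord.
    by rewrite liftK mul1r mnmE.
  rewrite msizeX ltnS -Em !mdegE big_ord_recr /=.
  rewrite (leq_trans _ (leq_addr _ _)) //; apply: leq_sum => i _; rewrite mnmE.
  have -> // : widen_ord (leqnSn n) i = lift ord_max i.
  by apply: val_inj; rewrite /= /bump leqNgt ltn_ord.
Qed.

Definition dehom (L : fieldType) (p : {mpoly L[3]}) : {mpoly L[2]} :=
  mmap (@mpolyC 2 L) (hpoint (xy 'X_ord0 'X_ord_max) 1) p.

Lemma comp_hpoint (S T : comNzRingType) (g : {rmorphism S -> T}) n (a : 'I_n -> S) c :
  g \o hpoint a c =1 hpoint (g \o a) (g c).
Proof. by move=> i; rewrite /hpoint /=; case: unlift => [j|] //; rewrite rmorphM. Qed.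

Lemma hpoint_ext (S : comNzRingType) n (a b : 'I_n -> S) c : a =1 b -> hpoint a c =1 hpoint b c.
Proof. by move=> ab i; rewrite /hpoint; case: unlift => // j; rewrite ab. Qed.

Lemma mmap_dehom (L : fieldType) (S : comNzRingType) (f : {rmorphism L -> S}) a b p :
  mmap f (xy a b) (dehom p) = mmap f (hpoint (xy a b) 1) p.
Proof.
rewrite /dehom rmorph_mmap; apply: eq_mmap => [c|i]; first by rewrite /= mmapC.
rewrite comp_hpoint rmorph1; apply: hpoint_ext => j.
by rewrite comp_xy /= !mmapXU.
Qed.

Lemma xy_X (R : comNzRingType) :
  xy 'X_ord0 'X_ord_max =1 (fun i : 'I_2 => 'X_i : {mpoly R[2]}).
Proof.
move=> i; rewrite /xy; case: (unliftP ord0 i) => [j|] -> //=.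
by congr 'X_(_); apply: val_inj; rewrite /= ord1.
Qed.

Lemma dehom_msize (L : fieldType) D (p : {mpoly L[3]}) :
  p \is D.-homog -> (msize (dehom p) <= D.+1)%N.
Proof.
have -> : dehom p = mmap (@mpolyC 2 L) (hpoint (fun i => 'X_i) 1) p.
  apply: eq_mmap => [c|i]; first by [].
  by apply: hpoint_ext => j; apply: xy_X.
exact: dehomogenise_msize.
Qed.

Lemma hpoint_homog (R S : comNzRingType) n (f : {rmorphism R -> S}) (a : 'I_n -> S) c D p :
  p \is D.-homog -> mmap f (hpoint (fun i => a i) c) p = c ^+ D * mmap f (hpoint a 1) p.
Proof.
move=> hp; rewrite -(mmap_dhomog _ _ _ hp); apply: eq_mmap => // i.
by rewrite /hpoint; case: unlift => [j|]; rewrite ?mul1r ?mulr1.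
Qed.

(** A form which on the affine part is a multiple of [F] vanishes also at the
    points at infinity of [F]: compare degrees along [(w0 : w1 : s)], [s -> 0]. *)
Lemma dehom_divides_vanishes (L : closedFieldType) (F : {mpoly L[2]}) D
    (p : {mpoly L[3]}) (w : 'I_3 -> L) :
  F != 0 -> p \is D.-homog -> divides F (dehom p) ->
  (homogenise F).@[w] = 0 -> p.@[w] = 0.
Proof.
move=> F0 hp [q Eq] Fw; pose c := w ord_max.
pose a := w ord0; pose b := w (lift ord_max ord_max).
have Ew : w =1 (fun i => if unlift ord_max i is Some j then xy a b j else c).
  move=> i; case: (unliftP ord_max i) => [j|] -> //.
  rewrite /xy /a /b; case: eqP => [->|]; first by congr w; apply: val_inj.
  case: (unliftP ord0 j) => [k|] -> // _; congr w; apply: val_inj.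
  by rewrite /= ord1.
pose W (s : L) := fun i => if unlift ord_max i is Some j then xy a b j else s.
have EW s : s != 0 -> W s =1 hpoint (xy (a / s) (b / s)) s.
  move=> s0 i; rewrite /W /hpoint; case: unlift => // j.
  by rewrite /xy; case: (j == ord0); rewrite mulrC divfK.
have evp s : s != 0 -> p.@[W s] = s ^+ D * (dehom p).@[xy (a / s) (b / s)].
  move=> s0; rewrite (meval_eq _ (EW s s0)) /meval mmap_dehom.
  by rewrite (hpoint_homog _ _ _ hp).
have evh (r : {mpoly L[2]}) s : s != 0 ->
    (homogenise r).@[W s] = s ^+ (msize r).-1 * r.@[xy (a / s) (b / s)].
  by move=> s0; rewrite (meval_eq _ (EW s s0)) /meval mmap_homogenise.
have [q0|q0] := eqVneq q 0.
  have P0 s : s != 0 -> p.@[W s] = 0.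
    by move=> s0; rewrite evp // Eq q0 mul0r meval0 mulr0.
  rewrite (meval_eq _ Ew) -/(W c).
  pose P : {poly L} := mmap polyC (fun i => if unlift ord_max i is Some j then (xy a b j)%:P else 'X) p.
  have evP s : P.[s] = p.@[W s].
    rewrite -[LHS]/(horner_eval s P) rmorph_mmap; apply: eq_mmap => [k|i] /=.
      by rewrite /horner_eval hornerC.
    by rewrite /W /horner_eval; case: unlift => [j|]; rewrite ?hornerC ?hornerX.
  rewrite -evP (@poly_infinite_zeros _ P [:: 0]) ?horner0 // => s.
  by rewrite inE evP => /P0.
have dle : ((msize q).-1 + (msize F).-1 <= D)%N.
  have := dehom_msize hp; rewrite Eq msizeM //.
  by have := mpolySpred mdeg q0; have := mpolySpred mdeg F0; move=> -> ->; rewrite addnS /= addSn ltnS.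
pose k := (D - ((msize q).-1 + (msize F).-1))%N.
have E s : s != 0 -> p.@[W s] = s ^+ k * ((homogenise q).@[W s] * (homogenise F).@[W s]).
  move=> s0; rewrite (evp s s0) Eq mevalM !(evh _ s s0).
  have -> : D = (k + ((msize q).-1 + (msize F).-1))%N by rewrite subnK.
  rewrite 2!exprD; move: (s ^+ k) (s ^+ _) (s ^+ _) (meval _ _) (meval _ _) => e1 e2 e3 e4 e5.
  by rewrite -!mulrA; congr (_ * (_ * _)); rewrite mulrCA.
pose lin : 'I_3 -> {poly L} :=
  fun i => if unlift ord_max i is Some j then (xy a b j)%:P else 'X.
pose P (r : {mpoly L[3]}) : {poly L} := mmap polyC lin r.
have evP r s : (P r).[s] = r.@[W s].
  rewrite -[LHS]/(horner_eval s (P r)) rmorph_mmap; apply: eq_mmap => [l|i] /=.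
    by rewrite /horner_eval hornerC.
  by rewrite /W /lin /horner_eval; case: unlift => [j|]; rewrite ?hornerC ?hornerX.
have EP : P p - 'X^k * (P (homogenise q) * P (homogenise F)) = 0.
  apply: (@poly_infinite_zeros _ _ [:: 0]) => s; rewrite inE => s0.
  by rewrite hornerD hornerN !hornerM hornerXn !evP (E s s0) subrr.
have := congr1 (horner^~ c) EP; rewrite /= hornerD hornerN !hornerM hornerXn horner0 !evP.
by rewrite -(meval_eq (homogenise F) Ew) Fw !mulr0 subr0 (meval_eq _ Ew).
Qed.

(** * The nonsingular model *)

Section Model.
Variables (L : closedFieldType) (F : {mpoly L[2]}) (eta : {fps L}).
Variable M : nonsingular_model F.
Hypothesis irrF : irreducible_elt F.
Hypothesis etaF : subst_series eta F = 0.

Notation N := (ns_dim M).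
Notation X := ('X_ord0 : {mpoly L[2]}).
Notation Y := ('X_ord_max : {mpoly L[2]}).

Lemma divides_prime p q : divides F (p * q) -> divides F p \/ divides F q.
Proof.
have dP := subst_series_divides irrF etaF.
move/dP; rewrite subst_seriesE rmorphM /= -!subst_seriesE => pq0.
have [p0|p0] := EM (subst_series eta p = 0); first by left; apply/dP.
by right; apply/dP; apply: fps_mulf_eq0 pq0 p0.
Qed.

Lemma vanishing_divides_curve g :
  (forall x y, F.@[xy x y] = 0 -> g.@[xy x y] = 0) -> divides F g.
Proof. exact: vanishing_divides irrF (branch_degY irrF etaF) g. Qed.

Definition on_model (S : comNzRingType) (f : {rmorphism L -> S}) (u : 'I_N.+1 -> S) :=
  forall g, g \in ns_eqs M -> mmap f u g = 0.

Definition vanish_on (f : {mpoly L[N.+1]}) := forall x, zeros (ns_eqs M) x -> vanishes f x.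

(** The form is a combination of the equations, because these generate the vanishing ideal; this
    extends a fact about [L]-points to points over any [L]-algebra. *)
Lemma vanish_on_transfer d f (S : comNzRingType) (h : {rmorphism L -> S}) u :
  f \is d.-homog -> vanish_on f -> on_model h u -> mmap h u f = 0.
Proof.
move=> hf vf hu; have [c ->] := ns_ideal hf vf.
rewrite raddf_sum big1 // => i _ /=.
by rewrite rmorphM /= (hu _ (mem_nth 0 (ltn_ord i))) mulr0.
Qed.

Lemma zeros_hcoords x u : hcoords x u ->
  (zeros (ns_eqs M) x <-> forall g, g \in ns_eqs M -> g.@[u] = 0).
Proof.
move=> xu; split=> H g gM; have [d hg] := ns_homog gM.
  by apply/(vanishes_hcoords hg xu)/H.
by apply/(vanishes_hcoords hg xu)/H.
Qed.

Lemma vanish_onP f d : f \is d.-homog -> (forall x u, hcoords x u ->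
  zeros (ns_eqs M) x -> f.@[u] = 0) -> vanish_on f.
Proof.
move=> hf H x Mx; apply/(vanishes_hcoords hf (hcoords_coords x)).
exact: H (hcoords_coords x) Mx.
Qed.

Lemma ns_map_sends phi x u y : phi \in ns_map M -> hcoords x u ->
  hcoords y (fun i => (tnth phi i).@[u]) -> mor_sends (ns_map M) x y.
Proof.
move=> phiM xu yphi; exists phi => //.
exact/(sends_hcoords _ (ns_map_homog phiM) xu).
Qed.

Definition comp3 k (phi : 3.-tuple {mpoly L[k]}) (q : {mpoly L[3]}) : {mpoly L[k]} :=
  mmap (@mpolyC k L) (tnth phi) q.

Lemma mmap_comp3 k (phi : 3.-tuple {mpoly L[k]}) q (S : comNzRingType) (h : {rmorphism L -> S}) u :
  mmap h u (comp3 phi q) = mmap h (fun i => mmap h u (tnth phi i)) q.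
Proof. by rewrite /comp3 rmorph_mmap; apply: eq_mmap => // c; rewrite /= mmapC. Qed.

Lemma comp3_homog k (phi : 3.-tuple {mpoly L[k]}) q d :
  same_degree phi -> q \is d.-homog -> exists e, comp3 phi q \is e.-homog.
Proof. by move=> [e he] hq; exists (d * e)%N; apply: dhomog_mmap. Qed.

(** A representative [phi] says nothing where all its components vanish; the factor [tnth phi l]
    makes the identity hold at those points too. *)
Lemma model_curve phi l : phi \in ns_map M ->
  vanish_on (tnth phi l * comp3 phi (homogenise F)).
Proof.
move=> phiM; have [d hd] := ns_map_homog phiM.
have [e he] := comp3_homog (ns_map_homog phiM) (homogenise_homog F).
apply: vanish_onP (dhomogM (hd l) he) _ => x u xu Mx.
rewrite mevalM [X in _ * X]mmap_comp3 -/(meval u _).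
have [/hcoords_exists[y yphi]|->] := fun_eq0_or (fun i => (tnth phi i).@[u]).
  have /(vanishes_hcoords (homogenise_homog F) yphi) := ns_map_curve Mx (ns_map_sends phiM xu yphi).
  by move=> E; rewrite [X in _ * X]E mulr0.
by rewrite mul0r.
Qed.

Lemma model_agree phi phi' i k : phi \in ns_map M -> phi' \in ns_map M ->
  vanish_on (tnth phi i * tnth phi' k - tnth phi k * tnth phi' i).
Proof.
move=> phiM phiM'; have [d hd] := ns_map_homog phiM.
have [d' hd'] := ns_map_homog phiM'.
apply: (@vanish_onP _ (d + d')).
  by apply: rpredB; apply: dhomogM.
move=> x u xu Mx; rewrite mevalB !mevalM.
have [/hcoords_exists[y yphi]|E] := fun_eq0_or (fun i => (tnth phi i).@[u]); last first.
  by rewrite !E !mul0r subrr.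
have [/hcoords_exists[y' yphi']|E] := fun_eq0_or (fun i => (tnth phi' i).@[u]); last first.
  by rewrite !E !mulr0 subrr.
have Ey := ns_map_agree Mx (ns_map_sends phiM xu yphi) (ns_map_sends phiM' xu yphi').
rewrite -Ey in yphi'; apply/eqP; rewrite subr_eq0; apply/eqP.
exact: (hcoords_cross _ _ yphi yphi').
Qed.

(** * Identities between the morphism and its rational inverse *)

Section Inverse.
Variable psi : N.+1.-tuple {mpoly L[3]}.
Hypothesis psi_degree : same_degree psi.
Hypothesis psi_defined : exists y x, vanishes (homogenise F) y /\ sends psi y x.
Hypothesis psi_model : forall y x, vanishes (homogenise F) y -> sends psi y x ->
  zeros (ns_eqs M) x /\ mor_sends (ns_map M) x y.
Hypothesis psi_inverse : forall x y x', zeros (ns_eqs M) x ->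
  mor_sends (ns_map M) x y -> sends psi y x' -> x' = x.

Definition psia i : {mpoly L[2]} := dehom (tnth psi i).

(** The point where [psi] is defined may lie at infinity, hence the use of [dehom_divides_vanishes]
    instead of an evaluation on the affine part. *)
Lemma psia_exists : exists i, ~ divides F (psia i).
Proof.
apply: contrapT => H; have [y [x [Fy /= yx]]] := psi_defined.
have yw := hcoords_coords y; have [D hD] := psi_degree.
have /(sends_hcoords _ psi_degree yw)/(hcoords_neq0 (u := fun i => _)) [i] := yx.
have F0 : F != 0 by have [] := irrF.
have dv : divides F (psia i) by apply: contrapT => nd; apply: H; exists i.
by rewrite (dehom_divides_vanishes F0 (hD i) dv) ?eqxx.
Qed.

Lemma hpoint_neq0 (a b : L) : exists i, hpoint (xy a b) 1 i != 0.
Proof. by exists ord_max; rewrite /hpoint unlift_none oner_eq0. Qed.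

Lemma affine_point (x y : L) : F.@[xy x y] = 0 ->
  exists2 a : pspace L 2, hcoords a (hpoint (xy x y) 1) & vanishes (homogenise F) a.
Proof.
move=> Fxy; have [a ha] := hcoords_exists (hpoint_neq0 x y); exists a => //.
apply/(vanishes_hcoords (homogenise_homog F) ha).
by rewrite /meval mmap_homogenise expr1n mul1r.
Qed.

Lemma psia_model x y a l : F.@[xy x y] = 0 -> hcoords a (hpoint (xy x y) 1) ->
  vanishes (homogenise F) a -> (psia l).@[xy x y] != 0 ->
  exists q, [/\ hcoords q (fun i => (psia i).@[xy x y]),
     zeros (ns_eqs M) q & mor_sends (ns_map M) q a].
Proof.
move=> Fxy ha Fa pl.
have Ep i : (psia i).@[xy x y] = (tnth psi i).@[hpoint (xy x y) 1].
  by rewrite /meval mmap_dehom.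
have [q hq] := hcoords_exists (ex_intro (fun i => (psia i).@[xy x y] != 0) l pl).
exists q; have [] // := psi_model Fa (x := q).
apply/(sends_hcoords _ psi_degree ha); apply: hcoords_ext hq => i; exact: Ep.
Qed.

Lemma psia_ne l : ~ divides F (psia l) -> forall g, divides F (psia l * g) -> divides F g.
Proof. by move=> nl g /divides_prime[]. Qed.

(** At an [L]-point of the curve where some [psia l] is nonzero, [psi] has a value on the model;
    elsewhere the product with [psia l] is zero. So [F] divides the product, and [psia l] cancels
    for an [l] with [F] not dividing it. [psia_phi] follows the same pattern. *)
Lemma psia_eqs g : g \in ns_eqs M -> divides F (mmap (@mpolyC 2 L) psia g).
Proof.
move=> gM; have [l nl] := psia_exists; apply: (psia_ne nl).
apply: vanishing_divides_curve => x y Fxy; rewrite mevalM.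
have [->|pl] := eqVneq (psia l).@[xy x y] 0; first by rewrite mul0r.
have [a ha Fa] := affine_point Fxy.
have [q [hq Mq _]] := psia_model Fxy ha Fa pl.
have /(zeros_hcoords hq)/(_ _ gM) E := Mq.
suff -> : (mmap (@mpolyC 2 L) psia g).@[xy x y] = 0 by rewrite mulr0.
by rewrite -E /meval rmorph_mmap; apply: eq_mmap => // c; rewrite /= mmapC.
Qed.

Lemma psia_phi phi i k : phi \in ns_map M ->
  divides F (mmap (@mpolyC 2 L) psia (tnth phi i) * hpoint (xy X Y) 1 k
           - mmap (@mpolyC 2 L) psia (tnth phi k) * hpoint (xy X Y) 1 i).
Proof.
move=> phiM; have [l nl] := psia_exists; apply: (psia_ne nl).
apply: vanishing_divides_curve => x y Fxy; rewrite mevalM.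
have [->|pl] := eqVneq (psia l).@[xy x y] 0; first by rewrite mul0r.
have [a ha Fa] := affine_point Fxy.
have [q [hq Mq qa]] := psia_model Fxy ha Fa pl.
have Ephi j : (mmap (@mpolyC 2 L) psia (tnth phi j)).@[xy x y]
    = (tnth phi j).@[fun i => (psia i).@[xy x y]].
  by rewrite /meval rmorph_mmap; apply: eq_mmap => // c; rewrite /= mmapC.
have EX j : (hpoint (xy X Y) 1 j).@[xy x y] = hpoint (xy x y) 1 j.
  rewrite -[LHS]/((meval (xy x y) \o hpoint (xy X Y) 1) j) comp_hpoint rmorph1.
  by apply: hpoint_ext => m; rewrite comp_xy /= !mevalXU.
rewrite mevalB !mevalM !Ephi !EX.
have [/hcoords_exists[y' hy']|E] :=
  fun_eq0_or (fun j => (tnth phi j).@[fun i => (psia i).@[xy x y]]).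
  have Ey := ns_map_agree Mq (ns_map_sends phiM hq hy') qa.
  rewrite Ey in hy'.
  by rewrite (hcoords_cross i k hy' ha) subrr mulr0.
by rewrite !E !mul0r subrr mulr0.
Qed.

Lemma model_inverse phi l i k : phi \in ns_map M ->
  vanish_on (tnth phi l * (comp3 phi (tnth psi i) * 'X_k - comp3 phi (tnth psi k) * 'X_i)).
Proof.
move=> phiM; have [d hd] := ns_map_homog phiM; have [D hD] := psi_degree.
have hc j : comp3 phi (tnth psi j) \is (D * d)%N.-homog by apply: dhomog_mmap.
apply: (@vanish_onP _ (d + (D * d + 1))).
  by apply: dhomogM => //; apply: rpredB; apply: dhomogM => //; apply: dhomogXU.
move=> x u xu Mx; rewrite mevalM mevalB !mevalM !mevalXU.
have Ec j : (comp3 phi (tnth psi j)).@[u] = (tnth psi j).@[fun m => (tnth phi m).@[u]].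
  exact: mmap_comp3.
rewrite !Ec.
have [/hcoords_exists[y hy]|E] := fun_eq0_or (fun m => (tnth phi m).@[u]); last first.
  by rewrite E mul0r.
have [/hcoords_exists[x' hx']|E] :=
  fun_eq0_or (fun j => (tnth psi j).@[fun m => (tnth phi m).@[u]]); last first.
  by rewrite !E !mul0r subrr mulr0.
have Ex : x' = x.
  apply: (psi_inverse Mx (ns_map_sends phiM xu hy)).
  exact/(sends_hcoords _ psi_degree hy).
rewrite Ex in hx'.
by rewrite (hcoords_cross i k hx' xu) subrr mulr0.
Qed.

End Inverse.
End Model.

Lemma origin_hcoords (K : fieldType) n :
  hcoords (origin K n) (fun i => (i == ord_max)%:R).
Proof.
rewrite /hcoords /has_coords /=; congr <[_]>%VS.
by apply/rowP => i; rewrite !mxE eqxx.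
Qed.

(** * Points of the model over [K] and over the valuation ring *)

Section KPoints.
Variables (L K : closedFieldType) (iota : {rmorphism L -> K}).
Variables (F : {mpoly L[2]}) (M : nonsingular_model F).
Notation N := (ns_dim M).

Lemma map_mpoly_homog n d (p : {mpoly L[n]}) :
  p \is d.-homog -> map_mpoly iota p \is d.-homog.
Proof.
move=> /dhomogP hp; apply/dhomogP => m; rewrite mcoeff_msupp mcoeff_map_mpoly => pm.
by apply: hp; rewrite mcoeff_msupp; move: pm; rewrite fmorph_eq0.
Qed.

Lemma ns_pointP (x : pspace K N) u : hcoords x u ->
  (ns_point iota x <-> on_model (M := M) iota u).
Proof.
move=> xu; split=> H g.
  move=> gM; have [d hg] := ns_homog gM.
  have /(vanishes_hcoords (map_mpoly_homog hg) xu) := H _ (map_f _ gM).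
  by rewrite meval_map_mpoly.
move=> /mapP[g' gM ->]; have [d hg] := ns_homog gM.
apply/(vanishes_hcoords (map_mpoly_homog hg) xu).
by rewrite meval_map_mpoly; apply: H.
Qed.

Lemma ns_sendsP (x : pspace K N) y u : hcoords x u ->
  (ns_sends iota x y <-> exists2 phi, phi \in ns_map M &
      hcoords y (fun i => mmap iota u (tnth phi i))).
Proof.
move=> xu; have sd phi : phi \in ns_map M -> same_degree (map_tuple (map_mpoly iota) phi).
  move=> phiM; have [d hd] := ns_map_homog phiM; exists d => i.
  by rewrite tnth_map map_mpoly_homog.
have E phi : \row_i (tnth (map_tuple (map_mpoly iota) phi) i).@[u]
           = \row_i mmap iota u (tnth phi i).
  by apply/rowP => i; rewrite !mxE tnth_map meval_map_mpoly.
split=> [[phi' /mapP[phi phiM ->]]|[phi phiM yphi]].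
  by move=> /(sends_hcoords _ (sd _ phiM) xu); rewrite E; exists phi.
exists (map_tuple (map_mpoly iota) phi); first exact: map_f.
by apply/(sends_hcoords _ (sd _ phiM) xu); rewrite E.
Qed.

Variable V : residue_ring iota.
Notation R := (vring V).
Notation res := (@vres L K iota V).
Notation vv := (@vval L K iota V).
Notation cst := (@vconst L K iota V).

Lemma vv_mmap n (t : 'I_n -> R) p : vv (mmap cst t p) = mmap iota (vv \o t) p.
Proof. by rewrite rmorph_mmap; apply: eq_mmap. Qed.

Lemma res_mmap n (t : 'I_n -> R) p : res (mmap cst t p) = p.@[res \o t].
Proof. by rewrite rmorph_mmap; apply: eq_mmap => // a; apply: vres_const. Qed.

(** The coordinates [r] of [p] can be prescribed, since those of [x] may be rescaled by the same
    constant of [L]. *)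
Lemma specialisesP n (x : pspace K n) (p : pspace L n) (r : 'I_n.+1 -> L) :
  hcoords p r ->
  (specialises iota (rr_pred V) x p <->
   exists2 t : 'I_n.+1 -> R, hcoords x (vv \o t) & forall i, res (t i) = r i).
Proof.
move=> pr; split=> [[u [w [xu pw uw]]]|[t xt tr]].
  have /choice[t tP] i : exists a, vv a = u 0 i /\ res a = w 0 i.
    by have /specialisesE[a] := uw i; exists a.
  have [k k0 Ek] := hcoords_uniq (proj1 (has_coords_hcoords _ _) pw) pr.
  exists (fun i => cst k * t i).
    apply: (hcoords_ext (u := fun i => iota k * u 0 i)).
      by move=> i; rewrite /= rmorphM /=; have [-> _] := tP i.
    by apply: hcoords_scale (proj1 (has_coords_hcoords x u) xu); rewrite fmorph_eq0.
  by move=> i; rewrite rmorphM /= vres_const Ek; have [_ ->] := tP i.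
exists (\row_i vv (t i)), (\row_i r i); split=> // i.
by rewrite !mxE; apply/specialisesE; exists (t i).
Qed.

Lemma on_model_vv (t : 'I_N.+1 -> R) : on_model (M := M) cst t <-> on_model (M := M) iota (vv \o t).
Proof.
split=> H g gM; first by rewrite -vv_mmap H // rmorph0.
by apply: (@vval_inj _ _ _ V); rewrite vv_mmap H // rmorph0.
Qed.

Lemma on_model_zeros (t : 'I_N.+1 -> R) p : on_model (M := M) cst t ->
  hcoords p (res \o t) -> zeros (ns_eqs M) p.
Proof.
by move=> Ht hp; apply/(zeros_hcoords hp) => g gM; rewrite -res_mmap Ht // rmorph0.
Qed.

Lemma vring_expI (x a b : R) m : x <> 0 -> x ^+ m * a = x ^+ m * b -> a = b.
Proof.
move=> x0 E; apply: (@vval_inj _ _ _ V); apply: (mulfI (x := vv x ^+ m)).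
  by rewrite expf_neq0 // vval_eq0; apply/eqP.
by rewrite -rmorphXn -!rmorphM E.
Qed.

End KPoints.

(** * The points above the origin *)

Section BranchCenter.
Variables (L K : closedFieldType) (iota : {rmorphism L -> K}) (V : residue_ring iota).
Notation R := (vring V).
Notation res := (@vres L K iota V).
Notation vv := (@vval L K iota V).
Notation cst := (@vconst L K iota V).
Variables (F : {mpoly L[2]}) (M : nonsingular_model F).
Notation N := (ns_dim M).
Notation X := ('X_ord0 : {mpoly L[2]}).
Notation Y := ('X_ord_max : {mpoly L[2]}).
Variable psi : N.+1.-tuple {mpoly L[3]}.
Hypothesis psi_degree : same_degree psi.
Hypothesis psi_defined : exists y x, vanishes (homogenise F) y /\ sends psi y x.
Hypothesis psi_model : forall y x, vanishes (homogenise F) y -> sends psi y x ->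
  zeros (ns_eqs M) x /\ mor_sends (ns_map M) x y.
Hypothesis psi_inverse : forall x y x', zeros (ns_eqs M) x ->
  mor_sends (ns_map M) x y -> sends psi y x' -> x' = x.

Variables (u0 u1 u2 : {mpoly L[2]}) (eta : {fps L}) (a' : L).
Hypothesis irrF : irreducible_elt F.
Hypothesis EF : F = Y ^+ 2 * u0 + X * Y * u1 + X ^+ 2 * u2.
Hypothesis eta0 : eta 0%N = 0.
Hypothesis etaF : subst_series eta F = 0.
Hypothesis c0_neq0 : u0.@[fun=> 0] != 0.
Hypothesis a'_root : u0.@[fun=> 0] * a' ^+ 2 + u1.@[fun=> 0] * a' + u2.@[fun=> 0] = 0.
Hypothesis a'_neq : eta 1%N != a'.

Notation near := (near_branch (V := V) (strict_transform u0 u1 u2) (slope_series eta)).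
Notation pa := (psia psi).

Definition center_at m p : Prop :=
  hcoords p (fun i => subst_series eta (pa i) m) /\
  forall i k, (k < m)%N -> subst_series eta (pa i) k = 0.

Lemma center_exists : exists m p, center_at m p.
Proof.
have [l nl] := psia_exists irrF psi_degree psi_defined.
have /fps_neq0_ord[k [pk _]] : subst_series eta (pa l) <> 0.
  by move=> E; apply: nl; apply/(subst_series_divides irrF etaF).
pose P (m : nat) := [exists i, subst_series eta (pa i) m != 0].
have exP : exists m, P m by exists k; apply/existsP; exists l.
case: (ex_minnP exP) => m /existsP[i pim] mmin.
have [p hp] := hcoords_exists (ex_intro (fun i => subst_series eta (pa i) m != 0) i pim).
exists m, p; split=> // j n nm; apply/eqP/negPn/negP => pj.
have /mmin : P n by apply/existsP; exists j.
by rewrite leqNgt nm.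
Qed.

Variables (m : nat) (p : pspace L N).
Hypothesis cp : center_at m p.

(** Dividing the values of [psi] by [x^m] leaves coordinates in [O] whose residues are coordinates
    of [p], so the image of the near point visibly specialises to [p]. *)
Lemma center_lift x z : near x z -> exists t : 'I_N.+1 -> R,
  (forall i, mmap cst (xy x (x * z)) (pa i) = x ^+ m * t i) /\
  (forall i, res (t i) = subst_series eta (pa i) m).
Proof.
move=> nb; have [_ low] := cp.
have /choice[t tP] i : exists w, mmap cst (xy x (x * z)) (pa i) = x ^+ m * w /\
    res w = subst_series eta (pa i) m.
  by have [w Ew rw] := branch_value EF eta0 etaF c0_neq0 a'_root a'_neq nb (low i); exists w.
by exists t; split=> i; case: (tP i).
Qed.

Section Lift.
Variables (x z : R) (t : 'I_N.+1 -> R).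
Hypotheses (nb : near x z) (x0 : x <> 0).
Hypothesis tE : forall i, mmap cst (xy x (x * z)) (pa i) = x ^+ m * t i.
Hypothesis rt : forall i, res (t i) = subst_series eta (pa i) m.

Lemma center_lift_hcoords : hcoords p (res \o t).
Proof. by have [hp _] := cp; apply: hcoords_ext hp => i; rewrite /= rt. Qed.

Lemma mmap_psia_lift d (g : {mpoly L[N.+1]}) : g \is d.-homog ->
  mmap cst (xy x (x * z)) (mmap (@mpolyC 2 L) pa g) = x ^+ m ^+ d * mmap cst t g.
Proof.
move=> hg; rewrite rmorph_mmap -(mmap_dhomog _ _ _ hg).
by apply: eq_mmap => [c|i]; rewrite /= ?mmapC // tE.
Qed.

Lemma divides_near g : divides F g -> mmap cst (xy x (x * z)) g = 0.
Proof.
by move=> [q ->]; rewrite rmorphM /= (near_branch_onF EF nb) mulr0.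
Qed.

Lemma center_on_model : on_model (M := M) cst t.
Proof.
move=> g gM; have [d hg] := ns_homog gM.
have := mmap_psia_lift hg.
rewrite (divides_near (psia_eqs irrF etaF psi_degree psi_defined psi_model gM)) -exprM.
by rewrite -[LHS](mulr0 (x ^+ (m * d))) => /(vring_expI x0)/esym.
Qed.

Lemma center_phi phi i : phi \in ns_map M ->
  mmap cst t (tnth phi i) = mmap cst t (tnth phi ord_max) * hpoint (xy x (x * z)) 1 i.
Proof.
move=> phiM; have [d hd] := ns_map_homog phiM.
have := divides_near (psia_phi irrF etaF psi_degree psi_defined psi_model i ord_max phiM).
rewrite rmorphB !rmorphM /= !(mmap_psia_lift (hd _)).
have EX j : mmap cst (xy x (x * z)) (hpoint (xy X Y) 1 j) = hpoint (xy x (x * z)) 1 j.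
  rewrite -[LHS]/((mmap cst (xy x (x * z)) \o hpoint (xy X Y) 1) j) comp_hpoint rmorph1.
  by apply: hpoint_ext => k; rewrite comp_xy /= !mmapXU.
rewrite !EX {1}/hpoint unlift_none mulr1 -!exprM -mulrA => /subr0_eq.
by move/(vring_expI x0).
Qed.

End Lift.

(** One near point with [x <> 0] suffices: its image on the model reduces to [p], while the morphism
    sends that image to [(x, x z)], which reduces to the origin. *)
Lemma center_branch : branch_centred_at (M := M) (origin L 2) p.
Proof.
have [x x0 rx] := vring_infinitesimal V.
have {}x0 : x <> 0 by move=> E; rewrite E rmorph0 eqxx in x0.
have [z nb] := near_branch_exists irrF EF eta0 etaF c0_neq0 a'_root a'_neq rx.
have [t [tE rt]] := center_lift nb.
have hp := center_lift_hcoords rt.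
have Mp := on_model_zeros (center_on_model nb x0 tE) hp.
split=> //; have [y [phi phiM py]] := ns_map_total Mp.
have /(sends_hcoords _ (ns_map_homog phiM) hp) hy := py.
have Ephi i : (tnth phi i).@[res \o t] = (tnth phi ord_max).@[res \o t] * (i == ord_max)%:R.
  rewrite -res_mmap (center_phi nb x0 tE i phiM) rmorphM /= res_mmap; congr (_ * _).
  rewrite /hpoint; case: unliftP => [j|] ->; last by rewrite rmorph1 eqxx.
  rewrite eq_sym (negPf (neq_lift _ _)) mul1r /xy.
  by case: (j == ord0); rewrite ?rmorphM /= rx ?mul0r.
have Ey : y = origin L 2.
  apply: (hcoords_eq hy); apply: (hcoords_minors (origin_hcoords L 2)).
    exact: hcoords_neq0 hy.
  by move=> i j; rewrite (Ephi i) (Ephi j) mulrCA [RHS]mulrCA; congr (_ * _); apply: mulrC.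
by exists phi; rewrite // -Ey.
Qed.

End BranchCenter.

(** The quotient [y / x] satisfies a quadratic equation over [O] whose leading coefficient is a
    unit, so it lies in [O], and its residue is a root of the tangent cone. *)
Lemma node_dichotomy (L K : closedFieldType) (iota : {rmorphism L -> K})
    (V : residue_ring iota) (F u0 u1 u2 : {mpoly L[2]}) (eta1 eta2 : {fps L})
    (x y : vring V) :
  F = 'X_ord_max ^+ 2 * u0 + 'X_ord0 * 'X_ord_max * u1 + 'X_ord0 ^+ 2 * u2 ->
  (forall z, u0.@[fun=> 0] * z ^+ 2 + u1.@[fun=> 0] * z + u2.@[fun=> 0]
     = u0.@[fun=> 0] * (z - eta1 1%N) * (z - eta2 1%N)) ->
  u0.@[fun=> 0] != 0 -> vres x = 0 -> vres y = 0 -> x <> 0 ->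
  mmap (@vconst _ _ _ V) (xy x y) F = 0 ->
  exists z, y = x * z /\
    (near_branch (strict_transform u0 u1 u2) (slope_series eta1) x z \/
     near_branch (strict_transform u0 u1 u2) (slope_series eta2) x z).
Proof.
move=> EF fac c0 rx ry x0; set cst := @vconst _ _ _ V => Fxy.
have ev0 (u : {mpoly L[2]}) : vres (mmap cst (xy x y) u) = u.@[fun=> 0].
  rewrite (rmorph_mmap_xy _ (@vres _ _ _ V)) /= rx ry.
  apply: eq_mmap => [a|i]; first exact: vres_const.
  by rewrite /xy; case: (i == ord0).
set U0 := mmap cst (xy x y) u0; set U1 := mmap cst (xy x y) u1.
set U2 := mmap cst (xy x y) u2.
have EU : y ^+ 2 * U0 + x * y * U1 + x ^+ 2 * U2 = 0.
  by rewrite -[RHS]Fxy EF !expr2 !mmapD !rmorphM /= !mmapXU.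
have vx0 : vval x != 0 by rewrite vval_eq0; apply/eqP.
have [z Ez] : exists z, y = x * z.
  have [[z Ez]|[w Ew rw]] := vring_or_inv V (vval y / vval x).
    by exists z; apply: (@vval_inj _ _ _ V); rewrite rmorphM /= Ez mulrC divfK.
  (* Here [w = x / y] is infinitesimal; dividing the equation by [y^2] and reducing gives
     [c0 = 0]. *)
  have [y0|y0] := eqVneq y 0; first by exists 0; rewrite mulr0.
  have vy0 : vval y != 0 by rewrite vval_eq0.
  have Exw : x = y * w.
    by apply: (@vval_inj _ _ _ V); rewrite rmorphM /= Ew invfM invrK mulrA divff // mul1r.
  have : y ^+ 2 * (U0 + w * U1 + w ^+ 2 * U2) = y ^+ 2 * 0.
    by rewrite mulr0 -[RHS]EU Exw; ring.
  move=> /vring_expI => /(_ (elimN eqP y0))/(congr1 (@vres _ _ _ V)).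
  rewrite !expr2 !rmorphD !rmorphM rmorph0 /= rw !mul0r !addr0 ev0 => E.
  by rewrite E eqxx in c0.
have Gxz : mmap cst (xy x z) (strict_transform u0 u1 u2) = 0.
  rewrite mmap_G -Ez -/U0 -/U1 -/U2; apply: (vring_expI (m := 2) x0).
  by rewrite mulr0 -[RHS]EU Ez; ring.
exists z; split=> //.
have : (strict_transform u0 u1 u2).@[xy 0 (vres z)] = 0.
  rewrite -[RHS](rmorph0 (@vres _ _ _ V)) -Gxz (rmorph_mmap_xy _ (@vres _ _ _ V)) /= rx.
  by apply: eq_mmap => // a; rewrite /= vres_const.
rewrite meval_G0 fac => /eqP; rewrite !mulf_eq0 (negPf c0) /= !subr_eq0.
by case/orP=> /eqP Ea; [left | right]; split.
Qed.

Section OverOrigin.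
Variables (L K : closedFieldType) (iota : {rmorphism L -> K}) (V : residue_ring iota).
Notation R := (vring V).
Notation res := (@vres L K iota V).
Notation vv := (@vval L K iota V).
Notation cst := (@vconst L K iota V).
Variables (F : {mpoly L[2]}) (M : nonsingular_model F).
Notation N := (ns_dim M).
Variable psi : N.+1.-tuple {mpoly L[3]}.
Hypothesis psi_degree : same_degree psi.
Hypothesis psi_inverse : forall x y x', zeros (ns_eqs M) x ->
  mor_sends (ns_map M) x y -> sends psi y x' -> x' = x.
Notation pa := (psia psi).

(** The last component being a unit, the image of [t] stays in the affine plane and has coordinates
    [x], [y] in [O]. *)
Definition lies_over (t : 'I_N.+1 -> R) phi x y : Prop :=
  [/\ phi \in ns_map M, res (mmap cst t (tnth phi ord_max)) != 0 &
      forall i, mmap cst t (tnth phi i)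
        = mmap cst t (tnth phi ord_max) * hpoint (xy x y) 1 i].

Lemma mor_origin p (r : 'I_N.+1 -> L) phi : phi \in ns_map M -> hcoords p r ->
  sends phi p (origin L 2) ->
  (tnth phi ord_max).@[r] != 0 /\ forall j, (tnth phi (lift ord_max j)).@[r] = 0.
Proof.
move=> phiM pr /(sends_hcoords _ (ns_map_homog phiM) pr) ho.
have E i : (tnth phi i).@[r] = (tnth phi ord_max).@[r] * (i == ord_max)%:R.
  have := hcoords_cross i ord_max ho (origin_hcoords L 2).
  by rewrite eqxx mulr1.
split; last by move=> j; rewrite E eq_sym (negPf (neq_lift _ _)) mulr0.
have [i] := hcoords_neq0 (u := fun i => (tnth phi i).@[r]) ho.
by rewrite E; apply: contraNneq => ->; rewrite mul0r.
Qed.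

Lemma model_over_origin t p : on_model (M := M) cst t -> hcoords p (res \o t) ->
  branch_centred_at (M := M) (origin L 2) p ->
  exists phi x y, [/\ lies_over t phi x y, res x = 0, res y = 0 &
    mmap cst (xy x y) F = 0].
Proof.
move=> Mt pt [Mp [phi phiM po]]; have [rm rl] := mor_origin phiM pt po.
pose P i := mmap cst t (tnth phi i).
have rP i : res (P i) = (tnth phi i).@[res \o t] := res_mmap _ _.
have rm' : res (P ord_max) != 0 by rewrite rP.
have [b [_ Pb]] := vunit rm'.
pose c j := P (lift ord_max j) * b.
have rc j : res (c j) = 0 by rewrite rmorphM /= rP rl mul0r.
have EP i : P i = P ord_max * hpoint (xy (c ord0) (c ord_max)) 1 i.
  rewrite /hpoint; case: (unliftP ord_max i) => [j|] ->; last by rewrite mulr1.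
  have -> : xy (c ord0) (c ord_max) j = c j.
    rewrite /xy; case: eqP => [->|] //; case: (unliftP ord0 j) => [k|] -> // _.
    by congr c; apply: val_inj; rewrite /= ord1.
  by rewrite mul1r mulrCA Pb mulr1.
exists phi, (c ord0), (c ord_max); split=> //.
have [e he] := comp3_homog (ns_map_homog phiM) (homogenise_homog F).
have [d hd] := ns_map_homog phiM.
have := vanish_on_transfer (dhomogM (hd ord_max) he) (model_curve ord_max phiM) Mt.
rewrite rmorphM /= mmap_comp3 => /vring_mulf0[P0|].
  by move: rm'; rewrite /P P0 rmorph0 eqxx.
have -> : mmap cst (fun i => mmap cst t (tnth phi i)) (homogenise F)
   = mmap cst (fun i => P ord_max * hpoint (xy (c ord0) (c ord_max)) 1 i) (homogenise F).
  by apply: eq_mmap => // i; rewrite -EP.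
rewrite (mmap_dhomog _ _ _ (homogenise_homog F)) mmap_homogenise expr1n mul1r.
move=> /vring_mulf0[/(congr1 res)|//]; rewrite rmorphXn rmorph0 => /eqP.
by rewrite expf_eq0 (negPf rm') andbF.
Qed.

Lemma model_inverse_pt t phi x y i k : on_model (M := M) cst t -> lies_over t phi x y ->
  mmap cst (xy x y) (pa i) * t k = mmap cst (xy x y) (pa k) * t i.
Proof.
move=> Mt [phiM rm EP]; have [d hd] := ns_map_homog phiM; have [D hD] := psi_degree.
have hc j : comp3 phi (tnth psi j) \is (D * d)%N.-homog by apply: dhomog_mmap.
have Hhom : tnth phi ord_max * (comp3 phi (tnth psi i) * 'X_k - comp3 phi (tnth psi k) * 'X_i)
    \is (d + (D * d + 1))%N.-homog.
  by apply: dhomogM => //; apply: rpredB; apply: dhomogM => //; apply: dhomogXU.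
have := vanish_on_transfer Hhom (model_inverse psi_degree psi_inverse ord_max i k phiM) Mt.
rewrite rmorphM rmorphB !rmorphM /= !mmapXU !mmap_comp3 => /vring_mulf0[P0|].
  by move: rm; rewrite P0 rmorph0 eqxx.
have Ec j : mmap cst (fun i => mmap cst t (tnth phi i)) (tnth psi j)
   = mmap cst t (tnth phi ord_max) ^+ D * mmap cst (xy x y) (pa j).
  rewrite mmap_dehom -(mmap_dhomog _ _ _ (hD j)).
  by apply: eq_mmap => // l; rewrite -EP.
have assoc (a b c b' c' : R) : a * b * c - a * b' * c' = 0 -> a * (b * c) = a * (b' * c').
  by move=> /subr0_eq; rewrite !mulrA.
rewrite !Ec => /assoc; apply: vring_expI => P0.
by move: rm; rewrite P0 rmorph0 eqxx.
Qed.

End OverOrigin.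

(** * Tangent vectors and distinctness of the two centres *)

Section TangentVector.
Variables (L K : closedFieldType) (iota : {rmorphism L -> K}) (V : residue_ring iota).
Notation R := (vring V).
Notation res := (@vres L K iota V).
Notation vv := (@vval L K iota V).
Notation cst := (@vconst L K iota V).
Variables (F : {mpoly L[2]}) (M : nonsingular_model F).
Notation N := (ns_dim M).
Notation X := ('X_ord0 : {mpoly L[2]}).
Notation Y := ('X_ord_max : {mpoly L[2]}).
Variable psi : N.+1.-tuple {mpoly L[3]}.
Hypothesis psi_degree : same_degree psi.
Hypothesis psi_defined : exists y x, vanishes (homogenise F) y /\ sends psi y x.
Hypothesis psi_model : forall y x, vanishes (homogenise F) y -> sends psi y x ->
  zeros (ns_eqs M) x /\ mor_sends (ns_map M) x y.
Variables (u0 u1 u2 : {mpoly L[2]}) (eta : {fps L}) (a' : L).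
Hypothesis irrF : irreducible_elt F.
Hypothesis EF : F = Y ^+ 2 * u0 + X * Y * u1 + X ^+ 2 * u2.
Hypothesis eta0 : eta 0%N = 0.
Hypothesis etaF : subst_series eta F = 0.
Hypothesis c0_neq0 : u0.@[fun=> 0] != 0.
Hypothesis a'_root : u0.@[fun=> 0] * a' ^+ 2 + u1.@[fun=> 0] * a' + u2.@[fun=> 0] = 0.
Hypothesis a'_neq : eta 1%N != a'.
Variables (m : nat) (p : pspace L N).
Hypothesis cp : center_at psi eta m p.
Variables (r : 'I_N.+1 -> L) (i0 : 'I_N.+1).
Hypotheses (pr : hcoords p r) (ri0 : r i0 != 0).

Notation pa := (psia psi).
Notation ord3_0 := (lift ord_max ord0 : 'I_3).
Notation ord3_1 := (lift ord_max ord_max : 'I_3).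

Definition dir_deriv (e : 'I_N.+1 -> L) (g : {mpoly L[N.+1]}) : L :=
  \sum_i e i * g^`M(i).@[r].

(** A point of the model near [p] is [r + s w] with [s] infinitesimal; the
    residue [e] of [w] is tangent at [p].  As [s] is divisible by [x], the
    derivative of the abscissa along [e] does not vanish. *)
Lemma tangent_vector : exists e : 'I_N.+1 -> L, [/\
  exists i, e i != 0, e i0 = 0, forall g, g \in ns_eqs M -> dir_deriv e g = 0 &
  forall phi, phi \in ns_map M -> sends phi p (origin L 2) ->
    dir_deriv e (tnth phi ord3_0) != 0 /\
    dir_deriv e (tnth phi ord3_1) = eta 1%N * dir_deriv e (tnth phi ord3_0)].
Proof.
have [x vx0 rx] := vring_infinitesimal V.
have x0 : x <> 0 by move=> E; rewrite E rmorph0 eqxx in vx0.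
have [z nb] := near_branch_exists irrF EF eta0 etaF c0_neq0 a'_root a'_neq rx.
have rz : res z = eta 1%N by case: nb.
have [t [tE rt]] := center_lift EF eta0 etaF c0_neq0 a'_root a'_neq cp nb.
have hp := center_lift_hcoords cp rt.
have Mt := center_on_model psi_degree psi_defined psi_model irrF EF etaF nb x0 tE.
have phit := center_phi psi_degree psi_defined psi_model irrF EF etaF nb x0 tE.
have [k k0 Ek] := hcoords_uniq hp pr.
have ti0 : res (t i0) != 0 by apply: contraNneq ri0 => E; rewrite Ek /= E mulr0.
have [b [_ tb]] := vunit ti0.
have rb : res b * res (t i0) = 1 by rewrite mulrC -rmorphM tb rmorph1.
have rbk : res b * r i0 = k by rewrite Ek /= mulrCA rb mulr1.
(* The coordinates are normalised so that the one of index [i0] is the constant [r i0]; hence the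
   tangent vector has [e i0 = 0]. *)
pose T i := (b * cst (r i0)) * t i.
have rT i : res (T i) = r i by rewrite !rmorphM /= vres_const rbk Ek.
have Ti0 : T i0 = cst (r i0) by rewrite /T mulrAC (mulrC b) tb mul1r.
have MT : on_model (M := M) cst T.
  by move=> g gM; have [d hg] := ns_homog gM; rewrite (mmap_dhomog _ _ _ hg) Mt ?mulr0.
have phiT phi i : phi \in ns_map M ->
    mmap cst T (tnth phi i) = mmap cst T (tnth phi ord_max) * hpoint (xy x (x * z)) 1 i.
  move=> phiM; have [d hd] := ns_map_homog phiM.
  by rewrite !(mmap_dhomog _ _ _ (hd _)) phit // mulrA.
pose del i := T i - cst (r i).
(* The leading coefficients of [psi] along the branch are proportional to [r], so [g] has order at
   least [m + 1]: one power of [x] more than the coordinates. *)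
have /choice[u Edel] i : exists u, del i = x * u.
  pose g := r i0 *: pa i - r i *: pa i0.
  have sub0 (c d : L) : c = d -> d - c = 0 by move=> ->; rewrite subrr.
  have sub00 (c d : L) : c * 0 - d * 0 = 0 by rewrite !mulr0 subr0.
  have low j : (j < m.+1)%N -> subst_series eta g j = 0.
    have -> : subst_series eta g j =
        r i0 * subst_series eta (pa i) j - r i * subst_series eta (pa i0) j.
      have -> : subst_series eta g = fpsC (r i0) * subst_series eta (pa i)
          - fpsC (r i) * subst_series eta (pa i0).
        by rewrite [LHS]mmapB; congr (_ - _); apply: mmapZ.
      by rewrite -!fps_coefCM.
    have [hr lo] := cp; rewrite ltnS leq_eqVlt => /orP[/eqP ->|jm].
      by apply: sub0; have /= := hcoords_cross i i0 pr hr.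
    apply: etrans (sub00 (r i0) (r i)).
    by apply: (congr2 (fun c d => _ * c - _ * d)); apply: lo.
  have [w Ew _] := branch_value EF eta0 etaF c0_neq0 a'_root a'_neq nb low.
  exists (b * w).
  have : cst (r i0) * t i - cst (r i) * t i0 = x * w.
    apply: (vring_expI (m := m) x0).
    rewrite mulrA -exprSr -Ew /g mmapB !mmapZ !tE.
    by rewrite mulrBr !(mulrCA (x ^+ m)).
  move=> E; rewrite mulrCA -E /del /T mulrBr !mulrA; congr (_ - _).
  by rewrite -[LHS]mulr1 -tb; ring.
(* If [T] were the constant point [r], its plane image would be the origin, contradicting
   [x <> 0]. *)
have [i di] : exists i, vv (del i) != 0.
  apply: contrapT => nd; have [Mp [phi phiM po]] := center_branch V psi_degree psi_defined psi_model
     irrF EF eta0 etaF c0_neq0 a'_root a'_neq cp.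
  have TE i : T i = cst (r i).
    apply/eqP; rewrite -subr_eq0 -vval_eq0; apply/negPn/negP => di.
    by apply: nd; exists i.
  have ET g : mmap cst T g = cst g.@[r].
    by rewrite /meval rmorph_mmap; apply: eq_mmap => // i; rewrite TE.
  have [rm rl] := mor_origin phiM pr po.
  have := phiT phi ord3_0 phiM; rewrite !ET rl rmorph0 /hpoint liftK mul1r /xy /=.
  move=> /esym/vring_mulf0[/(congr1 res)|//]; rewrite vres_const rmorph0 => E.
  by rewrite E eqxx in rm.
(* The displacement is divided by its entry [s] of least valuation, so the direction [w] is over [O]
   and has an entry 1; its residue is a nonzero vector. *)
have [i1 di1 [w Ew]] := dominant_entry V (u := vv \o del) (ex_intro _ i di).
pose s := del i1; have s0 : s <> 0 by move=> E; rewrite /= -/s E rmorph0 eqxx in di1.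
have Ed j : del j = s * w j by apply: (@vval_inj _ _ _ V); rewrite rmorphM /= -Ew.
have ET : T =1 (fun j => cst (r j) + s * w j).
  by move=> j; rewrite -Ed /del addrC subrK.
have rs : res s = 0 by rewrite rmorphB /= rT vres_const subrr.
have mul_s0 (a : R) : s * a = 0 -> a = 0 by move=> /vring_mulf0[].
exists (res \o w).
have cderiv g : res (\sum_j w j * mmap cst (cst \o r) g^`M(j)) = dir_deriv (res \o w) g.
  rewrite rmorph_sum; apply: eq_bigr => j _; rewrite rmorphM /= res_mmap.
  by congr (_ * _); apply: meval_eq => l; rewrite /= vres_const.
have mc g : mmap cst (cst \o r) g = cst g.@[r].
  by rewrite /meval rmorph_mmap; apply: eq_mmap.
have Tay g : exists q, mmap cst T g = cst g.@[r]
     + s * (\sum_j w j * mmap cst (cst \o r) g^`M(j) + s * q).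
  have [q Eq] := mmap_Taylor1 cst (cst \o r) s w g; exists q.
  by rewrite (eq_mmap _ (frefl _) ET) Eq mc; ring.
split.
- exists i1; have : s * (w i1 - 1) = 0 by rewrite mulrBr -Ed mulr1 subrr.
  by move/mul_s0/subr0_eq => /= ->; rewrite rmorph1 oner_eq0.
- have : s * w i0 = 0 by rewrite -Ed /del Ti0 subrr.
  by move/mul_s0 => /= ->; rewrite rmorph0.
- move=> g gM; have [q] := Tay g; rewrite MT //.
  have Mp := on_model_zeros Mt hp; have /(zeros_hcoords pr) Mr := Mp.
  rewrite Mr // rmorph0 add0r => /esym/mul_s0/(congr1 res).
  by rewrite rmorphD rmorphM /= rs mul0r addr0 cderiv rmorph0.
move=> phi phiM po; have [rm rl] := mor_origin phiM pr po.
have E0 : exists q, mmap cst T (tnth phi ord_max) * x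
    = s * (\sum_j w j * mmap cst (cst \o r) (tnth phi ord3_0)^`M(j) + s * q).
  have [q Eq] := Tay (tnth phi ord3_0); exists q.
  move: Eq; rewrite (phiT _ _ phiM) rl rmorph0 add0r => <-.
  by rewrite /hpoint liftK mul1r.
have E1 : exists q, mmap cst T (tnth phi ord_max) * (x * z)
    = s * (\sum_j w j * mmap cst (cst \o r) (tnth phi ord3_1)^`M(j) + s * q).
  have [q Eq] := Tay (tnth phi ord3_1); exists q.
  move: Eq; rewrite (phiT _ _ phiM) rl rmorph0 add0r => <-.
  by rewrite /hpoint liftK mul1r.
have [[q0 {}E0] [q1 {}E1]] := (E0, E1).
have rP : res (mmap cst T (tnth phi ord_max)) = (tnth phi ord_max).@[r].
  by rewrite res_mmap; apply: meval_eq => j; rewrite /= rT.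
split.
  (* Since [s = x u], the factor [x] cancels from [E0]; were the derivative zero, the last component
     of [phi] would have residue 0. *)
  apply/negP => /eqP D0; have Es : s = x * u i1 := Edel i1.
  have : x * (mmap cst T (tnth phi ord_max) -
      u i1 * (\sum_j w j * mmap cst (cst \o r) (tnth phi ord3_0)^`M(j) + s * q0)) = 0.
    by rewrite mulrBr mulrA -Es -E0 mulrC subrr.
  move=> /vring_mulf0[//|/(congr1 res)].
  rewrite rmorphB rmorphM rmorphD /= cderiv D0 add0r rmorphM /= rs mul0r mulr0 subr0 rP rmorph0.
  by move=> E; rewrite E eqxx in rm.
have : s * (\sum_j w j * mmap cst (cst \o r) (tnth phi ord3_1)^`M(j) + s * q1)
   = s * (z * (\sum_j w j * mmap cst (cst \o r) (tnth phi ord3_0)^`M(j) + s * q0)).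
  by rewrite -E1 [RHS]mulrCA -E0 mulrA mulrC.
move/eqP; rewrite -subr_eq0 -mulrBr => /eqP/mul_s0/subr0_eq/(congr1 res).
by rewrite rmorphM !rmorphD !rmorphM /= rs !mul0r !addr0 !cderiv rz.
Qed.

End TangentVector.

(** The kernel of [J] has dimension [n + 1 - (n - 1) = 2] and is spanned by [r] and [e1]; the
    condition at [i0] kills the multiple of [r]. *)
Lemma dependent_kernel (L : fieldType) m n (J : 'M[L]_(m, n.+1)) (r e1 e2 : 'rV[L]_n.+1) i0 :
  (\rank J).+1 = n -> r 0 i0 != 0 -> e1 0 i0 = 0 -> e2 0 i0 = 0 -> e1 != 0 ->
  r *m J^T = 0 -> e1 *m J^T = 0 -> e2 *m J^T = 0 -> exists c, e2 = c *: e1.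
Proof.
move=> rJ r0 e10 e20 ne1 rK e1K e2K.
have rk : \rank (kermx J^T) = 2.
  rewrite mxrank_ker mxrank_tr; suff: (n.+1 - \rank J = 2)%N by [].
  by rewrite -[X in (X.+1 - _)%N]rJ subSn // subSnn.
pose B := col_mx r e1.
have Bfree : \rank B = 2%N.
  apply/eqP; rewrite -[_ == _]/(row_free B) -kermx_eq0; apply/eqP/row_matrixP => i.
  rewrite row0; have : row i (kermx B) *m B = 0 by rewrite -row_mul mulmx_ker row0.
  move: (row i (kermx B)) => v.
  rewrite -[v]hsubmxK mul_row_col [lsubmx v]mx11_scalar [rsubmx v]mx11_scalar.
  move: (lsubmx v 0 0) (rsubmx v 0 0) => l k; rewrite !mul_scalar_mx => E.
  have l0 : l = 0.
    move/matrixP/(_ 0 i0): (E); rewrite mxE [X in X + _]mxE [X in _ + X]mxE e10 mulr0 addr0 mxE.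
    by move/eqP; rewrite mulf_eq0 (negPf r0) orbF => /eqP.
  have k0 : k = 0.
    move: E; rewrite l0 scale0r add0r => /eqP.
    by rewrite scaler_eq0 (negPf ne1) orbF => /eqP.
  rewrite l0 k0.
  rewrite !raddf0.
  by rewrite row_mx0.
have sB : (B <= kermx J^T)%MS by apply/sub_kermxP; rewrite mul_col_mx rK e1K col_mx0.
have eB : (kermx J^T <= B)%MS by rewrite -(geq_leqif (mxrank_leqif_sup sB)) rk Bfree.
have : (e2 <= B)%MS by apply: submx_trans eB; apply/sub_kermxP.
move=> /submxP[v]; rewrite -[v]hsubmxK mul_row_col [lsubmx v]mx11_scalar [rsubmx v]mx11_scalar.
rewrite !mul_scalar_mx => E; exists (rsubmx v 0 0).
have l0 : lsubmx v 0 0 = 0.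
  move/matrixP/(_ 0 i0): (E); rewrite e20 mxE [X in X + _]mxE [X in _ + X]mxE e10 mulr0 addr0.
  by move/esym/eqP; rewrite mulf_eq0 (negPf r0) orbF => /eqP.
by rewrite E l0 scale0r add0r.
Qed.

Section Euler.
Variables (L K : closedFieldType) (iota : {rmorphism L -> K}) (V : residue_ring iota).
Notation cst := (@vconst L K iota V).
Notation res := (@vres L K iota V).

(** By homogeneity [g((1 + x) r) = 0] for an infinitesimal [x]; the Taylor expansion at [r], divided
    by [x] and reduced, leaves the sum. *)
Lemma euler_zero n d (g : {mpoly L[n]}) (r : 'I_n -> L) :
  g \is d.-homog -> g.@[r] = 0 -> \sum_i r i * g^`M(i).@[r] = 0.
Proof.
move=> hg gr.
have [x vx0 rx] := vring_infinitesimal V.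
have x0 : x <> 0 by move=> E; rewrite E rmorph0 eqxx in vx0.
have mc (q : {mpoly L[n]}) : mmap cst (cst \o r) q = cst q.@[r].
  by rewrite /meval rmorph_mmap; apply: eq_mmap.
have [q Eq] := mmap_Taylor1 cst (cst \o r) x (cst \o r) g.
have : mmap cst (fun i => (1 + x) * (cst \o r) i) g = 0.
  by rewrite (mmap_dhomog _ _ _ hg) mc gr rmorph0 mulr0.
have -> : mmap cst (fun i => (1 + x) * (cst \o r) i) g
   = mmap cst (fun i => (cst \o r) i + x * (cst \o r) i) g.
  by apply: eq_mmap => // i; rewrite mulrDl mul1r.
rewrite Eq mc gr rmorph0 add0r.
have -> : \sum_i (cst \o r) i * mmap cst (cst \o r) g^`M(i)
   = cst (\sum_i r i * g^`M(i).@[r]).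
  by rewrite rmorph_sum; apply: eq_bigr => i _; rewrite rmorphM mc.
move: (\sum_i _) => S; rewrite expr2 -mulrA -mulrDr.
move=> /vring_mulf0[//|/(congr1 res)].
by rewrite rmorphD rmorphM rmorph0 /= rx mul0r addr0 => <-; rewrite vres_const.
Qed.

End Euler.

Section Centers.
Variables (L K : closedFieldType) (iota : {rmorphism L -> K}) (V : residue_ring iota).
Variables (F : {mpoly L[2]}) (M : nonsingular_model F).
Notation N := (ns_dim M).
Notation X := ('X_ord0 : {mpoly L[2]}).
Notation Y := ('X_ord_max : {mpoly L[2]}).
Variable psi : N.+1.-tuple {mpoly L[3]}.
Hypothesis psi_degree : same_degree psi.
Hypothesis psi_defined : exists y x, vanishes (homogenise F) y /\ sends psi y x.
Hypothesis psi_model : forall y x, vanishes (homogenise F) y -> sends psi y x ->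
  zeros (ns_eqs M) x /\ mor_sends (ns_map M) x y.
Variables (u0 u1 u2 : {mpoly L[2]}) (eta1 eta2 : {fps L}).
Hypothesis irrF : irreducible_elt F.
Hypothesis EF : F = Y ^+ 2 * u0 + X * Y * u1 + X ^+ 2 * u2.
Hypothesis eta10 : eta1 0%N = 0.
Hypothesis eta20 : eta2 0%N = 0.
Hypothesis eta1F : subst_series eta1 F = 0.
Hypothesis eta2F : subst_series eta2 F = 0.
Hypothesis c0_neq0 : u0.@[fun=> 0] != 0.
Hypothesis eta_neq : eta1 1%N != eta2 1%N.

(** If the centres agreed, nonsingularity would make the two tangent vectors proportional. Their
    images in the plane would then have the same slope, whereas the slopes are [eta1'(0)] and
    [eta2'(0)]. *)
Lemma centers_neq m1 m2 p1 p2 :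
  center_at psi eta1 m1 p1 -> center_at psi eta2 m2 p2 -> p1 != p2.
Proof.
move=> cp1 cp2; apply/eqP => Ep; rewrite -{p2}Ep in cp2.
have r1 := slope_root EF eta10 eta1F; have r2 := slope_root EF eta20 eta2F.
have eta_neq' : eta2 1%N != eta1 1%N by rewrite eq_sym.
have pr := hcoords_coords p1; have [i0 ri0] := hcoords_neq0 pr.
have [Mp [phi phiM po]] := center_branch V psi_degree psi_defined psi_model
   irrF EF eta10 eta1F c0_neq0 r2 eta_neq cp1.
have [e1 [[i1 e1i] e10 e1g /(_ phi phiM po)[d1 De1]]] :=
  tangent_vector V psi_degree psi_defined psi_model irrF EF eta10 eta1F c0_neq0 r2 eta_neq cp1 pr ri0.
have [e2 [_ e20 e2g /(_ phi phiM po)[d2 De2]]] :=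
  tangent_vector V psi_degree psi_defined psi_model irrF EF eta20 eta2F c0_neq0 r1 eta_neq' cp2 pr ri0.
pose J := \matrix_(i < size (ns_eqs M), j < N.+1) ((ns_eqs M)`_i)^`M(j).@[coords p1 0].
have rJ : (\rank J).+1 = N := ns_nonsingular Mp.
have KJ e : (forall g, g \in ns_eqs M -> \sum_i e i * g^`M(i).@[coords p1 0] = 0) ->
    \row_i e i *m J^T = 0.
  move=> he; apply/rowP => i; rewrite !mxE -[RHS](he _ (mem_nth 0 (ltn_ord i))).
  by apply: eq_bigr => j _; rewrite !mxE.
have [c Ec] : exists c, \row_i e2 i = c *: \row_i e1 i.
  apply: (@dependent_kernel _ _ _ J (\row_i coords p1 0 i) _ _ i0 rJ).
  - by rewrite mxE.
  - by rewrite mxE.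
  - by rewrite mxE.
  - by apply: contraNneq e1i => /rowP/(_ i1); rewrite !mxE => ->.
  - apply: KJ => g gM; have [d hg] := ns_homog gM.
    by apply: (euler_zero V hg); apply/(vanishes_hcoords hg pr)/Mp.
  - exact: KJ.
  - exact: KJ.
have Dc g : dir_deriv (coords p1 0) e2 g = c * dir_deriv (coords p1 0) e1 g.
  rewrite /dir_deriv mulr_sumr; apply: eq_bigr => i _.
  by move/rowP/(_ i): Ec; rewrite !mxE => ->; rewrite mulrA.
move: d2 De2; rewrite !Dc De1 => d2 /eqP.
rewrite mulrCA -subr_eq0 -mulrBl mulf_eq0 (negPf d2) orbF subr_eq0 => E.
by move: eta_neq; rewrite E.
Qed.

End Centers.

(** * No third point above the origin *)

Section PlaceNode.
Variables (L K : closedFieldType) (iota : {rmorphism L -> K}).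

(** [Rp k a]: the element [k] of the local ring has residue [a]. *)
Variable Rp : K -> L -> Prop.
Hypothesis Rp0 : forall a, Rp 0 a -> a = 0.
Hypothesis RpC : forall a, Rp (iota a) a.
Hypothesis RpD : forall k l a b, Rp k a -> Rp l b -> Rp (k + l) (a + b).
Hypothesis RpM : forall k l a b, Rp k a -> Rp l b -> Rp (k * l) (a * b).
Hypothesis RpV : forall k a, Rp k a -> a != 0 -> Rp k^-1 a^-1.

Lemma RpN k a : Rp k a -> Rp (- k) (- a).
Proof. by move=> ka; rewrite -mulN1r -[- a]mulN1r -(rmorphN1 iota); apply: RpM. Qed.

Lemma Rp_mmap n (u : 'I_n -> K) (c : 'I_n -> L) f :
  (forall i, Rp (u i) (c i)) -> Rp (mmap iota u f) f.@[c].
Proof.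
move=> uc; elim/mpoly_ring_ind: f => [a|i|p q hp hq|p q hp hq].
- by rewrite mmapC mevalC; apply: RpC.
- by rewrite mmapXU mevalXU.
- by rewrite mmapD mevalD; apply: RpD.
- by rewrite rmorphM mevalM; apply: RpM.
Qed.

Variables (x z U0 U1 U2 w : K) (c0 c1 c2 a1 a2 : L) (D Q : {mpoly L[2]}).
Hypothesis Rx : Rp x 0.
Hypotheses (RU0 : Rp U0 c0) (RU1 : Rp U1 c1) (RU2 : Rp U2 c2).
Hypothesis Ez : z ^+ 2 * U0 + z * U1 + U2 = 0.
Hypothesis c0_neq0 : c0 != 0.
Hypothesis fac : forall b, c0 * b ^+ 2 + c1 * b + c2 = c0 * (b - a1) * (b - a2).
Hypothesis Rw : Rp w 0.
Hypothesis ED : mmap iota (xy x z) D = w * mmap iota (xy x z) Q.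

(** With [A] the local ring behind [Rp] and [I] its maximal ideal, [Rz] is [A[z] = A + A z], because
    [z] is quadratic over [A] with unit leading coefficient, and [Iz] is the ideal [I A[z]]. *)
Definition Rz k := exists m n a b, [/\ Rp m a, Rp n b & k = m + n * z].
Definition Iz k := exists m n, [/\ Rp m 0, Rp n 0 & k = m + n * z].

Let Rp_eq k a b : Rp k a -> a = b -> Rp k b. Proof. by move=> h <-. Qed.

Lemma RzC a : Rz (iota a).
Proof.
exists (iota a), (iota 0), a, 0; split; try exact: RpC.
by rewrite rmorph0 mul0r addr0.
Qed.

Lemma RzX : Rz z.
Proof.
exists (iota 0), (iota 1), 0, 1; split; try exact: RpC.
by rewrite rmorph0 rmorph1 mul1r add0r.
Qed.

Lemma RzD k l : Rz k -> Rz l -> Rz (k + l).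
Proof.
move=> [m [n [a [b [ma nb ->]]]]] [m' [n' [a' [b' [ma' nb' ->]]]]].
exists (m + m'), (n + n'), (a + a'), (b + b'); split; try exact: RpD.
by ring.
Qed.

Lemma z_square m n m' n' : (m + n * z) * (m' + n' * z) =
  (m * m' + - (n * n') * (U2 * U0^-1)) + (m * n' + n * m' + - (n * n') * (U1 * U0^-1)) * z.
Proof.
have U0n : U0 != 0.
  by apply: contraNneq c0_neq0 => E; apply/eqP/Rp0; rewrite -E.
have -> : U2 * U0^-1 = - (z ^+ 2 + z * (U1 * U0^-1)).
  have -> : U2 = - (z ^+ 2 * U0 + z * U1) by apply/eqP; rewrite -addr_eq0 addrC Ez.
  by rewrite mulNr mulrDl mulfK // mulrA.
by move: (U1 * _) => c; ring.
Qed.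

Lemma RzM k l : Rz k -> Rz l -> Rz (k * l).
Proof.
move=> [m [n [a [b [ma nb ->]]]]] [m' [n' [a' [b' [ma' nb' ->]]]]].
have RV := RpV RU0 c0_neq0; have Rnn := RpN (RpM nb nb').
have H1 := RpD (RpM ma ma') (RpM Rnn (RpM RU2 RV)).
have H2 := RpD (RpD (RpM ma nb') (RpM nb ma')) (RpM Rnn (RpM RU1 RV)).
by do 4 eexists; split; [exact: H1 | exact: H2 | exact: z_square].
Qed.

Lemma IzM k l : Iz k -> Rz l -> Iz (k * l).
Proof.
move=> [m [n [ma nb ->]]] [m' [n' [a' [b' [ma' nb' ->]]]]].
have RV := RpV RU0 c0_neq0; have Rnn := RpN (RpM nb nb').
have H1 := RpD (RpM ma ma') (RpM Rnn (RpM RU2 RV)).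
have H2 := RpD (RpD (RpM ma nb') (RpM nb ma')) (RpM Rnn (RpM RU1 RV)).
do 2 eexists; split; [apply: (Rp_eq H1) | apply: (Rp_eq H2) | exact: z_square].
  by rewrite !mul0r oppr0 mul0r addr0.
by rewrite !mul0r oppr0 mul0r !addr0.
Qed.

Lemma IzD k l : Iz k -> Iz l -> Iz (k + l).
Proof.
move=> [m [n [ma nb ->]]] [m' [n' [ma' nb' ->]]].
exists (m + m'), (n + n'); split; [apply: (Rp_eq (RpD ma ma'))|apply: (Rp_eq (RpD nb nb'))|by ring].
  exact: addr0.
exact: addr0.
Qed.

Lemma Iz_Rp k : Rp k 0 -> Iz k.
Proof.
move=> k0; exists k, (iota 0); split=> //.
by rewrite rmorph0 mul0r addr0.
Qed.

Lemma Rz_Rp k a : Rp k a -> Rz k.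
Proof.
move=> ka; exists k, (iota 0), a, 0; split=> //.
by rewrite rmorph0 mul0r addr0.
Qed.

Lemma Rz_mmap f : Rz (mmap iota (xy x z) f).
Proof.
elim/mpoly_ring_ind: f => [a|i|p q hp hq|p q hp hq].
- by rewrite mmapC; apply: RzC.
- rewrite mmapXU /xy; case: (i == ord0); [exact: Rz_Rp Rx | exact: RzX].
- by rewrite mmapD; apply: RzD.
- by rewrite rmorphM; apply: RzM.
Qed.

Lemma Rz_horner (s : {poly L}) : Rz (map_poly iota s).[z].
Proof.
elim/poly_ind: s => [|s c IH]; first by rewrite rmorph0 horner0 -(rmorph0 iota); apply: RzC.
rewrite rmorphD rmorphM /= map_polyX map_polyC /= hornerD hornerMX hornerC.
by apply: RzD (RzM IH RzX) (RzC _).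
Qed.

(** [D(0, z)] differs from [D(x, z) = w Q(x, z)] by a multiple of [x], and both [w] and [x] have
    residue 0. *)
Lemma Iz_exceptional : Iz (mmap iota (xy 0 z) D).
Proof.
have [A [B EAB]] := mmap_xy_sub (@mpolyC 2 L) 0 'X_ord_max 'X_ord0 'X_ord_max D.
have ev a b : mmap iota (xy x z) (mmap (@mpolyC 2 L) (xy a b) D) =
    mmap iota (xy (mmap iota (xy x z) a) (mmap iota (xy x z) b)) D.
  by rewrite rmorph_mmap_xy; apply: eq_mmap => // c; rewrite /= mmapC.
have alg (p q u v c d : {mpoly L[2]}) :
    p - q = (0 - u) * c + (v - v) * d -> p = q + u * - c.
  by move/eqP; rewrite subr_eq => /eqP ->; ring.
have E0 : mmap (@mpolyC 2 L) (xy 0 'X_ord_max) D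
    = mmap (@mpolyC 2 L) (xy 'X_ord0 'X_ord_max) D + 'X_ord0 * - A.
  exact: alg EAB.
have -> : mmap iota (xy 0 z) D = mmap iota (xy x z) (mmap (@mpolyC 2 L) (xy 0 'X_ord_max) D).
  by rewrite ev mmap0 mmapXU.
rewrite E0 mmapD ev rmorphM /= !mmapXU [X in mmap iota X D]/(xy x z) ED.
by apply: IzD; apply: IzM (Rz_mmap _); apply: Iz_Rp.
Qed.

(** [D(0, Z)] is prime to [c0 Z^2 + c1 Z + c2], and both take at [z] a value in
    the ideal [Iz]; so [1] would belong to it. *)
Lemma place_node : D.@[xy 0 a1] != 0 -> D.@[xy 0 a2] != 0 -> False.
Proof.
move=> D1 D2; pose d : {poly L} := mmap polyC (xy 0 'X) D.
have dE a : d.[a] = D.@[xy 0 a].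
  rewrite -[LHS]/(horner_eval a d) rmorph_mmap_xy; apply: eq_mmap => [b|i] /=.
    by rewrite /horner_eval hornerC.
  by rewrite /xy /horner_eval /= horner0 hornerX.
have diE : (map_poly iota d).[z] = mmap iota (xy 0 z) D.
  rewrite -[LHS]/(horner_eval z (map_poly iota d)) !rmorph_mmap_xy; apply: eq_mmap => [b|i] /=.
    by rewrite map_polyC /horner_eval /= hornerC.
  by rewrite /xy /= map_polyX rmorph0 /horner_eval horner0 hornerX.
pose q : {poly L} := ('X - a1%:P) * ('X - a2%:P).
have : coprimep d q.
  rewrite coprimepMr !coprimep_XsubC /root !dE.
  by rewrite D1 D2.
move=> /Bezout_eq1_coprimepP[[s t] /= E].
(* Subtracting the exact equation of [z] leaves coefficients [c_i - U_i], all of residue 0. *)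
have qz : Iz (map_poly iota q).[z].
  have Eq : iota c0 * (map_poly iota q).[z] =
     (iota c0 - U0) * z ^+ 2 + (iota c1 - U1) * z + (iota c2 - U2).
    have -> : (iota c0 - U0) * z ^+ 2 + (iota c1 - U1) * z + (iota c2 - U2)
       = (iota c0 * z ^+ 2 + iota c1 * z + iota c2) - (z ^+ 2 * U0 + z * U1 + U2) by ring.
    rewrite Ez subr0.
    have Ec2 : c2 = c0 * a1 * a2.
      have -> : c2 = c0 * 0 ^+ 2 + c1 * 0 + c2 by ring.
      by rewrite fac; ring.
    have Ec1 : c1 = - (c0 * (a1 + a2)).
      have -> : c1 = (c0 * 1 ^+ 2 + c1 * 1 + c2) - c0 - c2 by ring.
      by rewrite fac Ec2; ring.
    rewrite Ec1 Ec2 /q [map_poly _ _]rmorphM /= !map_polyXsubC hornerM !hornerXsubC.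
    by rewrite rmorphN !rmorphM rmorphD; ring.
  have -> : (map_poly iota q).[z] = (iota c0 * (map_poly iota q).[z]) * iota c0^-1.
    by rewrite mulrAC -rmorphM divff // rmorph1 mul1r.
  apply: IzM (RzC _); rewrite Eq.
  have Rs c U : Rp U c -> Iz (iota c - U).
    by move=> RU; apply/Iz_Rp/(Rp_eq (RpD (RpC c) (RpN RU)))/subrr.
  by apply: IzD (Rs _ _ RU2); apply: IzD (IzM (Rs _ _ RU1) RzX); apply: IzM (Rs _ _ RU0) (RzM RzX RzX).
have : Iz 1.
  have -> : 1 = (map_poly iota d).[z] * (map_poly iota s).[z] + (map_poly iota q).[z] * (map_poly iota t).[z].
    by rewrite -!hornerM -hornerD -!rmorphM -rmorphD /= mulrC [X in _ + X]mulrC E rmorph1 hornerC.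
  by apply: IzD; apply: IzM (Rz_horner _) => //; rewrite diE; apply: Iz_exceptional.
(* Nakayama by hand: from [1 - m = n z] the equation of [z], multiplied by [n^2], becomes one
   between elements of the local ring, and its residue is [c0 = 0]. *)
move=> [m [n [Rm Rn E1]]].
have E2 : (1 - m) * (1 - m) * U0 + n * (1 - m) * U1 + n * n * U2 = 0.
  have -> : 1 - m = n * z by rewrite E1 addrC addKr.
  by rewrite -[RHS](mulr0 (n ^+ 2)) -Ez; ring.
have R1m : Rp (1 - m) 1.
  by rewrite -(rmorph1 iota); apply: (Rp_eq (RpD (RpC 1) (RpN Rm))); rewrite subr0.
have := RpD (RpD (RpM (RpM R1m R1m) RU0) (RpM (RpM Rn R1m) RU1)) (RpM (RpM Rn Rn) RU2).
by rewrite E2 => /Rp0/eqP; rewrite !mul0r !mul1r !addr0 (negPf c0_neq0).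
Qed.

End PlaceNode.

Section LocalQuotient.
Variables (L : closedFieldType) (F u0 u1 u2 : {mpoly L[2]}) (eta : {fps L}) (a' : L).
Notation X := ('X_ord0 : {mpoly L[2]}).
Notation Y := ('X_ord_max : {mpoly L[2]}).
Notation c0 := u0.@[fun=> 0].
Notation c1 := u1.@[fun=> 0].
Notation c2 := u2.@[fun=> 0].
Hypothesis EF : F = Y ^+ 2 * u0 + X * Y * u1 + X ^+ 2 * u2.
Hypothesis eta0 : eta 0%N = 0.
Hypothesis etaF : subst_series eta F = 0.
Hypothesis c0_neq0 : c0 != 0.
Hypothesis a'_root : c0 * a' ^+ 2 + c1 * a' + c2 = 0.
Hypothesis a'_neq : eta 1%N != a'.
Notation G := (strict_transform u0 u1 u2).
Notation zeta := (slope_series eta).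

(** [A / B] has nonnegative order along the branch, hence equals [Q / D] on [G] with [D] a unit at
    the slope of that branch. The identity holds at every point of [G] with [x <> 0], so the
    identities of both branches can be read at one point. *)
Lemma local_quotient m A B :
  (forall i, (i < m)%N -> subst_series eta A i = 0) ->
  (forall i, (i < m)%N -> subst_series eta B i = 0) -> subst_series eta B m != 0 ->
  exists D Q : {mpoly L[2]}, D.@[xy 0 (eta 1%N)] != 0 /\
    forall (K : closedFieldType) (iota : {rmorphism L -> K}) (V : residue_ring iota)
      (x z : vring V), x <> 0 -> mmap (@vconst _ _ _ V) (xy x z) G = 0 ->
    mmap (@vconst _ _ _ V) (xy x (x * z)) A * mmap (@vconst _ _ _ V) (xy x z) D
    = mmap (@vconst _ _ _ V) (xy x (x * z)) B * mmap (@vconst _ _ _ V) (xy x z) Q.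
Proof.
move=> lowA lowB Bm.
have sl f i : subst_series zeta (blowup f) i = subst_series eta f i by rewrite subst_slope.
have {}lowA i : (i < m)%N -> subst_series zeta (blowup A) i = 0 by rewrite sl; apply: lowA.
have {}lowB i : (i < m)%N -> subst_series zeta (blowup B) i = 0 by rewrite sl; apply: lowB.
have [Da [Am [Ba [Ea Da0]]]] := branch_divide EF eta0 etaF c0_neq0 a'_root a'_neq lowA.
have [Db [Bm' [Bb [Eb Db0]]]] := branch_divide EF eta0 etaF c0_neq0 a'_root a'_neq lowB.
exists (Da * Bm'), (Am * Db); split.
  rewrite mevalM mulf_eq0 negb_or; apply/andP; split; first exact: Da0.
  rewrite (branch_divide_coef EF eta0 etaF lowB Eb) mulf_eq0 negb_or; apply/andP; split; first exact: Db0.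
  by rewrite sl; exact: Bm.
move=> K iota V x z x0 Gxz; rewrite -!mmap_blowup.
have ev D f g C : D * f = X ^+ m * g + C * G ->
  mmap (@vconst _ _ _ V) (xy x z) D * mmap (@vconst _ _ _ V) (xy x z) f
   = x ^+ m * mmap (@vconst _ _ _ V) (xy x z) g.
  by move=> E; rewrite -rmorphM /= E mmapD !rmorphM rmorphXn /= mmapXU Gxz mulr0 addr0.
have {}Ea := ev _ _ _ _ Ea; have {}Eb := ev _ _ _ _ Eb.
rewrite !rmorphM /=; apply: (vring_expI (m := m) x0).
move: (mmap _ _ Da) (mmap _ _ Am) (mmap _ _ Db) (mmap _ _ Bm') Ea Eb.
move: (mmap _ _ (blowup A)) (mmap _ _ (blowup B)) (x ^+ m) => a b c da am db bm Ea Eb.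
transitivity ((da * a) * (c * bm)); first by ring.
by rewrite Ea -Eb; ring.
Qed.

End LocalQuotient.

Section Generic.
Variables (L K : closedFieldType) (iota : {rmorphism L -> K}) (V : residue_ring iota).
Notation R := (vring V).
Notation res := (@vres L K iota V).
Notation vv := (@vval L K iota V).
Notation cst := (@vconst L K iota V).
Variables (F : {mpoly L[2]}) (M : nonsingular_model F).
Notation N := (ns_dim M).
Notation X := ('X_ord0 : {mpoly L[2]}).
Notation Y := ('X_ord_max : {mpoly L[2]}).
Variable psi : N.+1.-tuple {mpoly L[3]}.
Hypothesis psi_degree : same_degree psi.
Hypothesis psi_defined : exists y x, vanishes (homogenise F) y /\ sends psi y x.
Hypothesis psi_model : forall y x, vanishes (homogenise F) y -> sends psi y x ->
  zeros (ns_eqs M) x /\ mor_sends (ns_map M) x y.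
Hypothesis psi_inverse : forall x y x', zeros (ns_eqs M) x ->
  mor_sends (ns_map M) x y -> sends psi y x' -> x' = x.
Hypothesis F_neq0 : F != 0.

(** The form [h] is nonzero at the point [q] and, where it does not vanish, [psi] inverts the
    morphism; there [g] vanishes because its pullback to the plane is divisible by [F]. Thus [h g]
    vanishes on the model, and irreducibility removes [h]. *)
Lemma pullback_vanish d (g : {mpoly L[N.+1]}) : g \is d.-homog ->
  divides F (mmap (@mpolyC 2 L) (psia psi) g) -> vanish_on (M := M) g.
Proof.
move=> hg dv; have [D hD] := psi_degree.
pose gp := mmap (@mpolyC 3 L) (tnth psi) g.
have hgp : gp \is (d * D)%N.-homog by apply: dhomog_mmap.
have Edh : dehom gp = mmap (@mpolyC 2 L) (psia psi) g.
  by rewrite /dehom rmorph_mmap; apply: eq_mmap => // c; rewrite /= mmapC.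
rewrite -Edh in dv.
have gpz w : (homogenise F).@[w] = 0 -> g.@[fun i => (tnth psi i).@[w]] = 0.
  move=> /(dehom_divides_vanishes F_neq0 hgp dv) <-.
  by rewrite /meval rmorph_mmap; apply: eq_mmap => // c; rewrite /= mmapC.
have [y [q [Fy yq]]] := psi_defined; have [Mq [phi phiM qy]] := psi_model Fy yq.
have hq := hcoords_coords q; have hy := hcoords_coords y.
have /(sends_hcoords _ psi_degree hy)/(hcoords_neq0 (u := fun i => _))[l nl] := yq.
have phid := ns_map_homog phiM; have [e he] := phid.
have /(sends_hcoords _ phid hq) hphi := qy.
have /(hcoords_neq0 (u := fun i => _))[k nk] := hphi.
pose h := tnth phi k * comp3 phi (tnth psi l).
have hh : h \is (e + D * e)%N.-homog by apply: dhomogM => //; apply: dhomog_mmap.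
have [] // := (ns_irreducible M).2 _ _ _ _ hh hg.
  apply: (vanish_onP (dhomogM hh hg)) => x u xu Mx; rewrite 2!mevalM.
  have [/hcoords_exists[y' hy']|->] := fun_eq0_or (fun j => (tnth phi j).@[u]); last first.
    by rewrite !mul0r.
  have Ec j : (comp3 phi (tnth psi j)).@[u] = (tnth psi j).@[fun m => (tnth phi m).@[u]].
    exact: mmap_comp3.
  rewrite Ec.
  have sy := ns_map_sends phiM xu hy'.
  have [/hcoords_exists[x' hx']|->] :=
    fun_eq0_or (fun j => (tnth psi j).@[fun m => (tnth phi m).@[u]]); last first.
    by rewrite mulr0 mul0r.
  have Ex : x' = x.
    by apply: (psi_inverse Mx sy); apply/(sends_hcoords _ psi_degree hy').
  rewrite Ex in hx'.
  suff -> : g.@[u] = 0 by rewrite mulr0.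
  apply: (meval_hcoords0 hg hx' xu); apply: gpz.
  exact/(vanishes_hcoords (homogenise_homog F) hy')/(ns_map_curve Mx).
move=> /(_ q Mq)/(vanishes_hcoords hh hq)/eqP; rewrite mevalM mulf_eq0 => /orP[E|].
  by move: nk; rewrite E.
have -> : (comp3 phi (tnth psi l)).@[coords q 0]
   = (tnth psi l).@[fun m => (tnth phi m).@[coords q 0]] by apply: mmap_comp3.
by move=> /eqP/(meval_hcoords0 (hD l) hphi hy) E; move: nl; rewrite E eqxx.
Qed.

End Generic.

Lemma avoid_two (L : fieldType) (T : zmodType) (S : T -> Prop) (e1 e2 : T -> L) :
  (forall a b, S a -> S b -> S (a + b)) ->
  {morph e1 : a b / a + b} -> {morph e2 : a b / a + b} ->
  (exists2 a, S a & e1 a != 0) -> (exists2 a, S a & e2 a != 0) ->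
  exists a, [/\ S a, e1 a != 0 & e2 a != 0].
Proof.
move=> SD D1 D2 [a Sa a1] [b Sb b2].
have [a2|a2] := eqVneq (e2 a) 0; last by exists a.
have [b1|b1] := eqVneq (e1 b) 0; last by exists b.
by exists (a + b); rewrite D1 D2 a2 b1 addr0 add0r; split=> //; apply: SD.
Qed.

Lemma separating_form (L : fieldType) n (p q : pspace L n) r s :
  p <> q -> hcoords p r -> hcoords q s ->
  exists2 g : {mpoly L[n.+1]}, g \is 1.-homog /\ g.@[r] = 0 & g.@[s] != 0.
Proof.
move=> pq pr qs; apply: contrapT => ns; apply: pq; apply: (hcoords_eq _ qs).
apply: (hcoords_minors pr (hcoords_neq0 qs)) => i k; apply/eqP; rewrite -subr_eq0.
apply/negPn/negP => nz; apply: ns; exists (r i *: 'X_k - r k *: 'X_i); last first.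
  by rewrite mevalB !mevalZ !mevalXU.
split; last by rewrite mevalB !mevalZ !mevalXU mulrC subrr.
by apply: rpredB; apply: rpredZ; apply: dhomogXU.
Qed.

Section Residue.
Variables (L K : closedFieldType) (iota : {rmorphism L -> K}) (n : nat).
Variables (t : 'I_n -> K) (r : 'I_n -> L).
Hypothesis tr : forall d (g : {mpoly L[n]}), g \is d.-homog -> mmap iota t g = 0 -> g.@[r] = 0.

(** The local ring of the model at [r], embedded in [K] by the generic point [t]: the element
    [k = g(t) / h(t)] has residue [a = g(r) / h(r)]. *)
Definition residue_at k a := exists d (g h : {mpoly L[n]}),
  [/\ g \is d.-homog, h \is d.-homog, h.@[r] != 0,
      k * mmap iota t h = mmap iota t g & a * h.@[r] = g.@[r]].

Lemma residue_at0 a : residue_at 0 a -> a = 0.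
Proof.
move=> [d [g [h [hg hh h0]]]]; rewrite mul0r => /esym/(tr hg) -> /eqP.
by rewrite mulf_eq0 (negPf h0) orbF => /eqP.
Qed.

Lemma residue_atC a : residue_at (iota a) a.
Proof.
exists 0%N, a%:MP, 1; rewrite meval1 mevalC rmorph1 /= mmapC !mulr1 oner_neq0.
rewrite dhomog1; split=> //; rewrite -[a%:MP]mulr1 mul_mpolyC rpredZ ?dhomog1 //.
Qed.

Lemma residue_atD k l a b : residue_at k a -> residue_at l b -> residue_at (k + l) (a + b).
Proof.
move=> [d [g [h [hg hh h0 Ek Ea]]]] [d' [g' [h' [hg' hh' h'0 Ek' Ea']]]].
exists (d + d')%N, (g * h' + h * g'), (h * h'); split.
- by apply: rpredD; apply: dhomogM.
- exact: dhomogM.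
- by rewrite mevalM mulf_neq0.
- by rewrite mmapD !rmorphM /= -Ek -Ek'; ring.
- by rewrite mevalD !mevalM -Ea -Ea'; ring.
Qed.

Lemma residue_atM k l a b : residue_at k a -> residue_at l b -> residue_at (k * l) (a * b).
Proof.
move=> [d [g [h [hg hh h0 Ek Ea]]]] [d' [g' [h' [hg' hh' h'0 Ek' Ea']]]].
exists (d + d')%N, (g * g'), (h * h'); split.
- exact: dhomogM.
- exact: dhomogM.
- by rewrite mevalM mulf_neq0.
- by rewrite !rmorphM /= -Ek -Ek'; ring.
- by rewrite !mevalM -Ea -Ea'; ring.
Qed.

Lemma residue_atV k a : residue_at k a -> a != 0 -> residue_at k^-1 a^-1.
Proof.
move=> ka a0; have k0 : k != 0.
  by apply: contraNneq a0 => k0; apply/eqP/residue_at0; rewrite -k0.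
have [d [g [h [hg hh h0 Ek Ea]]]] := ka.
by exists d, h, g; split=> //; rewrite -?Ek -?Ea ?mulKf ?mulf_neq0.
Qed.

End Residue.

Section OverOriginCenter.
Variables (L K : closedFieldType) (iota : {rmorphism L -> K}) (V : residue_ring iota).
Notation R := (vring V).
Notation res := (@vres L K iota V).
Notation vv := (@vval L K iota V).
Notation cst := (@vconst L K iota V).
Variables (F : {mpoly L[2]}) (M : nonsingular_model F).
Notation N := (ns_dim M).
Notation X := ('X_ord0 : {mpoly L[2]}).
Notation Y := ('X_ord_max : {mpoly L[2]}).
Variable psi : N.+1.-tuple {mpoly L[3]}.
Hypothesis psi_degree : same_degree psi.
Hypothesis psi_defined : exists y x, vanishes (homogenise F) y /\ sends psi y x.
Hypothesis psi_model : forall y x, vanishes (homogenise F) y -> sends psi y x ->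
  zeros (ns_eqs M) x /\ mor_sends (ns_map M) x y.
Hypothesis psi_inverse : forall x y x', zeros (ns_eqs M) x ->
  mor_sends (ns_map M) x y -> sends psi y x' -> x' = x.
Variables (u0 u1 u2 : {mpoly L[2]}) (eta1 eta2 : {fps L}).
Hypothesis irrF : irreducible_elt F.
Hypothesis EF : F = Y ^+ 2 * u0 + X * Y * u1 + X ^+ 2 * u2.
Hypothesis eta10 : eta1 0%N = 0.
Hypothesis eta20 : eta2 0%N = 0.
Hypothesis eta1F : subst_series eta1 F = 0.
Hypothesis eta2F : subst_series eta2 F = 0.
Hypothesis c0_neq0 : u0.@[fun=> 0] != 0.
Hypothesis eta_neq : eta1 1%N != eta2 1%N.
Notation pa := (psia psi).
Notation pull := (mmap (@mpolyC 2 L) pa).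

Lemma center_pull eta m p d (g : {mpoly L[N.+1]}) : center_at psi eta m p ->
  g \is d.-homog ->
  (forall k, (k < m * d)%N -> subst_series eta (pull g) k = 0) /\
  subst_series eta (pull g) (m * d) = g.@[fun i => subst_series eta (pa i) m].
Proof.
move=> [_ low] hg.
have /choice[f Ef] i : exists f, subst_series eta (pa i) = fpsX ^+ m * f.
  by apply/fps_lowP => k; apply: low.
have E : subst_series eta (pull g) = fpsX ^+ (m * d) * mmap (@fpsC L) f g.
  rewrite subst_seriesE exprM -(mmap_dhomog _ _ _ hg) rmorph_mmap.
  by apply: eq_mmap => [c|i]; rewrite /= ?mmapC // -subst_seriesE Ef.
rewrite E; split=> [k km|]; rewrite fps_coefXnM ?km // ltnn subnn.
rewrite -[LHS]/(@fps_at0 L _) rmorph_mmap; apply: eq_mmap => // i.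
by rewrite Ef fps_coefXnM ltnn subnn.
Qed.

Lemma over_origin_center m1 m2 p1 p2 p :
  center_at psi eta1 m1 p1 -> center_at psi eta2 m2 p2 ->
  branch_centred_at (M := M) (origin L 2) p -> p = p1 \/ p = p2.
Proof.
move=> cp1 cp2 [Mp [phi phiM po]].
have [|np1] := EM (p = p1); first by left.
have [|np2] := EM (p = p2); first by right.
exfalso.
have r1 := slope_root EF eta10 eta1F; have r2 := slope_root EF eta20 eta2F.
have eta_neq' : eta2 1%N != eta1 1%N by rewrite eq_sym.
have pr := hcoords_coords p; set r := coords p 0 in pr.
have [i0 ri0] := hcoords_neq0 pr.
have [rm rl] := mor_origin phiM pr po.
(* [g] vanishes at [p] but at neither centre: a sum of two separating linear forms when neither form
   alone will do. *)
have [g [[hg gr] g1 g2]] : exists g : {mpoly L[N.+1]}, [/\ g \is 1.-homog /\ g.@[r] = 0,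
    g.@[fun i => subst_series eta1 (pa i) m1] != 0 &
    g.@[fun i => subst_series eta2 (pa i) m2] != 0].
  apply: avoid_two.
  - move=> a b [ha ar] [hb br]; split; first exact: rpredD.
    by rewrite mevalD ar br addr0.
  - exact: mevalD.
  - exact: mevalD.
  - exact: separating_form np1 pr cp1.1.
  - exact: separating_form np2 pr cp2.1.
(* A near point of the first branch supplies a generic point [t] of the model over [L]; only its
   genericity matters, the reduction of interest being the one at [p]. *)
have [x vx0 rx] := vring_infinitesimal V.
have x0 : x <> 0 by move=> E; rewrite E rmorph0 eqxx in vx0.
have [z nb] := near_branch_exists irrF EF eta10 eta1F c0_neq0 r2 eta_neq rx.
have [t [tE rt]] := center_lift EF eta10 eta1F c0_neq0 r2 eta_neq cp1 nb.
have tr d (f : {mpoly L[N.+1]}) : f \is d.-homog -> mmap iota (vv \o t) f = 0 -> f.@[r] = 0.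
  move=> hf; rewrite -vv_mmap => /eqP; rewrite vval_eq0 => /eqP f0.
  have F0 : F != 0 by have [] := irrF.
  apply/(vanishes_hcoords hf pr).
  apply: (pullback_vanish psi_degree psi_defined psi_model psi_inverse F0 hf _ Mp).
  apply: (near_branch_generic irrF EF eta10 eta1F c0_neq0 r2 eta_neq nb x0).
  by rewrite (mmap_psia_lift tE hf) f0 mulr0.
have ti0 : t i0 <> 0.
  move=> E; move: ri0; have <- : ('X_i0 : {mpoly L[N.+1]}).@[r] = r i0 by exact: mevalXU.
  by rewrite (tr 1%N) ?eqxx ?dhomogXU // mmapXU /= E rmorph0.
have Gxz : mmap cst (xy x z) (strict_transform u0 u1 u2) = 0 by case: nb.
have paE : pull 'X_i0 = pa i0 by rewrite mmapXU.
have quo (eta : {fps L}) a' m q : eta 0%N = 0 -> subst_series eta F = 0 ->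
    u0.@[fun=> 0] * a' ^+ 2 + u1.@[fun=> 0] * a' + u2.@[fun=> 0] = 0 ->
    eta 1%N != a' -> center_at psi eta m q ->
    g.@[fun i => subst_series eta (pa i) m] != 0 ->
    exists2 DQ : {mpoly L[2]} * {mpoly L[2]},
      t i0 * mmap cst (xy x z) DQ.1 = mmap cst t g * mmap cst (xy x z) DQ.2 &
      DQ.1.@[xy 0 (eta 1%N)] != 0.
  move=> e0 eF ra en cq gq.
  have [low1 _] := center_pull cq (dhomogXU L i0).
  have [low2 Eg] := center_pull cq hg.
  have gq' : subst_series eta (pull g) (m * 1) != 0 by rewrite Eg.
  have [D [Q [D0 DQ]]] := local_quotient EF e0 eF c0_neq0 ra en low1 low2 gq'.
  exists (D, Q) => //=; have := DQ _ _ V x z x0 Gxz.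
  rewrite (mmap_psia_lift tE hg) (mmap_psia_lift tE (dhomogXU L i0)) mmapXU.
  by rewrite !expr1 -!mulrA => /(vring_expI x0).
(* The inverse of the function [g / 'X_i0] equals [Q / D]. The set of pairs [(D, Q)] is closed under
   sums, so the denominators obtained from the two branches combine into one nonzero at both
   slopes. *)
have [[D Q] [/= EDQ D1 D2]] : exists DQ : {mpoly L[2]} * {mpoly L[2]},
    [/\ t i0 * mmap cst (xy x z) DQ.1 = mmap cst t g * mmap cst (xy x z) DQ.2,
      DQ.1.@[xy 0 (eta1 1%N)] != 0 & DQ.1.@[xy 0 (eta2 1%N)] != 0].
  apply: (@avoid_two L _ (fun DQ : {mpoly L[2]} * {mpoly L[2]} =>
    t i0 * mmap cst (xy x z) DQ.1 = mmap cst t g * mmap cst (xy x z) DQ.2)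
    (fun DQ => DQ.1.@[xy 0 (eta1 1%N)]) (fun DQ => DQ.1.@[xy 0 (eta2 1%N)])).
  - by move=> [a b] [a' b'] /= E E'; rewrite !mmapD !mulrDr E E'.
  - by move=> a b; apply: mevalD.
  - by move=> a b; apply: mevalD.
  - exact: quo eta10 eta1F r2 eta_neq cp1 g1.
  - exact: quo eta20 eta2F r1 eta_neq' cp2 g2.
pose Rp := residue_at iota (vv \o t) r.
have phit i := center_phi psi_degree psi_defined psi_model irrF EF eta1F nb x0 tE i phiM.
have [d hd] := ns_map_homog phiM.
have Rphi i : Rp (vv (xy x (x * z) i)) 0.
  exists d, (tnth phi (lift ord_max i)), (tnth phi ord_max); split=> //.
    rewrite -!vv_mmap -rmorphM [in RHS](phit (lift ord_max i)) /hpoint liftK mul1r.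
    by rewrite [in LHS]mulrC.
  by rewrite rl mul0r.
have Rp0 := residue_at0 tr; have RpC := residue_atC iota (vv \o t) r.
have RpD := @residue_atD _ _ iota _ (vv \o t) r; have RpM := @residue_atM _ _ iota _ (vv \o t) r.
have RpV := residue_atV tr.
have Rxy (u : {mpoly L[2]}) : Rp (mmap iota (vv \o xy x (x * z)) u) u.@[fun=> 0].
  exact: (Rp_mmap RpC RpD RpM).
(* The element [w = g(t) / t_i0] has residue 0 at [p], and [D(x, z) = w Q(x, z)]. *)
apply: (place_node Rp0 RpC RpD RpM RpV (Rphi ord0) (Rxy u0) (Rxy u1) (Rxy u2) (z := vv z)
   (a1 := eta1 1%N) (a2 := eta2 1%N) (w := vv (mmap cst t g) / vv (t i0)) (D := D) (Q := Q)) => //.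
- rewrite -!vv_mmap !expr2 -!rmorphM -!rmorphD /= -expr2.
  by apply/eqP; rewrite vval_eq0 -mmap_G Gxz.
- by move=> b; apply: (slope_factor EF eta10 eta1F r2 eta_neq).
- exists 1%N, g, 'X_i0; rewrite mevalXU mmapXU mul0r gr; split=> //; first exact: dhomogXU.
  by rewrite divfK ?vv_mmap // vval_eq0; apply/eqP.
have vt0 : vv (t i0) != 0 by rewrite vval_eq0; apply/eqP.
apply: (mulfI vt0).
have ev f : mmap iota (xy (vv (xy x (x * z) ord0)) (vv z)) f = vv (mmap cst (xy x z) f).
  by rewrite vv_mmap; apply: eq_mmap => // i; rewrite comp_xy.
by rewrite !ev -rmorphM EDQ rmorphM mulrA mulrCA mulfV // mulr1.
Qed.

End OverOriginCenter.

(** * Matching near zeros with the points of one branch *)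

Section Card.
Variables (L K : closedFieldType) (iota : {rmorphism L -> K}) (V : residue_ring iota).
Notation R := (vring V).
Notation res := (@vres L K iota V).
Notation vv := (@vval L K iota V).
Notation cst := (@vconst L K iota V).
Variables (F : {mpoly L[2]}) (M : nonsingular_model F).
Notation N := (ns_dim M).
Notation X := ('X_ord0 : {mpoly L[2]}).
Notation Y := ('X_ord_max : {mpoly L[2]}).
Variable psi : N.+1.-tuple {mpoly L[3]}.
Hypothesis psi_degree : same_degree psi.
Hypothesis psi_defined : exists y x, vanishes (homogenise F) y /\ sends psi y x.
Hypothesis psi_model : forall y x, vanishes (homogenise F) y -> sends psi y x ->
  zeros (ns_eqs M) x /\ mor_sends (ns_map M) x y.
Hypothesis psi_inverse : forall x y x', zeros (ns_eqs M) x ->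
  mor_sends (ns_map M) x y -> sends psi y x' -> x' = x.
Variables (u0 u1 u2 : {mpoly L[2]}) (eta eta' : {fps L}).
Hypothesis irrF : irreducible_elt F.
Hypothesis EF : F = Y ^+ 2 * u0 + X * Y * u1 + X ^+ 2 * u2.
Hypothesis eta0 : eta 0%N = 0.
Hypothesis eta'0 : eta' 0%N = 0.
Hypothesis etaF : subst_series eta F = 0.
Hypothesis eta'F : subst_series eta' F = 0.
Hypothesis c0_neq0 : u0.@[fun=> 0] != 0.
Hypothesis eta_neq : eta 1%N != eta' 1%N.
Notation pa := (psia psi).
Notation near eta := (near_branch (V := V) (strict_transform u0 u1 u2) (slope_series eta)).

Variables (m m' : nat) (p p' : pspace L N).
Hypothesis cp : center_at psi eta m p.
Hypothesis cp' : center_at psi eta' m' p'.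

Variables (e : nat) (h : {mpoly K[3]}) (s : seq (R * R)).
Hypothesis hom_h : h \is e.-homog.
Hypothesis h_origin : h.@[hpoint (xy 0 0) 1] != 0.
Hypothesis sP : forall x z, (x, z) \in s <->
  near eta x z /\ h.@[hpoint (xy (vv x) (vv (x * z))) 1] = 0.
Hypothesis uniq_s : uniq s.

Let r1 := slope_root EF eta0 etaF.
Let r2 := slope_root EF eta'0 eta'F.

(** A zero with [x = 0] would lie over the origin, where [h] does not vanish. This keeps the zeros
    away from the only point where the correspondence with the model fails. *)
Lemma zeros_abscissa x z : (x, z) \in s -> x <> 0.
Proof.
move=> /sP[_ hx] x0; case/eqP: h_origin; apply: etrans hx; apply: meval_eq => i.
by rewrite x0 mul0r rmorph0.
Qed.

Lemma zero_point x z : (x, z) \in s ->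
  exists t, [/\ forall i, mmap cst (xy x (x * z)) (pa i) = x ^+ m * t i,
    on_model (M := M) cst t, hcoords p (res \o t) &
    forall phi i, phi \in ns_map M ->
     mmap cst t (tnth phi i) = mmap cst t (tnth phi ord_max) * hpoint (xy x (x * z)) 1 i].
Proof.
move=> xzs; have x0 := zeros_abscissa xzs; have [nb _] := (sP x z).1 xzs.
have [t [tE rt]] := center_lift EF eta0 etaF c0_neq0 r2 eta_neq cp nb.
have Mt := center_on_model psi_degree psi_defined psi_model irrF EF etaF nb x0 tE.
have pt := center_lift_hcoords cp rt.
exists t; split=> // phi i phiM.
have := center_phi psi_degree psi_defined psi_model irrF EF etaF nb x0 tE i phiM.
exact.
Qed.

Lemma residue_coords n (t : 'I_n.+1 -> R) (q : pspace L n) :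
  hcoords q (res \o t) -> exists i, vv (t i) != 0.
Proof.
move=> qt; have [i ri] := hcoords_neq0 qt; exists i; rewrite vval_eq0.
by apply: contraNneq ri => E; rewrite /= E rmorph0.
Qed.

Lemma origin_phi : exists2 phi, phi \in ns_map M &
  forall t, hcoords p (res \o t) -> vv (mmap cst t (tnth phi ord_max)) != 0.
Proof.
have [Mp [phi phiM po]] := center_branch V psi_degree psi_defined psi_model
   irrF EF eta0 etaF c0_neq0 r2 eta_neq cp.
exists phi => // t pt; have [rm _] := mor_origin phiM pt po.
by rewrite vval_eq0; apply: contraNneq rm => E; rewrite -res_mmap E rmorph0.
Qed.

Definition point_of (xz : R * R) (q : pspace K N) :=
  exists2 t, (forall i, mmap cst (xy xz.1 (xz.1 * xz.2)) (pa i) = xz.1 ^+ m * t i) &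
    hcoords q (vv \o t).

Lemma point_of_exists xz : xz \in s -> exists q, point_of xz q.
Proof.
case: xz => x z xzs; have [t [tE _ pt _]] := zero_point xzs.
by have [q qt] := hcoords_exists (residue_coords pt); exists q, t.
Qed.

Lemma hpoint_vv x y : vv \o hpoint (xy x y) 1 =1 hpoint (xy (vv x) (vv y)) 1.
Proof. by move=> i; rewrite comp_hpoint rmorph1; apply: hpoint_ext => j; rewrite comp_xy. Qed.

Lemma point_of_branch xz q : xz \in s -> point_of xz q ->
  branch_intersection iota (rr_pred V) (M := M) p h q.
Proof.
case: xz => x z xzs [t' t'E qt'].
have [t [tE Mt pt phit]] := zero_point xzs.
have x0 := zeros_abscissa xzs.
have {}qt : hcoords q (vv \o t).
  apply: hcoords_ext qt' => i /=; congr vv; apply: (vring_expI (m := m) x0).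
  by rewrite -tE -t'E.
split; first split.
- by apply/(ns_pointP iota qt)/on_model_vv.
- by apply/(specialisesP V q pt); exists t.
have [phi phiM phi0] := origin_phi; have {}phi0 := phi0 t pt.
pose w i := mmap iota (vv \o t) (tnth phi i).
have Ew i : w i = vv (mmap cst t (tnth phi ord_max)) * hpoint (xy (vv x) (vv (x * z))) 1 i.
  by rewrite /w -vv_mmap phit // rmorphM -hpoint_vv.
have [y hy] : exists y, hcoords y w.
  by apply: hcoords_exists; exists ord_max; rewrite Ew /hpoint unlift_none mulr1.
exists y; first by apply/(ns_sendsP iota y qt); exists phi.
apply/(vanishes_hcoords hom_h hy); rewrite (meval_eq _ Ew) /meval (mmap_dhomog _ _ _ hom_h).
by have [_ /= E] := (sP x z).1 xzs; rewrite -/(meval _ _) E mulr0.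
Qed.

(** The morphism recovers [(x, x z)] from [q], and [x <> 0] then recovers [z]. *)
Lemma point_of_inj xz xz' q : xz \in s -> xz' \in s ->
  point_of xz q -> point_of xz' q -> xz = xz'.
Proof.
case: xz => x z; case: xz' => x' z' xzs xzs' [t tE qt] [t' t'E qt'].
have [phi phiM phi0] := origin_phi; have [d hd] := ns_map_homog phiM.
have get y w u : (y, w) \in s -> hcoords q (vv \o u) ->
    (forall i, mmap cst (xy y (y * w)) (pa i) = y ^+ m * u i) ->
    vv (mmap cst u (tnth phi ord_max)) != 0 /\
    forall i, mmap iota (vv \o u) (tnth phi i)
      = mmap iota (vv \o u) (tnth phi ord_max) * hpoint (xy (vv y) (vv (y * w))) 1 i.
  move=> yws qu uE; have [v [vE _ pv phiv]] := zero_point yws.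
  have y0 := zeros_abscissa yws.
  have uv : u =1 v by move=> i; apply: (vring_expI (m := m) y0); rewrite -uE -vE.
  have ep f : mmap cst u f = mmap cst v f by apply: eq_mmap.
  split; first by rewrite ep; apply: phi0.
  by move=> i; rewrite -!vv_mmap !ep phiv // rmorphM -hpoint_vv.
have [n1 E1] := get _ _ _ xzs qt tE; have [n2 E2] := get _ _ _ xzs' qt' t'E.
have [k k0 Ek] := hcoords_uniq qt qt'.
have Ep i : mmap iota (vv \o t') (tnth phi i) = k ^+ d * mmap iota (vv \o t) (tnth phi i).
  by rewrite -(mmap_dhomog _ _ _ (hd i)); apply: eq_mmap.
have Eh i : hpoint (xy (vv x') (vv (x' * z'))) 1 i = hpoint (xy (vv x) (vv (x * z))) 1 i.
  have := E2 i; rewrite !Ep E1 -!mulrA => /(mulfI (expf_neq0 d k0)).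
  by rewrite vv_mmap in n1 => /(mulfI n1).
have := Eh (lift ord_max ord0); rewrite /hpoint liftK !mul1r {1 2}/xy /= => /vval_inj Ex.
have := Eh (lift ord_max ord_max); rewrite /hpoint liftK !mul1r {1 2}/xy /= => /vval_inj.
rewrite Ex => /(vring_expI (m := 1) (zeros_abscissa xzs)) -> //.
Qed.

Lemma proportional_residue n (t u : 'I_n.+1 -> R) (a b : pspace L n) :
  hcoords a (res \o t) -> hcoords b (res \o u) -> (forall i k, t i * u k = t k * u i) -> a = b.
Proof.
move=> ta ub tu; apply: (hcoords_eq _ ub).
apply: (hcoords_minors ta (hcoords_neq0 ub)) => i k.
by rewrite /= -!rmorphM tu.
Qed.

(** The plane image of [q] is infinitely near the double point with [x <> 0], so it comes from one
    of the two branches of [G]; [psi] recovers [q] from it. *)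
Lemma branch_point_of q : branch_intersection iota (rr_pred V) (M := M) p h q ->
  exists2 xz, xz \in s & point_of xz q.
Proof.
move=> [[Mq sq] [y qy hy]].
have [t qt rt] := (specialisesP V q (hcoords_coords p)).1 sq.
have pt : hcoords p (res \o t).
  by apply: hcoords_ext (hcoords_coords p) => i; rewrite /= rt.
have Mt : on_model (M := M) cst t by apply/on_model_vv/(ns_pointP iota qt).
have cb := center_branch V psi_degree psi_defined psi_model
   irrF EF eta0 etaF c0_neq0 r2 eta_neq cp.
have [phi [x [y' [lo rx ry Fxy]]]] := model_over_origin Mt pt cb.
have [phiM rm EP] := lo.
have [phi' phiM' hy'] := (ns_sendsP iota y qt).1 qy.
have h0 : h.@[hpoint (xy (vv x) (vv y')) 1] = 0.
  have vm : vv (mmap cst t (tnth phi ord_max)) != 0.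
    by rewrite vval_eq0; apply: contraNneq rm => ->; rewrite rmorph0.
  have yh : hcoords y (hpoint (xy (vv x) (vv y')) 1).
    apply: (hcoords_minors hy'); first by exists ord_max; rewrite /hpoint unlift_none oner_neq0.
    move=> i k; apply: (mulfI vm).
    have [d hd] := ns_map_homog phiM; have [d' hd'] := ns_map_homog phiM'.
    have Hh : tnth phi' i * tnth phi k - tnth phi' k * tnth phi i \is (d' + d)%N.-homog.
      by apply: rpredB; apply: dhomogM.
    have := congr1 vv (vanish_on_transfer Hh (model_agree i k phiM' phiM) Mt).
    rewrite rmorph0 mmapB !rmorphM /= (EP i) (EP k) rmorphB !rmorphM /= !vv_mmap.
    rewrite -!hpoint_vv /= => /subr0_eq E.
    by rewrite mulrCA E mulrCA.
  exact/(vanishes_hcoords hom_h yh).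
(* For [x = 0] the equation of [F] reduces to [y^2 U0 = 0] with [U0] a unit, so the image would be
   the origin, which [h] avoids. *)
have x0 : x <> 0.
  move=> Ex; have : y' ^+ 2 * mmap cst (xy x y') u0 = 0.
    rewrite -[RHS]Fxy EF !expr2 !mmapD !rmorphM /= !mmapXU.
    by rewrite {2 4 6}/xy /= Ex !mul0r !addr0.
  have U0 : mmap cst (xy x y') u0 <> 0.
    move=> /(congr1 res); rewrite (rmorph_mmap_xy _ (@vres _ _ _ V)) /= rx ry rmorph0 => E.
    case/eqP: c0_neq0; apply: etrans E; apply: eq_mmap => [a|i]; first by rewrite /= vres_const.
    by rewrite /xy; case: (i == ord0).
  rewrite expr2; case/vring_mulf0=> // /vring_mulf0 y0; have {}y0 : y' = 0 by case: y0.
  by case/eqP: h_origin; apply: etrans h0; rewrite Ex y0 !rmorph0.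
have fac := slope_factor EF eta0 etaF r2 eta_neq.
have [z [Ey nb]] := node_dichotomy EF fac c0_neq0 rx ry x0 Fxy.
have minors a (u : 'I_N.+1 -> R) : (forall i, mmap cst (xy x (x * z)) (pa i) = x ^+ a * u i) ->
    forall i k, t i * u k = t k * u i.
  move=> uE i k; have := model_inverse_pt psi_degree psi_inverse i k Mt lo.
  rewrite Ey !uE -!mulrA => /(vring_expI x0) E.
  by rewrite mulrC -E mulrC.
case: nb => nb.
  exists (x, z); first by apply/sP; rewrite -Ey.
  have [u [uE ru]] := center_lift EF eta0 etaF c0_neq0 r2 eta_neq cp nb.
  exists u => //; apply: (hcoords_minors qt).
    exact: residue_coords (center_lift_hcoords cp ru).
  by move=> i k; rewrite /= -!rmorphM (minors _ _ uE).
(* On the other branch [q] would specialise to [p'] as well as to [p], but the centres differ. *)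
have eta_neq' : eta' 1%N != eta 1%N by rewrite eq_sym.
have [u [uE ru]] := center_lift EF eta'0 eta'F c0_neq0 r1 eta_neq' cp' nb.
have := proportional_residue pt (center_lift_hcoords cp' ru) (minors _ _ uE).
move/eqP; rewrite (negPf (centers_neq V psi_degree psi_defined psi_model irrF EF
  eta0 eta'0 etaF eta'F c0_neq0 eta_neq cp cp')) //.
Qed.

Lemma branch_intersection_card :
  has_card (branch_intersection iota (rr_pred V) (M := M) p h) (size s).
Proof.
have /choice[g gP] xz : exists q, xz \in s -> point_of xz q.
  have [xzs|xzs] := boolP (xz \in s); last first.
    by exists (origin K N).
  by have [q qP] := point_of_exists xzs; exists q.
exists (map g s); split; last 1 first.
- move=> q; split=> [/mapP[xz xzs ->]|/branch_point_of[xz xzs xzq]].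
    exact: point_of_branch xzs (gP _ xzs).
  apply/mapP; exists xz => //; case: xzq => t tE qt; have [t' t'E qt'] := gP _ xzs.
  apply: (hcoords_eq qt); apply: hcoords_ext qt' => i /=; congr vv.
  have x0 : xz.1 <> 0 by case: xz xzs {tE t'E} => x z /zeros_abscissa.
  by apply: (vring_expI (m := m) x0); rewrite -tE -t'E.
- rewrite map_inj_in_uniq // => a b sa sb E.
  by apply: (point_of_inj sa sb (gP _ sa)); rewrite E; apply: gP.
- exact: size_map.
Qed.

End Card.

(** * Generic members of a linear system *)

Section FractionSubfield.
Variables (A : comNzRingType) (E : fieldType) (ev : {rmorphism A -> E}).

(** The field of fractions of the image of [A], taken inside [E], so that the closure properties of
    integral elements over a field apply. *)
Definition is_fraction : {pred E} :=
  [pred x | `[< exists p q, ev q != 0 /\ x * ev q = ev p >]].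

Lemma is_fractionP x : reflect (exists p q, ev q != 0 /\ x * ev q = ev p) (x \in is_fraction).
Proof. exact: asboolP. Qed.

Fact is_fraction_divring : divring_closed is_fraction.
Proof.
split=> [|x y|x y].
- by apply/is_fractionP; exists 1, 1; rewrite rmorph1 oner_neq0 mul1r.
- move=> /is_fractionP[p [q [q0 Ex]]] /is_fractionP[p' [q' [q'0 Ey]]].
  apply/is_fractionP; exists (p * q' - p' * q), (q * q').
  by rewrite rmorphB !rmorphM mulf_neq0 // -Ex -Ey; split=> //; ring.
- move=> /is_fractionP[p [q [q0 Ex]]] /is_fractionP[p' [q' [q'0 Ey]]].
  apply/is_fractionP; have [->|y0] := eqVneq y 0.
    by exists 0, 1; rewrite rmorph1 oner_neq0 invr0 mulr0 mul0r rmorph0.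
  have p'0 : ev p' != 0 by rewrite -Ey mulf_neq0.
  exists (p * q'), (q * p'); rewrite !rmorphM mulf_neq0 //; split=> //.
  by rewrite -Ex -Ey; field.
Qed.

HB.instance Definition _ := GRing.isDivringClosed.Build E is_fraction is_fraction_divring.

Definition fraction_field := {x : E | x \in is_fraction}.

HB.instance Definition _ := SubChoice.on fraction_field.
HB.instance Definition _ := [SubChoice_isSubComUnitRing of fraction_field by <:].
HB.instance Definition _ := [SubComUnitRing_isSubIntegralDomain of fraction_field by <:].
HB.instance Definition _ := [SubIntegralDomain_isSubField of fraction_field by <:].

Definition fraction_val (x : fraction_field) : E := \val x.
HB.instance Definition _ := GRing.RMorphism.copy fraction_val (\val : fraction_field -> E).

Lemma fraction_of_subproof a : ev a \in is_fraction.
Proof. by apply/is_fractionP; exists a, 1; rewrite rmorph1 oner_neq0 mulr1. Qed.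

Definition fraction_of a : fraction_field := exist _ (ev a) (fraction_of_subproof a).

Lemma fraction_ofE a : fraction_val (fraction_of a) = ev a. Proof. by []. Qed.

Lemma fraction_of0 : fraction_of 0 = 0.
Proof. by apply: val_inj; rewrite /= rmorph0. Qed.

Lemma clear_denominators (p : {poly fraction_field}) :
  exists d (q : {poly A}), ev d != 0 /\ map_poly ev q = ev d *: map_poly fraction_val p.
Proof.
elim/poly_ind: p => [|p c [d [q [d0 Eq]]]].
  by exists 1, 0; rewrite !rmorph0 scaler0 rmorph1 oner_neq0.
have /is_fractionP[a [b [b0 Ec]]] := valP c.
exists (d * b), (b *: (q * 'X) + (d * a)%:P); rewrite rmorphM mulf_neq0 //; split=> //.
rewrite rmorphD /= map_polyC /= map_polyZ !rmorphM /= map_polyX Eq.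
rewrite rmorphD rmorphM /= map_polyX map_polyC /= scalerDr -Ec.
by rewrite -!mul_polyC !rmorphM /=; ring.
Qed.

Lemma integral_fraction_root s : integralOver fraction_val s ->
  exists2 q : {poly A}, q != 0 & root (map_poly ev q) s.
Proof.
move=> [p /monic_neq0 p0 ps]; have [d [q [d0 Eq]]] := clear_denominators p.
exists q; last by rewrite Eq rootZ.
apply: contraNneq p0 => q0; move: Eq; rewrite q0 rmorph0 => /esym/eqP.
by rewrite scaler_eq0 (negPf d0) map_poly_eq0.
Qed.

Lemma root_integral_fraction (q : {poly A}) s : injective ev -> q != 0 ->
  root (map_poly ev q) s -> integralOver fraction_val s.
Proof.
move=> ev_inj q0 qs; apply/integral_algebraic.
have Eq : map_poly fraction_val (map_poly fraction_of q) = map_poly ev q.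
  by apply/polyP => i; rewrite !coef_map_id0 ?rmorph0 ?fraction_of0.
exists (map_poly fraction_of q); last by rewrite Eq.
apply: contraNneq q0 => E0; move: Eq; rewrite E0 rmorph0 => /polyP Eq.
apply/eqP/polyP => i; have := Eq i; rewrite coef_map coef0 coef0 => /esym E1.
by apply: ev_inj; rewrite E1 rmorph0.
Qed.

End FractionSubfield.

Lemma bipoly_deriv (L : closedFieldType) (f : {mpoly L[2]}) :
  bipoly f^`M(ord_max) = (bipoly f)^`().
Proof.
elim/mpoly_ring_ind: f => [a|i|p q hp hq|p q hp hq].
- by rewrite mderivC rmorph0 bipolyC derivC.
- rewrite /bipoly mmapXU mderivXU /xy; case: (unliftP ord0 i) => [k|] ->.
    have -> : lift ord0 k = ord_max by apply: val_inj; rewrite /= ord1.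
    by rewrite eqxx derivX rmorph1.
  by rewrite eqxx derivC /= mmap0.
- by rewrite mderivD !rmorphD /= hp hq derivD.
- by rewrite mderivM rmorphD !rmorphM /= hp hq derivM.
Qed.

Section GenericIntersection.
Variables (L : closedFieldType) (E : fieldType) (j : {rmorphism L -> E}).
Variables (r : nat) (w : 'I_r -> E).
Notation A := {mpoly L[r]}.
Notation ev := (mmap j w : {rmorphism A -> E}).
Hypothesis w_inj : injective (mmap j w).
Variable F : {mpoly L[2]}.
Hypothesis irrF : irreducible_elt F.
Hypothesis degF : (1 < size (bipoly F))%N.
Variables (x y : E) (delta : 'I_r -> {mpoly L[2]}) (g : 'I_r -> L).
Hypothesis Fxy : mmap j (xy x y) F = 0.
Hypothesis F'xy : mmap j (xy x y) F^`M(ord_max) != 0.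
Hypothesis delta_xy : \sum_k w k * mmap j (xy x y) (delta k) = 0.
Hypothesis delta_g : ~ divides F (\sum_k g k *: delta k).

Let lift_coef : {rmorphism {poly {poly L}} -> {poly {poly A}}} :=
  map_poly (map_poly (@mpolyC r L)).
Let at_point : {rmorphism {poly A} -> E} := horner_morph (fun a => mulrC x (ev a)).

Let lift_value f : (map_poly at_point (lift_coef (bipoly f))).[y] = mmap j (xy x y) f.
Proof.
rewrite mmap_bipoly -map_poly_comp; congr (_.[y]); apply: eq_map_poly => p.
rewrite /= /horner_morph -map_poly_comp; congr (_.[x]); apply: eq_map_poly => a.
by rewrite /= mmapC.
Qed.

Let W : {poly {poly A}} := \sum_k ('X_k : A)%:P%:P * lift_coef (bipoly (delta k)).
Let P := lift_coef (bipoly F).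
(** The second summand fixes the leading coefficient, so that the resultant with
    [P] commutes with specialisation. *)
Let Q := W + P * 'X^(size W).

Let P_lead : lead_coef P = map_poly (@mpolyC r L) (lead_coef (bipoly F)).
Proof. by rewrite lead_coef_map_inj ?rmorph0 //; apply: map_poly_inj. Qed.

Let P_size : size P = size (bipoly F).
Proof. by rewrite size_map_inj_poly ?rmorph0 //; apply: map_poly_inj. Qed.

Let sWQ : (size W < size (P * 'X^(size W) : {poly {poly A}})%R)%N.
Proof.
have P0 : P != 0 by rewrite -size_poly_gt0 P_size (leq_trans _ degF).
rewrite size_mulXn //.
by rewrite -[X in (X < _)%N]addn0 ltn_add2l P_size (leq_trans _ degF).
Qed.

Let Q_lead : lead_coef Q = lead_coef P.
Proof. by rewrite lead_coefDr // lead_coef_Mmonic ?monicXn. Qed.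

Let resultant_root : root (map_poly ev (resultant P Q)) x.
Proof.
have sP : (1 < size P)%N by rewrite P_size.
have sQ : (1 < size Q)%N.
  rewrite /Q addrC size_polyDl //; have P0 : P != 0 by rewrite -size_poly_gt0 ltnW.
  rewrite size_mulXn //.
  by rewrite (leq_trans sP) // leq_addl.
have [[a b] _ /= Eab] := resultant_in_ideal sP sQ.
have := congr1 (fun q => (map_poly at_point q).[y]) Eab.
rewrite map_polyC hornerC rmorphD !rmorphM rmorphD rmorphM /= map_polyXn.
rewrite hornerD !hornerM hornerD hornerM !lift_value Fxy !(mulr0, mul0r) add0r addr0.
have -> : (map_poly at_point W).[y] = 0.
  rewrite rmorph_sum horner_sum -[RHS]delta_xy; apply: eq_bigr => k _ /=.
  rewrite rmorphM hornerM lift_value /= map_polyC hornerC /= /horner_morph map_polyC hornerC.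
  by rewrite /= mmapXU.
by rewrite mulr0 => /rootP.
Qed.

(** Specialising the indeterminates to [g] yields the resultant of [F] with a polynomial congruent
    to [\sum_k g k *: delta k] modulo [F], which [F] does not divide. *)
Let resultant_neq0 : resultant P Q != 0.
Proof.
pose sg : {rmorphism A -> L} := meval g; pose f : {rmorphism {poly A} -> {poly L}} := map_poly sg.
have fC : cancel (map_poly (@mpolyC r L)) f.
  move=> p; rewrite /f /= -map_poly_comp map_poly_id // => a _.
  by rewrite /= mevalC.
have fl q : map_poly f (lift_coef q) = q.
  by rewrite /= -map_poly_comp map_poly_id // => a _; apply: fC.
have fP0 : f (lead_coef P) != 0.
  by rewrite P_lead fC lead_coef_eq0 -size_poly_gt0 (leq_trans _ degF).
have : f (resultant P Q) != 0.
  rewrite map_resultant ?Q_lead // fl.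
  have -> : map_poly f Q = bipoly (\sum_k g k *: delta k + F * 'X_ord_max ^+ size W).
    rewrite [RHS]rmorphD [X in _ = _ + X]rmorphM rmorphXn /= bipolyX1.
    rewrite [LHS]rmorphD [X in _ + X = _]rmorphM /= map_polyXn fl.
    congr (_ + _); rewrite !rmorph_sum; apply: eq_bigr => k _ /=.
    rewrite rmorphM /= fl !map_polyC /= -mul_mpolyC rmorphM /= bipolyC.
    by rewrite map_polyC /= mevalXU.
  apply/eqP => /(resultant0_divides irrF degF)[q Eq]; apply: delta_g.
  exists (q - 'X_ord_max ^+ size W); rewrite mulrBl -Eq.
  by rewrite [X in _ - X]mulrC addrK.
by apply: contraNneq => ->; rewrite rmorph0.
Qed.

(** The abscissa is a root of a nonzero resultant with coefficients in [L[w]]. The ordinate is a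
    root of [F(x, Y)], a nonzero polynomial because its derivative does not vanish at [y]. *)
Lemma generic_point_integral f : integralOver (@fraction_val A E ev) (mmap j (xy x y) f).
Proof.
have ix : integralOver (@fraction_val A E ev) x.
  exact: root_integral_fraction w_inj resultant_neq0 resultant_root.
have iC a : integralOver (@fraction_val A E ev) (j a).
  have -> : j a = fraction_val (fraction_of ev a%:MP) by rewrite fraction_ofE /= mmapC.
  exact: integral_id.
have ihx (p : {poly L}) : integralOver (@fraction_val A E ev) (map_poly j p).[x].
  apply: integral_horner => // a /(nthP 0)[i _ <-]; rewrite coef_map; exact: iC.
have iy : integralOver (@fraction_val A E ev) y.
  pose p := map_poly (horner_morph (fun a => mulrC x (j a))) (bipoly F).
  apply: (@integral_root _ _ _ p).
  - apply: contraNneq F'xy => p0.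
    by rewrite mmap_bipoly bipoly_deriv -deriv_map -/p p0 linear0 horner0.
  - by rewrite /root -mmap_bipoly Fxy.
  - by move=> a /(nthP 0)[i _ <-]; rewrite coef_map; apply: ihx.
elim/mpoly_ring_ind: f => [a|i|p q hp hq|p q hp hq].
- by rewrite mmapC; apply: iC.
- by rewrite mmapXU /xy; case: (i == ord0).
- by rewrite mmapD; apply: integral_add.
- by rewrite rmorphM; apply: integral_mul.
Qed.

Lemma generic_combination_algebraic (beta : 'I_r -> {mpoly L[2]}) :
  exists2 q : {poly A}, q != 0 & root (map_poly ev q) (\sum_k w k * mmap j (xy x y) (beta k)).
Proof.
apply: integral_fraction_root; apply: (big_ind (integralOver (@fraction_val A E ev))).
- exact: integral0.
- by move=> a b; apply: integral_add.
move=> k _; apply: integral_mul; last exact: generic_point_integral.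
have -> : w k = fraction_val (fraction_of ev 'X_k) by rewrite fraction_ofE /= mmapXU.
exact: integral_id.
Qed.

End GenericIntersection.

Section LinearChange.
Variables (L : fieldType) (E : fieldType) (j : {rmorphism L -> E}) (r : nat).
Variables (al : 'I_r.+1 -> E) (c : 'I_r.+1 -> L) (i0 : 'I_r.+1).
Hypothesis al_inj : forall G : {mpoly L[r.+1]}, mmap j al G = 0 -> G = 0.
Hypothesis c_i0 : c i0 != 0.

(** The vector [al] is written as a multiple of [c] plus a vector whose entry at [i0] is zero:
    [pivot_value] is the multiplier and [reduced_value] lists the remaining entries. *)
Definition pivot_value : E := al i0 * j (c i0)^-1.
Definition reduced_value (k : 'I_r) : E := al (lift i0 k) - pivot_value * j (c (lift i0 k)).

Let h : {rmorphism L -> {poly {mpoly L[r]}}} :=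
  [the {rmorphism _ -> _} of polyC \o @mpolyC r L].

(** The passage from [al] to the pivot and the reduced values is an invertible linear change of
    variables over [L], so it preserves algebraic independence. [Phi] and [Psi] are the substitution
    and its inverse. *)
Lemma pivot_transcendental (q : {poly {mpoly L[r]}}) :
  (map_poly (mmap j reduced_value) q).[pivot_value] = 0 -> q = 0.
Proof.
pose W k : {mpoly L[r.+1]} := 'X_(lift i0 k) - ((c i0)^-1 * c (lift i0 k)) *: 'X_i0.
pose S : {mpoly L[r.+1]} := (c i0)^-1 *: 'X_i0.
pose Phi q : {mpoly L[r.+1]} := (map_poly (mmap (@mpolyC r.+1 L) W) q).[S].
pose B i : {poly {mpoly L[r]}} :=
  if unlift i0 i is Some k then ('X_k)%:P + h (c i) * 'X else h (c i0) * 'X.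
pose Psi := mmap h B.
have PsiZ a p : Psi (a *: p) = h a * Psi p by exact: mmapZ.
have PsiX i : Psi 'X_i = B i by exact: mmapXU.
have B0 : B i0 = h (c i0) * 'X by rewrite /B unlift_none.
have cc a x : h a * (h (c i0) * x) = h (a * c i0) * x by rewrite mulrA -rmorphM.
have PsiW k : Psi (W k) = ('X_k)%:P.
  have E1 : (c i0)^-1 * c (lift i0 k) * c i0 = c (lift i0 k) by rewrite mulrAC mulVf // mul1r.
  have E2 : B (lift i0 k) = ('X_k)%:P + h (c (lift i0 k)) * 'X by rewrite /B liftK.
  rewrite /W [LHS]mmapB -!/(Psi _) PsiZ !PsiX B0 cc E1 E2.
  exact: addrK.
have PsiS : Psi S = 'X.
  have E1 : (c i0)^-1 * c i0 = 1 by rewrite mulVf.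
  by rewrite PsiZ PsiX B0 cc E1 (rmorph1 h); apply: mul1r.
have PsiPhi p : Psi (Phi p) = p.
  rewrite /Phi /Psi -horner_map /= -/(Psi S) PsiS -map_poly_comp.
  rewrite (eq_map_poly (g := polyC)) => [|a]; last first.
    rewrite /= rmorph_mmap; elim/mpoly_ring_ind: a => [a|i|p1 p2 IH1 IH2|p1 p2 IH1 IH2].
    - by rewrite mmapC /= mmapC.
    - by rewrite mmapXU /= -/(Psi _) PsiW.
    - by rewrite mmapD IH1 IH2 polyCD.
    - by rewrite rmorphM /= IH1 IH2 polyCM.
  elim/poly_ind: p => [|p a IH]; first by rewrite rmorph0 horner0.
  by rewrite rmorphD rmorphM /= map_polyX map_polyC hornerD hornerMX hornerC IH.
have alPhi p : mmap j al (Phi p) = (map_poly (mmap j reduced_value) p).[pivot_value].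
  rewrite /Phi -horner_map /= -map_poly_comp; congr (_.[_]).
    apply: eq_map_poly => a; rewrite /= rmorph_mmap.
    apply: eq_mmap => [b|k]; first by rewrite /= mmapC.
    rewrite /= /W mmapB mmapZ !mmapXU /reduced_value /pivot_value rmorphM /=.
    by congr (_ - _); rewrite mulrC mulrA.
  by rewrite mmapZ mmapXU mulrC.
by move=> q0; rewrite -(PsiPhi q) (al_inj (G := Phi q)) ?alPhi // /Psi mmap0.
Qed.

Lemma reduced_inj : injective (mmap j reduced_value).
Proof.
apply: raddf_inj => p p0; apply/eqP; rewrite -polyC_eq0; apply/eqP/pivot_transcendental.
by rewrite map_polyC hornerC /= p0.
Qed.

Lemma reduced_sum (f : 'I_r.+1 -> E) :
  \sum_i al i * f i = \sum_k reduced_value k * f (lift i0 k)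
    + pivot_value * \sum_i j (c i) * f i.
Proof.
rewrite [LHS](bigD1_ord i0) // [X in _ = _ + _ * X](bigD1_ord i0) //= mulrDr.
rewrite [RHS]addrCA mulr_sumr -big_split /=.
congr (_ + _); last by apply: eq_bigr => k _; rewrite /reduced_value; ring.
by rewrite /pivot_value mulrA -[al i0 * _ * _]mulrA -rmorphM mulVf // rmorph1 mulr1.
Qed.

End LinearChange.

Section Scaling.
Variables (L K : fieldType) (iota : {rmorphism L -> K}) (n : nat) (a : 'I_n -> K).
Hypothesis a_generic : forall d (G : {mpoly L[n]}), G \is d.-homog ->
  mmap iota a G = 0 -> G = 0.

(** Genericity in projective space controls homogeneous polynomials only. Multiplying the
    coordinates by the variable of [K(X)] separates the homogeneous components, so that no nonzero
    polynomial over [L] vanishes. *)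
Definition scaled_const : {rmorphism L -> {fraction {poly K}}} :=
  [the {rmorphism _ -> _} of @tofrac {poly K} \o polyC \o iota].
Definition scaled_value i : {fraction {poly K}} := tofrac (a i *: 'X).

Lemma scaled_value_inj (G : {mpoly L[n]}) : mmap scaled_const scaled_value G = 0 -> G = 0.
Proof.
have -> : mmap scaled_const scaled_value G = tofrac (mmap (polyC \o iota) (fun i => a i *: 'X) G).
  by rewrite [RHS](rmorph_mmap (@tofrac {poly K})); apply: eq_mmap.
move=> /eqP; rewrite tofrac_eq0 => /eqP G0.
have Gd d : pihomog mdeg d G = 0.
  apply: (a_generic (pihomogP mdeg d G)); move/polyP/(_ d): G0; rewrite coef0.
  rewrite {1}(pihomog_partitionE (leq_maxl (mmeasure mdeg G) d.+1)) raddf_sum coef_sum /= => E.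
  have Ec k : (mmap (polyC \o iota) (fun i => a i *: 'X) (pihomog mdeg k G))`_d
    = if d == k then mmap iota a (pihomog mdeg k G) else 0.
    have -> : mmap (polyC \o iota) (fun i => a i *: 'X) (pihomog mdeg k G)
      = 'X^k * (mmap iota a (pihomog mdeg k G))%:P.
      rewrite (rmorph_mmap polyC) -(mmap_dhomog _ _ _ (pihomogP mdeg k G)).
      by apply: eq_mmap => // i; rewrite /= mulrC mul_polyC.
    by rewrite mulrC coefCM coefXn; case: (d == k); rewrite ?mulr1 ?mulr0.
  move: E; rewrite (eq_bigr _ (fun k _ => Ec _)).
  rewrite (bigD1 (Ordinal (leq_maxr (mmeasure mdeg G) d.+1))) //= eqxx big1 ?addr0 // => k /eqP kd.
  by case: eqP => // E; case: kd; apply: val_inj.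
rewrite (pihomog_partitionE (leqnn (mmeasure mdeg G))) big1 // => d _; exact: Gd.
Qed.

End Scaling.

Section Bracket.
Variables (L : closedFieldType) (F : {mpoly L[2]}).
Notation X := ('X_ord0 : {mpoly L[2]}).
Notation Y := ('X_ord_max : {mpoly L[2]}).

(** The Jacobian determinant of [g] and [F], that is, the derivative of [g] along the curve [F = 0]:
    at a smooth point it detects tangency, and modulo [F] it depends only on the class of [g]. *)
Definition bracket g : {mpoly L[2]} :=
  g^`M(ord0) * F^`M(ord_max) - g^`M(ord_max) * F^`M(ord0).

Lemma bracketD g h : bracket (g + h) = bracket g + bracket h.
Proof. by rewrite /bracket !mderivD !mulrDl opprD addrACA. Qed.

Lemma bracketZ a g : bracket (a *: g) = a *: bracket g.
Proof. by rewrite /bracket !mderivZ -!scalerAl -scalerBr. Qed.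

Lemma bracket_sum n (c : 'I_n -> L) (g : 'I_n -> {mpoly L[2]}) :
  bracket (\sum_i c i *: g i) = \sum_i c i *: bracket (g i).
Proof.
have b0 : bracket 0 = 0 by rewrite /bracket !mderiv0 !mul0r subrr.
by rewrite (big_morph bracket bracketD b0); apply: eq_bigr => i _; apply: bracketZ.
Qed.

Lemma bracket_mulF q : bracket (q * F) = bracket q * F.
Proof. by rewrite /bracket !mderivM; ring. Qed.

Lemma divides_bracket g h : divides F (g - h) -> divides F (bracket g - bracket h).
Proof.
move=> [q /eqP]; rewrite subr_eq => /eqP ->; exists (bracket q).
by rewrite bracketD bracket_mulF addrK.
Qed.

Lemma bracket1 : bracket 1 = 0.
Proof. by rewrite /bracket -mpolyC1 !mderivC !mul0r subrr. Qed.

Lemma bracketX : bracket X = F^`M(ord_max).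
Proof. by rewrite /bracket !mderivXU /= mul1r mul0r subr0. Qed.

End Bracket.

Section NoTangency.
Variables (L K : closedFieldType) (iota : {rmorphism L -> K}) (F : {mpoly L[2]}).
Notation X := ('X_ord0 : {mpoly L[2]}).
Notation Y := ('X_ord_max : {mpoly L[2]}).
Hypothesis irrF : irreducible_elt F.
Hypothesis degF : (1 < size (bipoly F))%N.
Hypothesis sepF : ~ divides F F^`M(ord_max).
Variables (r : nat) (beta : 'I_r.+1 -> {mpoly L[2]}) (c d : 'I_r.+1 -> L).
Hypothesis Ec : divides F (\sum_i c i *: beta i - 1).
Hypothesis Ed : divides F (\sum_i d i *: beta i - X).
Variable a : 'I_r.+1 -> K.
Hypothesis a_generic : forall e (G : {mpoly L[r.+1]}), G \is e.-homog ->
  mmap iota a G = 0 -> G = 0.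

(** Since the bracket of 1 is 0, the tangency equation involves only the reduced values and makes
    the point algebraic over the field they generate. The incidence equation, where 1 occurs, then
    expresses the pivot algebraically through them, against its transcendence. *)
Lemma no_tangency x y : mmap iota (xy x y) F = 0 -> mmap iota (xy x y) F^`M(ord_max) != 0 ->
  \sum_i a i * mmap iota (xy x y) (beta i) = 0 ->
  \sum_i a i * mmap iota (xy x y) (bracket F (beta i)) = 0 -> False.
Proof.
move=> Fxy F'xy axy a'xy.
pose j := scaled_const iota; pose al := scaled_value a.
pose emb : {rmorphism K -> {fraction {poly K}}} :=
  [the {rmorphism _ -> _} of @tofrac {poly K} \o polyC].
pose x' := emb x; pose y' := emb y.
have ev f : mmap j (xy x' y') f = emb (mmap iota (xy x y) f).
  by rewrite rmorph_mmap_xy; apply: eq_mmap.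
have alE i : al i = tofrac 'X * emb (a i).
  by rewrite /al /scaled_value -mul_polyC mulrC rmorphM.
have divE f g : divides F (f - g) -> mmap j (xy x' y') f = mmap j (xy x' y') g.
  move=> [q /eqP]; rewrite subr_eq => /eqP ->.
  by rewrite mmapD rmorphM /= (ev F) Fxy rmorph0 mulr0 add0r.
have sumE (b : 'I_r.+1 -> L) (f : 'I_r.+1 -> {mpoly L[2]}) :
    mmap j (xy x' y') (\sum_i b i *: f i) = \sum_i j (b i) * mmap j (xy x' y') (f i).
  by rewrite raddf_sum; apply: eq_bigr => i _; rewrite /= mmapZ.
have alsum (f : 'I_r.+1 -> {mpoly L[2]}) : \sum_i a i * mmap iota (xy x y) (f i) = 0 ->
    \sum_i al i * mmap j (xy x' y') (f i) = 0.
  move=> f0; transitivity (tofrac 'X * emb (\sum_i a i * mmap iota (xy x y) (f i))).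
    rewrite rmorph_sum mulr_sumr; apply: eq_bigr => i _.
    by rewrite alE ev rmorphM mulrA.
  by rewrite f0 rmorph0 mulr0.
have c1 : \sum_i j (c i) * mmap j (xy x' y') (beta i) = 1.
  by rewrite -sumE (divE _ _ Ec) rmorph1.
have [i0 ci0] : exists i0, c i0 != 0.
  have [//|c0] := fun_eq0_or c; move: c1; rewrite big1 => [/esym/eqP|i _].
    by rewrite oner_eq0.
  by rewrite c0 rmorph0 mul0r.
have c'0 : \sum_i j (c i) * mmap j (xy x' y') (bracket F (beta i)) = 0.
  by rewrite -sumE -bracket_sum (divE _ _ (divides_bracket Ec)) bracket1 mmap0.
have al_inj := scaled_value_inj a_generic.
pose w := reduced_value j al c i0.
(* The combination giving [X], corrected by a multiple of the one giving 1 so as to have no entry at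
   [i0]; modulo [F] its bracket is [F_Y]. *)
pose g k := d (lift i0 k) - d i0 / c i0 * c (lift i0 k).
have [||||q q0 qs] := generic_combination_algebraic (reduced_inj al_inj ci0) irrF degF
   (x := x') (y := y') (delta := fun k => bracket F (beta (lift i0 k))) (g := g) _ _ _ _
   (fun k => - beta (lift i0 k)).
- by rewrite ev Fxy rmorph0.
- by rewrite ev fmorph_eq0.
- have := reduced_sum j al ci0 (fun i => mmap j (xy x' y') (bracket F (beta i))).
  by rewrite (alsum _ a'xy) c'0 mulr0 addr0 => <-.
- have -> : \sum_k g k *: bracket F (beta (lift i0 k))
      = bracket F (\sum_i d i *: beta i) - d i0 / c i0 *: bracket F (\sum_i c i *: beta i).
    rewrite !bracket_sum scaler_sumr -sumrB (bigD1_ord i0) //= scalerA divfK // subrr add0r.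
    by apply: eq_bigr => k _; rewrite scalerA -scalerBl.
  move=> [q Eq]; apply: sepF; have [q1 E1] := divides_bracket Ec.
  have [q2 E2] := divides_bracket Ed; rewrite bracket1 subr0 in E1; rewrite bracketX in E2.
  exists (q + (d i0 / c i0) *: q1 - q2).
  rewrite mulrBl -E2 mulrDl -Eq -scalerAl -E1 subrK.
  by rewrite opprB addrC subrK.
move/negP: q0; apply; apply/eqP; apply: (pivot_transcendental al_inj ci0).
move/rootP: qs; congr (_.[_] = 0).
have := reduced_sum j al ci0 (fun i => mmap j (xy x' y') (beta i)).
rewrite (alsum beta axy) c1 mulr1 => /esym/eqP; rewrite addrC addr_eq0 => /eqP ->.
by rewrite -sumrN; apply: eq_bigr => k _; rewrite mmapN mulrN.
Qed.

End NoTangency.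

Section SimpleZeros.
Variables (L K : closedFieldType) (iota : {rmorphism L -> K}) (V : residue_ring iota).
Notation R := (vring V).
Notation res := (@vres L K iota V).
Notation vv := (@vval L K iota V).
Notation cst := (@vconst L K iota V).
Variables (F u0 u1 u2 : {mpoly L[2]}) (eta : {fps L}) (a' : L).
Notation X := ('X_ord0 : {mpoly L[2]}).
Notation Y := ('X_ord_max : {mpoly L[2]}).
Hypothesis irrF : irreducible_elt F.
Hypothesis EF : F = Y ^+ 2 * u0 + X * Y * u1 + X ^+ 2 * u2.
Hypothesis eta0 : eta 0%N = 0.
Hypothesis etaF : subst_series eta F = 0.
Hypothesis c0_neq0 : u0.@[fun=> 0] != 0.
Hypothesis a'_root : u0.@[fun=> 0] * a' ^+ 2 + u1.@[fun=> 0] * a' + u2.@[fun=> 0] = 0.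
Hypothesis a'_neq : eta 1%N != a'.
Hypothesis sepF : ~ divides F F^`M(ord_max).
Variables (r : nat) (beta : 'I_r.+1 -> {mpoly L[2]}) (c d : 'I_r.+1 -> L).
Hypothesis Ec : divides F (\sum_i c i *: beta i - 1).
Hypothesis Ed : divides F (\sum_i d i *: beta i - X).
Variable t : 'I_r.+1 -> R.
Hypothesis t_generic : forall e (G : {mpoly L[r.+1]}), G \is e.-homog ->
  mmap iota (vv \o t) G = 0 -> G = 0.
Notation G := (strict_transform u0 u1 u2).

(** The blow-down sends the direction [(1, s)] at [(x, z)] to [(1, z + s x)] at [(x, x z)]. *)
Lemma dual_eval_blowup x z s (g : {mpoly L[2]}) :
  let P := xy (vv x) (vv (x * z)) in
  exists q, dual_eval (vv x) (vv z) s (map_mpoly cst (blowup g)) =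
    (mmap iota P g)%:P + 'X * (mmap iota P g^`M(ord0)
      + (vv z + s * vv x) * mmap iota P g^`M(ord_max))%:P + 'X ^+ 2 * q.
Proof.
move=> P; pose w := xy 1 ((vv z + s * vv x)%:P + s *: 'X) : 'I_2 -> {poly K}.
have [q Eq] := mmap_Taylor1 (polyC \o iota) (polyC \o P) 'X w g.
have EC f : mmap (polyC \o iota) (polyC \o P) f = (mmap iota P f)%:P.
  by rewrite [RHS](rmorph_mmap polyC).
exists (q + s *: (mmap iota P g^`M(ord_max))%:P).
have -> : dual_eval (vv x) (vv z) s (map_mpoly cst (blowup g))
   = mmap (polyC \o iota) (fun i => (polyC \o P) i + 'X * w i) g.
  rewrite /dual_eval mmap_map_mpoly mmap_blowup; apply: eq_mmap => // i.
  rewrite /P /w /xy /=; case: (i == ord0); first by rewrite mulr1.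
  by rewrite rmorphM polyCD !polyCM -!mul_polyC; ring.
rewrite Eq !EC big_ord_recl big_ord1 !EC /w /xy /=.
have -> : lift ord0 ord0 = ord_max :> 'I_2 by apply: val_inj.
by rewrite polyCD polyCM -!mul_polyC; ring.
Qed.

Lemma dvd_X2_coef1 (p q : {poly K}) (a b : K) :
  'X^2 %| p -> p = a%:P + 'X * b%:P + 'X^2 * q -> b = 0.
Proof.
move=> /dvdpP[p' ->] /polyP/(_ 1%N).
by rewrite coefMXn /= !coefD coefC coefXM coefC coefXnM /= add0r addr0.
Qed.

Lemma no_double_zero x z : near_branch G (slope_series eta) x z -> x <> 0 ->
  let f := \sum_i t i *: map_mpoly cst (blowup (beta i)) in
  f.@[xy x z] = 0 -> tangent_at G f x z -> False.
Proof.
move=> nb x0 f fxz [s [sG sf]]; set P := xy (vv x) (vv (x * z)).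
have evP g : vv (map_mpoly cst (blowup g)).@[xy x z] = mmap iota P g.
  rewrite meval_map_mpoly mmap_blowup vv_mmap; apply: eq_mmap => // i.
  by rewrite comp_xy.
have FP : mmap iota P F = 0.
  by rewrite -evP meval_map_mpoly mmap_blowup (near_branch_onF EF nb) rmorph0.
have F'P : mmap iota P F^`M(ord_max) != 0.
  apply/eqP => E; apply: sepF.
  apply: (near_branch_generic irrF EF eta0 etaF c0_neq0 a'_root a'_neq nb x0).
  apply: (@vval_inj _ _ _ V); rewrite rmorph0 -E vv_mmap; apply: eq_mmap => // i.
  by rewrite comp_xy.
pose D g := mmap iota P g^`M(ord0) + (vv z + s * vv x) * mmap iota P g^`M(ord_max).
have DF : D F = 0.
  have [q Eq] := dual_eval_blowup x z s F; apply: dvd_X2_coef1 Eq.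
  by rewrite (blowup_F EF) rmorphM rmorphM dvdp_mull.
have Df : \sum_i vv (t i) * D (beta i) = 0.
  have /choice[q Eq] i := dual_eval_blowup x z s (beta i).
  apply: (@dvd_X2_coef1 _ (\sum_i (vv (t i))%:P * q i)
     (\sum_i vv (t i) * mmap iota P (beta i)) _ sf).
  rewrite /f [LHS]rmorph_sum !rmorph_sum !mulr_sumr -!big_split /=.
  apply: eq_bigr => i _; rewrite [LHS]mmapZ -/(dual_eval _ _ _ _) Eq /= !polyCM.
  by rewrite -/P -/(D _); ring.
apply: (no_tangency irrF (branch_degY irrF etaF) sepF Ec Ed t_generic FP F'P).
  transitivity (vv f.@[xy x z]); last by rewrite fxz rmorph0.
  have -> : f.@[xy x z] = \sum_i t i * (map_mpoly cst (blowup (beta i))).@[xy x z].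
    by rewrite /f raddf_sum; apply: eq_bigr => i _ /=; rewrite mevalZ.
  by rewrite rmorph_sum; apply: eq_bigr => i _; rewrite rmorphM /= evP.
transitivity (mmap iota P F^`M(ord_max) * \sum_i vv (t i) * D (beta i)); last first.
  by rewrite Df mulr0.
(* Tangency of [F] to the direction gives [F_X = - (z + s x) F_Y], so the bracket of [g] with [F] is
   [F_Y] times the directional derivative of [g]. *)
rewrite mulr_sumr; apply: eq_bigr => i _; rewrite /bracket mmapB !rmorphM /= /D.
have -> : mmap iota P F^`M(ord0) = - ((vv z + s * vv x) * mmap iota P F^`M(ord_max)).
  by apply/eqP; rewrite -addr_eq0 -/(D F) DF.
by ring.
Qed.

End SimpleZeros.

(** * Maximal finite systems *)

Section FiniteIntersections.
Variables (L : closedFieldType) (F : {mpoly L[2]}).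
Hypothesis irrF : irreducible_elt F.
Hypothesis degF : (1 < size (bipoly F))%N.

Definition infinity_point (a b : L) : 'I_3 -> L :=
  fun i => if unlift ord_max i is Some k then xy a b k else 0.

Lemma homogenise_infinity a : (homogenise F).@[infinity_point a 1] = (top_form F).[a].
Proof.
rewrite homogeniseE raddf_sum /top_form horner_sum [RHS]big_mkcond /=.
apply: eq_big_seq => m /msupp_deg mF.
rewrite mevalZ mevalX /mmap1 big_ord_recr /= mnmE unlift_none.
rewrite {2}/infinity_point unlift_none expr0n subn_eq0 leq_eqVlt ltnNge mF orbF eq_sym.
have -> : \prod_(i < 2) infinity_point a 1 (widen_ord (leqnSn 2) i) ^+ homog_exp F m (widen_ord (leqnSn 2) i)
    = a ^+ m ord0.
  have E i : widen_ord (leqnSn 2) i = lift ord_max i.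
    by apply: val_inj; rewrite /= /bump leqNgt ltn_ord.
  rewrite big_ord_recl big_ord1 !E !mnmE !liftK /infinity_point !liftK /xy /=.
  by rewrite expr1n mulr1.
case: eqP => _; last by rewrite !mulr0.
by rewrite mulr1 hornerZ hornerXn.
Qed.

(** Besides the affine common zeros, the list holds all candidates at infinity on [F]: the points
    [(a : 1 : 0)] with [a] a root of the top form, and [(1 : 0 : 0)]. *)
Lemma finite_form e h : h \is e.-homog -> ~ divides F (dehom h) -> finite_intersection F h.
Proof.
move=> hom_h nFh; have F0 : F != 0 by have [] := irrF.
have [s sP] := finite_common_zeros irrF degF nFh.
have [s' s'P] := poly_finite_roots (top_form_neq0 F0).
have /choice[pt ptP] (u : 'I_3 -> L) : exists q : pspace L 2, (exists i, u i != 0) -> hcoords q u.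
  have [[i ui]|u0] := EM (exists i, u i != 0); last by exists (origin L 2).
  by have [q] := hcoords_exists (ex_intro (fun i => u i != 0) i ui); exists q.
exists ([seq pt (hpoint (xy p.1 p.2) 1) | p <- s] ++
        [seq pt (infinity_point a 1) | a <- s'] ++ [:: pt (infinity_point 1 0)]).
move=> q Fq hq; have qc := hcoords_coords q; set u := coords q 0 in qc.
have [i0 ui0] := hcoords_neq0 qc.
have pt_eq v : (forall i k, u i * v k = u k * v i) -> (exists i, v i != 0) -> q = pt v.
  by move=> uv v0; apply: (hcoords_eq _ (ptP v v0)); apply: hcoords_minors qc v0 uv.
have uE i : u i = if unlift ord_max i is Some k then u (lift ord_max k) else u ord_max.
  by case: (unliftP ord_max i) => [k|] ->.
have xyE (a b : L) k : xy a b k = if k == ord0 then a else b by [].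
have k01 (k : 'I_2) : k = ord0 \/ k = ord_max.
  case: (unliftP ord0 k) => [l|] ->; [right|by left].
  by apply: val_inj; rewrite /= ord1.
rewrite !mem_cat; have [u2|u2] := eqVneq (u ord_max) 0; last first.
  set x := u (lift ord_max ord0) / u ord_max; set y := u (lift ord_max ord_max) / u ord_max.
  have Eu i : u i = u ord_max * hpoint (xy x y) 1 i.
    rewrite uE /hpoint; case: (unlift ord_max i) => [k|]; last by rewrite mulr1.
    by rewrite mul1r; case: (k01 k) => ->; rewrite /xy /= mulrC divfK.
  have Eq : q = pt (hpoint (xy x y) 1).
    apply: pt_eq; last by exists ord_max; rewrite /hpoint unlift_none oner_neq0.
    by move=> i k; rewrite (Eu i) (Eu k); ring.
  have qh : hcoords q (hpoint (xy x y) 1).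
    by rewrite Eq; apply: ptP; exists ord_max; rewrite /hpoint unlift_none oner_neq0.
  apply/orP; left; apply/mapP; exists (x, y); last exact: Eq.
  apply: sP.
    have /(vanishes_hcoords (homogenise_homog F) qh) := Fq.
    by rewrite /meval mmap_homogenise expr1n mul1r.
  by have /(vanishes_hcoords hom_h qh) := hq; rewrite /meval mmap_dehom.
have Eu i : u i = infinity_point (u (lift ord_max ord0)) (u (lift ord_max ord_max)) i.
  rewrite uE /infinity_point; case: (unlift ord_max i) => [k|//].
  by case: (k01 k) => ->; rewrite /xy.
have [b0|b0] := eqVneq (u (lift ord_max ord_max)) 0.
  apply/orP; right; apply/orP; right; rewrite inE; apply/eqP; apply: pt_eq.
    move=> i k; rewrite (Eu i) (Eu k) b0 /infinity_point.
    by case: (unlift ord_max i) => [l|]; case: (unlift ord_max k) => [l'|]; rewrite /xy ?mul0r ?mulr0 //;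
       case: (l == ord0); case: (l' == ord0); rewrite ?mul0r ?mulr0.
  by exists (lift ord_max ord0); rewrite /infinity_point liftK /xy /= oner_neq0.
set x := u (lift ord_max ord0) / u (lift ord_max ord_max).
have Eu' i : u i = u (lift ord_max ord_max) * infinity_point x 1 i.
  rewrite {1}Eu /infinity_point; case: (unlift ord_max i) => [k|]; last by rewrite mulr0.
  by case: (k01 k) => ->; rewrite /xy /= ?mulr1 // mulrC divfK.
have nz : exists i, infinity_point x 1 i != 0.
  by exists (lift ord_max ord_max); rewrite /infinity_point liftK /xy /= oner_neq0.
have Eq : q = pt (infinity_point x 1).
  by apply: pt_eq => // i k; rewrite (Eu' i) (Eu' k); ring.
apply/orP; right; apply/orP; left; apply/mapP; exists x => //; apply: s'P.
have qh : hcoords q (infinity_point x 1) by rewrite Eq; apply: ptP.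
by apply/rootP; rewrite -homogenise_infinity; apply/(vanishes_hcoords (homogenise_homog F) qh).
Qed.

Lemma dehomZ a (h : {mpoly L[3]}) : dehom (a *: h) = a *: dehom h.
Proof. by rewrite /dehom mmapZ mul_mpolyC. Qed.

Lemma dehomD (h k : {mpoly L[3]}) : dehom (h + k) = dehom h + dehom k.
Proof. exact: mmapD. Qed.

Lemma dividesZ a (g : {mpoly L[2]}) : a != 0 -> divides F (a *: g) -> divides F g.
Proof.
by move=> a0 [q Eq]; exists (a^-1 *: q); rewrite -scalerAl -Eq scalerA mulVf // scale1r.
Qed.

Lemma dehom_homogenise (H : {mpoly L[2]}) : dehom (homogenise H) = H.
Proof.
rewrite /dehom mmap_homogenise expr1n mul1r.
elim/mpoly_ring_ind: H => [a|i|p q IH1 IH2|p q IH1 IH2].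
- by rewrite mmapC.
- by rewrite mmapXU xy_X.
- by rewrite mmapD IH1 IH2.
- by rewrite rmorphM /= IH1 IH2.
Qed.

Lemma finite_line e (h : dhomog 3 L e) : ~ divides F (dehom (val h)) ->
  finite_system F <[h]>%VS.
Proof.
move=> nFh k /vlineP[a ->] ah0; apply: (finite_form (dhomog_is_dhomog _)).
rewrite [val _]linearZ dehomZ => /dividesZ dv; apply: nFh; apply: dv.
by apply: contraNneq ah0 => ->; rewrite scale0r.
Qed.

Lemma maximal_system_exists e (h : dhomog 3 L e) : ~ divides F (dehom (val h)) ->
  exists2 W : {vspace dhomog 3 L e}, maximal_finite_system F W & h \in W.
Proof.
move=> nFh; pose P n := `[< exists W : {vspace dhomog 3 L e},
  [/\ finite_system F W, h \in W & \dim W = n] >].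
have exP : exists n, P n.
  exists (\dim <[h]>); apply/asboolP; exists <[h]>%VS.
  by split=> //; [apply: finite_line | apply: memv_line].
have bP n : P n -> (n <= \dim {:dhomog 3 L e})%N.
  by move=> /asboolP[W [_ _ <-]]; apply: dimvS; apply: subvf.
case: (ex_maxnP exP bP) => n /asboolP[W [fW hW dW]] nmax.
exists W => //; split=> // W' sW fW'; apply/eqP; rewrite eq_sym eqEdim sW /= dW.
by apply: nmax; apply/asboolP; exists W'; split=> //; apply: (subvP sW).
Qed.

(** If no member of [W] agreed with [g] modulo [F], adding [g] would keep the system finite: a form
    [u + a g] divisible by [F] with [a <> 0] makes [- a^-1 u] agree with [g]. Maximality then puts
    [g] itself in [W]. *)
Lemma maximal_system_spans e (W : {vspace dhomog 3 L e}) (g : dhomog 3 L e) :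
  maximal_finite_system F W -> exists2 w, w \in W & divides F (dehom (val w) - dehom (val g)).
Proof.
move=> [fW maxW]; apply: contrapT => H.
have nW w : w \in W -> ~ divides F (dehom (val w) - dehom (val g)).
  by move=> wW dv; apply: H; exists w.
have gW : g \in W.
  have EW : (W + <[g]>)%VS = W; last by rewrite -EW (subvP (addvSr _ _)) ?memv_line.
  apply: maxW; first exact: addvSl.
  move=> _ /memv_addP[u uW [_ /vlineP[a ->] ->]] n0.
  have [a0|a0] := eqVneq a 0.
    by rewrite a0 scale0r addr0 in n0 *; apply: fW.
  apply: (finite_form (dhomog_is_dhomog _)).
  have -> : val (u + a *: g) = val u + a *: val g by [].
  rewrite dehomD dehomZ => dv.
  apply: (nW (- a^-1 *: u)); first by rewrite memvZ.
  have -> : val (- a^-1 *: u) = - a^-1 *: val u by [].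
  rewrite dehomZ scaleNr -opprD.
  have [q Eq] := dv; exists (- (a^-1 *: q)); rewrite mulNr; congr (- _).
  by rewrite -scalerAl -Eq scalerDr scalerA mulVf // scale1r.
by apply: (nW g gW); exists 0; rewrite subrr mul0r.
Qed.

Lemma maximal_system_coords e r (b : r.+1.-tuple (dhomog 3 L e)) g :
  maximal_finite_system F <<b>>%VS -> g \is e.-homog ->
  exists c : 'I_r.+1 -> L, divides F (\sum_i c i *: dehom (val (tnth b i)) - dehom g).
Proof.
move=> mW hg; have [w wW dv] := maximal_system_spans (DHomog hg) mW.
exists (fun i => coord b i w); suff -> : \sum_i coord b i w *: dehom (val (tnth b i)) = dehom (val w) by [].
rewrite {2}(coord_span wW) /dehom [val _]linear_sum raddf_sum; apply: eq_bigr => i _.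
by rewrite /= (tnth_nth 0) -/(dehom _) -/(dehom _) -dehomZ.
Qed.

End FiniteIntersections.

(** * Existence of generic deformations *)

Section Reversal.
Variables (L : fieldType) (E : fieldType) (j : {rmorphism L -> E}) (n : nat).
Variable t : 'I_n -> E.
Hypothesis t_inj : forall P : {mpoly L[n]}, mmap j t P = 0 -> P = 0.

Lemma generic_translate (e : 'I_n -> L) (P : {mpoly L[n]}) :
  mmap j (fun i => t i + j (e i)) P = 0 -> P = 0.
Proof.
pose T (e : 'I_n -> L) := mmap (@mpolyC n L) (fun i => 'X_i + (e i)%:MP).
have TT : T (fun i => - e i) (T e P) = P.
  rewrite /T rmorph_mmap; elim/mpoly_ring_ind: P => [a|i|p q IH1 IH2|p q IH1 IH2].
  - by rewrite mmapC /= mmapC.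
  - by rewrite mmapXU /= mmapD mmapXU mmapC mpolyCN subrK.
  - by rewrite mmapD IH1 IH2.
  - by rewrite rmorphM /= IH1 IH2.
have tT : mmap j t (T e P) = mmap j (fun i => t i + j (e i)) P.
  rewrite /T rmorph_mmap; apply: eq_mmap => [a|i]; first by rewrite /= mmapC.
  by rewrite /= mmapD mmapXU mmapC.
by move=> P0; rewrite -TT (t_inj (P := T e P)) ?tT // /T mmap0.
Qed.

(** If [P] vanishes at the point obtained from [t] by inverting some
    coordinates, then a polynomial with the same coefficients, moved to other
    monomials, vanishes at [t]. *)
Lemma generic_inverse (b : 'I_n -> bool) (P : {mpoly L[n]}) :
  mmap j (fun i => if b i then (t i)^-1 else t i) P = 0 -> P = 0.
Proof.
move=> P0; pose N := msize P.
pose f (m : 'X_{1..n}) : 'X_{1..n} := [multinom if b i then (N - m i)%N else m i | i < n].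
have mN m i : m \in msupp P -> (m i <= N)%N.
  move=> /msize_mdeg_lt/ltnW; apply: leq_trans.
  by rewrite mdegE (bigD1 i) //= leq_addr.
have f_inj m m' : m \in msupp P -> m' \in msupp P -> f m = f m' -> m = m'.
  move=> mP mP' /mnmP E1; apply/mnmP => i; have := E1 i; rewrite !mnmE.
  case: (b i) => // E2; apply/eqP; rewrite -(eqn_add2l (N - m i)%N) subnK ?mN //.
  by rewrite E2 subnK ?mN.
have t0 i : t i != 0.
  apply/eqP => ti; have : ('X_i : {mpoly L[n]}) = 0 by apply: t_inj; rewrite mmapXU.
  move/(congr1 (meval (fun=> 1)))/eqP; by rewrite mevalXU meval0 oner_eq0.
pose Q := \sum_(m <- msupp P) P@_m *: 'X_[f m] : {mpoly L[n]}.
have : mmap j t Q = 0.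
  rewrite -[RHS](mulr0 (\prod_(i < n) (if b i then t i ^+ N else 1))) -P0.
  rewrite raddf_sum [in RHS]/mmap mulr_sumr; apply: eq_big_seq => m mP.
  rewrite /= mmapZ mmapX mulrCA; congr (_ * _); rewrite /mmap1 -big_split /=.
  apply: eq_bigr => i _; rewrite mnmE; case: (b i); last by rewrite mul1r.
  by rewrite exprVn expfB_cond ?(negPf (t0 i)) ?add0n ?mN.
move=> /t_inj Q0; apply/mpolyP => m; rewrite mcoeff0.
have [mP|mP] := boolP (m \in msupp P); last exact: memN_msupp_eq0.
have := congr1 (mcoeff (f m)) Q0; rewrite mcoeff0 raddf_sum (bigD1_seq m) ?msupp_uniq //=.
rewrite mcoeffZ mcoeffX eqxx mulr1 big_seq_cond big1 ?addr0 // => m' /andP[m'P mm'].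
rewrite mcoeffZ mcoeffX; case: eqP => [/f_inj E1|]; last by rewrite mulr0.
by rewrite E1 ?eqxx in mm'.
Qed.

End Reversal.

Section Deformation.
Variables (L K : closedFieldType) (iota : {rmorphism L -> K}) (V : residue_ring iota).
Notation R := (vring V).
Notation res := (@vres L K iota V).
Notation vv := (@vval L K iota V).
Notation cst := (@vconst L K iota V).

(** Algebraically independent elements of [K] need not lie in [O]; those that do not are inverted,
    and all are then translated by constants of [L] to obtain the prescribed residues. *)
Lemma generic_lift n (u : 'I_n -> L) : infinite_trdeg iota ->
  exists t : 'I_n -> R, (forall i, res (t i) = u i) /\
    forall P : {mpoly L[n]}, mmap iota (vv \o t) P = 0 -> P = 0.
Proof.
move=> /(_ n)[tau tauP].
have tau_inj (P : {mpoly L[n]}) : mmap iota tau P = 0 -> P = 0.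
  move=> P0; apply/eqP/negPn/negP => /tauP; rewrite meval_map_mpoly P0.
  by rewrite eqxx.
have /choice[bs bsP] i : exists bs : bool * R,
    vv bs.2 = if bs.1 then (tau i)^-1 else tau i.
  by have [[z Ez]|[w Ew _]] := vring_or_inv V (tau i); [exists (false, z) | exists (true, w)].
pose s i := (bs i).2; exists (fun i => s i + cst (u i - res (s i))); split=> [i|P P0].
  by rewrite rmorphD /= vres_const addrC subrK.
apply: (generic_translate (generic_inverse tau_inj (b := fun i => (bs i).1))
  (e := fun i => u i - res (s i))).
by rewrite -[RHS]P0; apply: eq_mmap => // i; rewrite /= -bsP [RHS]rmorphD.
Qed.

End Deformation.

Section GenericDeformation.
Variables (L K : closedFieldType) (iota : {rmorphism L -> K}) (V : residue_ring iota).
Notation R := (vring V).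
Notation res := (@vres L K iota V).
Notation vv := (@vval L K iota V).
Notation cst := (@vconst L K iota V).
Variables (F H : {mpoly L[2]}).
Hypothesis irrF : irreducible_elt F.
Hypothesis degF : (1 < size (bipoly F))%N.
Hypothesis nFH : ~ divides F H.

Lemma generic_deformation_exists : infinite_trdeg iota ->
  exists r b v, @generic_deformation L K iota (rr_pred V) F H r b v.
Proof.
move=> trK; pose h : dhomog 3 L (msize H).-1 := DHomog (homogenise_homog H).
have nFh : ~ divides F (dehom (val h)) by rewrite dehom_homogenise.
have [W mW hW] := maximal_system_exists irrF degF nFh.
have h0 : h != 0.
  apply/eqP => h0; apply: nFh; rewrite h0 /= /dehom mmap0.
  by exists 0; rewrite mul0r.
have [r Er] : exists r, \dim W = r.+1.
  case E : (\dim W) => [|r]; last by exists r.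
  by move/eqP: E hW h0; rewrite dimv_eq0 => /eqP ->; rewrite memv0 => ->.
have [b bW] : exists b : r.+1.-tuple (dhomog 3 L (msize H).-1), basis_of W b.
  by rewrite -Er; exists (vbasis W); apply: vbasisP.
have fb := basis_free bW; have sb := span_basis bW.
pose u i := coord b i h.
have Eh : \sum_i u i *: tnth b i = h.
  have hb : h \in <<b>>%VS by rewrite sb.
  by rewrite [RHS](coord_span hb); apply: eq_bigr => i _; rewrite (tnth_nth 0).
have [i0 ui0] : exists i, u i != 0.
  have [//|u0] := fun_eq0_or u; case/eqP: h0; rewrite -Eh big1 // => i _.
  by rewrite u0 scale0r.
have [v0 hv0] := hcoords_exists (ex_intro (fun i => u i != 0) i0 ui0).
have [t [rt t_gen]] := generic_lift V u trK.
have vt0 : exists i, vv (t i) != 0.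
  by exists i0; apply: contraNneq ui0 => /eqP; rewrite vval_eq0 -rt => /eqP ->; rewrite rmorph0.
have [v hv] := hcoords_exists vt0.
exists r, b, v; split=> //; first by rewrite sb.
  move=> d G hG G0 /(vanishes_hcoords (map_mpoly_homog iota hG) hv).
  by rewrite meval_map_mpoly => /t_gen; apply/eqP.
exists v0, (\row_i u i); split=> //.
  by apply/(specialisesP V v hv0); exists t.
transitivity (val h); last by [].
by rewrite -Eh linear_sum; apply: eq_bigr => i _; rewrite mxE.
Qed.

End GenericDeformation.

(** * The number of intersections on one branch *)

Section DeformationCard.
Variables (L K : closedFieldType) (iota : {rmorphism L -> K}) (V : residue_ring iota).
Notation R := (vring V).
Notation res := (@vres L K iota V).
Notation vv := (@vval L K iota V).
Notation cst := (@vconst L K iota V).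
Variables (F : {mpoly L[2]}) (M : nonsingular_model F).
Notation N := (ns_dim M).
Notation X := ('X_ord0 : {mpoly L[2]}).
Notation Y := ('X_ord_max : {mpoly L[2]}).
Variable psi : N.+1.-tuple {mpoly L[3]}.
Hypothesis psi_degree : same_degree psi.
Hypothesis psi_defined : exists y x, vanishes (homogenise F) y /\ sends psi y x.
Hypothesis psi_model : forall y x, vanishes (homogenise F) y -> sends psi y x ->
  zeros (ns_eqs M) x /\ mor_sends (ns_map M) x y.
Hypothesis psi_inverse : forall x y x', zeros (ns_eqs M) x ->
  mor_sends (ns_map M) x y -> sends psi y x' -> x' = x.
Variables (u0 u1 u2 : {mpoly L[2]}) (eta eta' : {fps L}).
Hypothesis irrF : irreducible_elt F.
Hypothesis EF : F = Y ^+ 2 * u0 + X * Y * u1 + X ^+ 2 * u2.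
Hypothesis eta0 : eta 0%N = 0.
Hypothesis eta'0 : eta' 0%N = 0.
Hypothesis etaF : subst_series eta F = 0.
Hypothesis eta'F : subst_series eta' F = 0.
Hypothesis c0_neq0 : u0.@[fun=> 0] != 0.
Hypothesis eta_neq : eta 1%N != eta' 1%N.
Hypothesis sepF : ~ divides F F^`M(ord_max).

Variables (m m' : nat) (p p' : pspace L N).
Hypothesis cp : center_at psi eta m p.
Hypothesis cp' : center_at psi eta' m' p'.

Variables (H : {mpoly L[2]}) (k : nat).
Hypothesis Hdeg : (1 < msize H)%N.
Hypothesis Hord : fps_ord (subst_series eta H) k.

Let a'_root := slope_root EF eta'0 eta'F.
Let degF := branch_degY irrF etaF.

Lemma deformation_card r (b : r.+1.-tuple (dhomog 3 L (msize H).-1)) v :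
  @generic_deformation L K iota (rr_pred V) F H r b v ->
  has_card (branch_intersection iota (rr_pred V) (M := M) p (sys_member iota b v)) k.
Proof.
set e := (msize H).-1 in b *.
move=> [_ mW gv [v0 [u [sv /has_coords_hcoords hu Eu]]]].
have [t hv rt] := (specialisesP V v hu).1 sv.
have t_gen d (G : {mpoly L[r.+1]}) : G \is d.-homog -> mmap iota (vv \o t) G = 0 -> G = 0.
  move=> hG G0; apply/eqP/negPn/negP => /(gv _ _ hG); apply.
  by apply/(vanishes_hcoords (map_mpoly_homog iota hG) hv); rewrite meval_map_mpoly.
pose beta i := dehom (val (tnth b i)).
have F0 : F.@[fun=> 0] = 0.
  by rewrite EF !expr2 !mevalD !mevalM !mevalXU !mul0r !addr0.
(* The form [Z^e], with [Z] the homogenising variable, dehomogenises to 1. *)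
have [c Ec] : exists c : 'I_r.+1 -> L, divides F (\sum_i c i *: beta i - 1).
  have hZ : ('X_ord_max ^+ e : {mpoly L[3]}) \is e.-homog.
    by have := dhomogMn e (dhomogXU L (ord_max : 'I_3)); rewrite mul1n.
  have [c Ec] := maximal_system_coords irrF degF mW hZ; exists c.
  by move: Ec; rewrite [dehom ('X_ord_max ^+ e)]rmorphXn /= mmapXU /hpoint unlift_none expr1n.
(* Likewise [X Z^(e-1)] gives [X]; it has degree [e] because [H] is nonconstant, that is [e > 0]. *)
have [d Ed] : exists d : 'I_r.+1 -> L, divides F (\sum_i d i *: beta i - X).
  have hZ : ('X_(lift ord_max ord0) * 'X_ord_max ^+ e.-1 : {mpoly L[3]}) \is e.-homog.
    have := dhomogM (dhomogXU L (lift ord_max ord0 : 'I_3)) (dhomogMn e.-1 (dhomogXU L (ord_max : 'I_3))).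
    by rewrite mul1n add1n prednK // /e; case: (msize H) Hdeg => [|[]].
  have [d Ed] := maximal_system_coords irrF degF mW hZ; exists d.
  move: Ed; rewrite [dehom (_ * _)]rmorphM rmorphXn /= !mmapXU /hpoint unlift_none expr1n.
  by rewrite liftK /xy /= !mulr1 mul1r.
pose h := sys_member iota b v.
have [l l0 El] := hcoords_uniq hv (hcoords_coords v).
have hom_h : h \is e.-homog.
  by apply: rpred_sum => i _; apply: rpredZ; apply: map_mpoly_homog; apply: dhomog_is_dhomog.
have hE (x y : K) : h.@[hpoint (xy x y) 1]
    = l * \sum_i vv (t i) * mmap iota (xy x y) (beta i).
  rewrite /h /sys_member raddf_sum mulr_sumr; apply: eq_bigr => i _.
  by rewrite /= mevalZ El meval_map_mpoly mmap_dehom mulrA.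
(* Vanishing at the origin would be a linear relation over [L] between the generic coordinates. All
   [beta i] would then vanish at the origin, although a combination of them is 1 modulo [F] and [F]
   vanishes there. *)
have h_origin : h.@[hpoint (xy 0 0) 1] != 0.
  rewrite hE mulf_neq0 //; apply/eqP => S0.
  pose G := \sum_i (beta i).@[fun=> 0] *: 'X_i : {mpoly L[r.+1]}.
  have G0 : G = 0.
    apply: (t_gen 1%N).
      by apply: rpred_sum => i _; apply: rpredZ; apply: dhomogXU.
    rewrite -[RHS]S0 raddf_sum; apply: eq_bigr => i _ /=.
    rewrite mmapZ mmapXU mulrC /= [in LHS]/meval rmorph_mmap; congr (_ * _).
    by apply: eq_mmap => // l'; rewrite /xy /= rmorph0; case: (l' == ord0).
  have [q Eq] := Ec; have := congr1 (meval (fun=> 0)) Eq.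
  rewrite mevalM F0 mulr0 mevalB meval1 raddf_sum /= => /subr0_eq.
  have -> : \sum_i (c i *: beta i).@[fun=> 0] = G.@[c].
    by rewrite raddf_sum; apply: eq_bigr => i _; rewrite /= !mevalZ mevalXU mulrC.
  by rewrite G0 meval0 => /eqP; rewrite eq_sym oner_eq0.
pose f := \sum_i t i *: map_mpoly cst (blowup (beta i)).
have fE x z : vv f.@[xy x z] = \sum_i vv (t i) * mmap iota (xy (vv x) (vv (x * z))) (beta i).
  have -> : f.@[xy x z] = \sum_i t i * (map_mpoly cst (blowup (beta i))).@[xy x z].
    by rewrite /f raddf_sum; apply: eq_bigr => i _ /=; rewrite mevalZ.
  rewrite rmorph_sum; apply: eq_bigr => i _ /=.
  rewrite rmorphM /= meval_map_mpoly mmap_blowup vv_mmap; congr (_ * _).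
  by apply: eq_mmap => // l'; rewrite comp_xy.
have hf x z : h.@[hpoint (xy (vv x) (vv (x * z))) 1] = 0 <-> f.@[xy x z] = 0.
  rewrite hE -fE; split=> [/eqP|->]; last by rewrite rmorph0 mulr0.
  by rewrite mulf_eq0 (negPf l0) vval_eq0 => /eqP.
(* The deformed curve reduces to [H], so the number of zeros near the branch is the order of [H]
   along it. *)
have Ef : map_mpoly res f = blowup H.
  rewrite /f raddf_sum -(dehom_homogenise H) -Eu /dehom.
  rewrite [X in blowup X]raddf_sum [RHS]raddf_sum; apply: eq_bigr => i _ /=.
  rewrite map_mpolyZ /= rt mmapZ -/(dehom _) mul_mpolyC /blowup mmapZ mul_mpolyC.
  congr (_ *: _); apply/mpolyP => n; rewrite !mcoeff_map_mpoly; exact: vres_const.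
have ordf : fps_ord (subst_series (slope_series eta) (map_mpoly res f)) k.
  by rewrite Ef (subst_slope eta0).
have [s [ss sP us]] := branch_zeros (slope_G EF eta0 etaF)
  (strict_transform_unramified EF eta0 etaF c0_neq0 a'_root eta_neq)
  (strict_transform_finite irrF EF eta0 etaF c0_neq0 a'_root eta_neq) ordf.
rewrite -ss; apply: (branch_intersection_card psi_degree psi_defined psi_model psi_inverse
  irrF EF eta0 eta'0 etaF eta'F c0_neq0 eta_neq cp cp' hom_h h_origin).
  by move=> x z; split=> [/sP[nb /hf]|[nb /hf fxz]]; [split | apply/sP].
case: us => // [[x [z [/sP[nb fxz] tf]]]]; exfalso.
have x0 : x <> 0.
  move=> x0; case/eqP: h_origin; have /hf := fxz; rewrite x0 mul0r rmorph0 => E0.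
  exact: E0.
exact: (no_double_zero irrF EF eta0 etaF c0_neq0 a'_root eta_neq sepF Ec Ed t_gen nb x0 fxz tf).
Qed.

End DeformationCard.

(** The second derivative of [F] in [Y] at the origin is [2 u0(0,0)], nonzero outside characteristic
    2. So [F_Y] is nonzero and of smaller degree in [Y] than [F]. *)
Lemma node_separable (L : closedFieldType) (F u0 u1 u2 : {mpoly L[2]}) :
  2%N \notin [pchar L] -> (1 < size (bipoly F))%N ->
  F = 'X_ord_max ^+ 2 * u0 + 'X_ord0 * 'X_ord_max * u1 + 'X_ord0 ^+ 2 * u2 ->
  u0.@[fun=> 0] != 0 -> ~ divides F F^`M(ord_max).
Proof.
move=> ch2 degF EF c0 [q Eq].
have D1 (j : 'I_2) : (1 : {mpoly L[2]})^`M(j) = 0 by rewrite -mpolyC1 mderivC.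
have F'0 : F^`M(ord_max) != 0.
  apply/eqP => E; have := congr1 (fun f => (f^`M(ord_max)).@[fun=> 0]) E.
  rewrite EF !expr2 !(mderivD, mderivM, mderivXU) /= !(mul0r, mulr0, mul1r, mulr1, add0r, addr0).
  rewrite !(mderivD, mderivM, mderivXU, D1, mderiv0) /= !(mul0r, mulr0, mul1r, mulr1, add0r, addr0).
  rewrite !mevalD !mevalM !mevalD !mevalXU !(meval0, meval1).
  rewrite !(mul0r, mulr0, mul1r, mulr1, add0r, addr0) -mulr2n => /eqP.
  rewrite mulf_eq0 (negPf c0) orbF => ch; move: ch2.
  by rewrite inE /= ch.
have q0 : q != 0 by apply: contraNneq F'0 => q0; rewrite Eq q0 mul0r.
have bq0 : bipoly q != 0 by apply: contraNneq q0 => E; rewrite -(bipolyK q) E rmorph0.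
have F0 : bipoly F != 0 by rewrite -size_poly_gt0 (leq_trans _ degF).
have := lt_size_deriv F0; rewrite -bipoly_deriv Eq rmorphM /= size_mul //.
by rewrite ltnNge -ltnS prednK ?addn_gt0 ?size_poly_gt0 ?bq0 // -add1n leq_add2r size_poly_gt0 bq0.
Qed.

Theorem theorem1p7 (L K : closedFieldType) (iota : {rmorphism L -> K})
    (O : {pred K}) (F : {mpoly L[2]}) (M : nonsingular_model F)
    (eta1 eta2 : {fps L}) (U : {fps {fps L}}) :
  2%N \notin [pchar L] ->
  infinitesimal_extension iota O ->
  irreducible_elt F ->
  ordinary_double_point F ->
  ~ tangent_line F 'X_ord0 ->
  eta1 0%N = 0 -> eta2 0%N = 0 -> eta1 1%N != eta2 1%N ->
  U 0%N 0%N != 0 ->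
  mpoly_series F = U * (fpsX - fpsC eta1) * (fpsX - fpsC eta2) ->
  exists p1 p2 : pspace L (ns_dim M),
    [/\ p1 != p2,
        forall p, branch_centred_at (origin L 2) p <-> p = p1 \/ p = p2 &
        forall H : {mpoly L[2]}, (1 < msize H)%N -> H.@[fun=> 0] = 0 ->
          ((subst_series eta1 H = 0 \/ subst_series eta2 H = 0) <->
             divides F H) /\
          (~ divides F H ->
             (exists2 m, fps_ord (subst_series eta1 H) m &
                branch_multiplicity iota O p1 H m) /\
             (exists2 m, fps_ord (subst_series eta2 H) m &
                branch_multiplicity iota O p2 H m))].
Proof.
move=> ch2 [trK valO constO nontrivO resO] irrF [F0 F00 F1 F2 _] _ eta10 eta20 eta_neq _ EF2.
pose V : residue_ring iota := ResidueRing valO constO nontrivO resO.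
have eta2F : subst_series eta2 F = 0 := subst_series_factor eta20 EF2.
have eta1F : subst_series eta1 F = 0.
  by apply: (subst_series_factor eta10); rewrite mulrAC in EF2; exact: EF2.
have [u0 [u1 [u2 [EF EF'2]]]] := node_expand F00 F1.
have r1 := slope_root EF eta10 eta1F; have r2 := slope_root EF eta20 eta2F.
(* Otherwise the two distinct slopes would be roots of [c1 z + c2], forcing [c1 = c2 = 0] and a zero
   tangent cone. *)
have c0 : u0.@[fun=> 0] != 0.
  apply: contraNneq F2 => c0; rewrite EF'2.
  move: r1 r2; rewrite c0 !mul0r !add0r => r1 r2.
  have c1 : u1.@[fun=> 0] = 0.
    have d0 : eta1 1%N - eta2 1%N != 0 by rewrite subr_eq0.
    apply: (mulIf d0); rewrite mul0r mulrBr; apply/eqP; rewrite subr_eq0; apply/eqP.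
    by apply: (addIr u2.@[fun=> 0]); rewrite r1 r2.
  by move: r1; rewrite c1 mul0r add0r => ->; rewrite !scale0r !addr0.
have eta_neq' : eta2 1%N != eta1 1%N by rewrite eq_sym.
have degF := branch_degY irrF eta1F.
have sepF := node_separable ch2 degF EF c0.
have [psi [pd pdef pm pinv]] := ns_birational M.
have [m1 [p1 cp1]] := center_exists pd pdef irrF eta1F.
have [m2 [p2 cp2]] := center_exists pd pdef irrF eta2F.
exists p1, p2; split.
- exact: (centers_neq V pd pdef pm irrF EF eta10 eta20 eta1F eta2F c0 eta_neq cp1 cp2).
- move=> p; split.
    exact: (over_origin_center V pd pdef pm pinv irrF EF eta10 eta20 eta1F eta2F c0 eta_neq cp1 cp2).
  case=> ->.
    exact: (center_branch V pd pdef pm irrF EF eta10 eta1F c0 r2 eta_neq cp1).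
  exact: (center_branch V pd pdef pm irrF EF eta20 eta2F c0 r1 eta_neq' cp2).
move=> H Hdeg _; split.
  split=> [[/(subst_series_divides irrF eta1F)|/(subst_series_divides irrF eta2F)]|dv] //.
  by left; apply/(subst_series_divides irrF eta1F).
move=> nFH; have gen := generic_deformation_exists V irrF degF nFH trK.
have ord eta : subst_series eta F = 0 -> exists m, fps_ord (subst_series eta H) m.
  by move=> etaF; apply: fps_neq0_ord => /(subst_series_divides irrF etaF).
split; [have [m om] := ord _ eta1F | have [m om] := ord _ eta2F]; exists m => //; split=> // r b v.
  exact: (deformation_card (V := V) pd pdef pm pinv irrF EF eta10 eta20 eta1F eta2F c0 eta_neq sepF cp1 cp2 Hdeg om).
exact: (deformation_card (V := V) pd pdef pm pinv irrF EF eta20 eta10 eta2F eta1F c0 eta_neq' sepF cp2 cp1 Hdeg om).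
Qed.
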